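(* Let $(A,\mu,\lambda,\eta,\varepsilon)$ be a biunital coFrobenius bialgebra over a discrete field $\mathbf{k}$, with copairing $c=(-1)^{|\lambda||\mu|+|\mu|}\lambda\eta\in A\otimes^!A$ and pairing $p=(-1)^{|\lambda|}\varepsilon\mu:A\otimes^*A\to\mathbf{k}$. Then, in addition to the identities $$(1\otimes\mu\otimes 1)(c\otimes c)=(\lambda\otimes 1)c,\qquad (-1)^{|p||\mu|}(p\otimes p)(1\otimes\lambda\otimes 1)=p(\mu\otimes 1),$$ $$(\mu\otimes 1)(1\otimes\lambda)=(1\otimes\mu)(\lambda\otimes 1)=(\mu\otimes\mu)(1\otimes c\otimes 1)=(-1)^{|\lambda||\mu|}(1\otimes p\otimes 1)(\lambda\otimes\lambda)=(-1)^{|\lambda||\mu|}\lambda\mu,$$ the following identities hold: $$p(\mu\otimes 1)=(-1)^{|\mu|}p(1\otimes\mu),\qquad (\lambda\otimes 1)c=(-1)^{|\lambda|}(1\otimes\lambda)c,$$ $$(-1)^{|\lambda|}\varepsilon=p(1\otimes\eta)=(-1)^{|\mu|}p(\eta\otimes 1),$$ $$(-1)^{|\lambda||\mu|+|\mu|}\eta=(\varepsilon\otimes 1)c=(-1)^{|\lambda|}(1\otimes\varepsilon)c,$$ $$(1\otimes p)(c\otimes 1)=(-1)^{|\lambda|+|\mu|}(p\otimes 1)(1\otimes c)=1.$$ In particular, $(A,\mu,\lambda,\eta,\varepsilon)$ is a biunital infinitesimal anti-symmetric bialgebra.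
   Context: **Tate vector spaces.** $\mathbf{k}$ is a field with the discrete topology. A linearly topologized vector space is a $\mathbf{k}$-vector space with a Hausdorff translation-invariant topology having a neighbourhood basis of $0$ consisting of open linear subspaces; morphisms are continuous linear maps. Its completion is $\widehat A=\varprojlim_U A/U$ ($U$ ranging over open linear subspaces, each $A/U$ discrete, limit topologized inside the product); $A$ is complete if $A\to\widehat A$ is an isomorphism. $A$ is linearly compact if it is complete and $\dim A/U<\infty$ for every open linear subspace $U$; $A$ is Tate if it is complete and has an open linearly compact subspace. The dual $A^\vee=\mathrm{Hom}(A,\mathbf{k})$ (continuous linear maps) has neighbourhood basis of $0$ given by the annihilators $L^\perp$, $L\subset A$ linearly compact. On the algebraic tensor product $A\otimes B$: a linear subspace $Q$ is open in the $*$ topology iff (i) $U\otimes V\subset Q$ for some open linear $U\subset A,V\subset B$, (ii) for each $a\in A$ there is an open linear $V\subset B$ with $a\otimes V\subset Q$, (iii) for each $b\in B$ there is an open linear $U\subset A$ with $U\otimes b\subset Q$; it is open in the $!$ topology iff $U\otimes B+A\otimes V\subset Q$ for some open linear $U,V$. Completions: $A\hat\otimes^*B$, $A\hat\otimes^!B$. **Graded version.** A graded Tate vector space is $A=\bigoplus_{i\in\mathbb{Z}}A_i$ with each $A_i$ Tate; a homogeneous map of degree $k$ is a collection of continuous linear maps $A_i\to B_{i+k}$, and all maps and elements considered are homogeneous, with degree denoted $|\cdot|$. $A^\vee=\bigoplus_i A^\vee_i$, $A_i^\vee=\mathrm{Hom}(A_{-i},\mathbf{k})$. $(A\otimes^*B)_k=\bigoplus_{i+j=k}A_i\hat\otimes^*B_j$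 and $(A\otimes^!B)_k=\prod_{i+j=k}A_i\hat\otimes^!B_j$. Both are commutative and associative up to canonical isomorphism, and the identity induces canonical continuous maps $A\otimes^*B\to A\otimes^!B$ and $A\otimes^*(B\otimes^!C)\to(A\otimes^*B)\otimes^!C$, which are inserted tacitly in compositions (e.g. $(\mu\otimes1)(1\otimes\lambda)$ is $A\otimes^*A\to A\otimes^*(A\otimes^!A)\to(A\otimes^*A)\otimes^!A\to A\otimes^!A$). Identities involving both $\mu$ and $\lambda$ on two inputs are between maps $A\otimes^*A\to A\otimes^!A$. **Signs.** $1$ is the identity map; $(\varphi\otimes\psi)(a\otimes b)=(-1)^{|\psi||a|}\varphi(a)\otimes\psi(b)$; $\tau(a\otimes b)=(-1)^{|a||b|}b\otimes a$; elements are viewed as maps from $\mathbf{k}$. A product is a map $\mu:A\otimes^*A\to A$; it is associative if $\mu(\mu\otimes1)=(-1)^{|\mu|}\mu(1\otimes\mu)$; $\eta\in A$ is a unit if $(-1)^{|\mu|}\mu(\eta\otimes1)=1=\mu(1\otimes\eta)$. A coproduct is a map $\lambda:A\to A\otimes^!A$; it is coassociative if $(\lambda\otimes1)\lambda=(-1)^{|\lambda|}(1\otimes\lambda)\lambda$; $\varepsilon:A\to\mathbf{k}$ is a counit if $(\varepsilon\otimes1)\lambda=1=(-1)^{|\lambda|}(1\otimes\varepsilon)\lambda$. **Biunital coFrobenius bialgebra.** A graded Tate vector space $A$ with an associative product $\mu$ with unit $\eta$ and a coassociative coproduct $\lambda$ with counit $\varepsilon$ such that, with $c$ and $p$ as in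 the claim, $\lambda=(1\otimes\mu)(c\otimes1)=(-1)^{|\mu|}(\mu\otimes1)(1\otimes c)$, $\mu=(-1)^{|\mu||\lambda|+|\lambda|}(p\otimes1)(1\otimes\lambda)=(-1)^{|\mu||\lambda|}(1\otimes p)(\lambda\otimes1)$, $\tau c=(-1)^{|\lambda|}c$ and $p\tau=(-1)^{|\mu|}p$. **Biunital infinitesimal anti-symmetric bialgebra.** A graded Tate vector space $A$ with an associative product $\mu$ with unit $\eta$ and a coassociative coproduct $\lambda$ with counit $\varepsilon$ satisfying: (1) $\lambda\mu=(-1)^{|\lambda||\mu|}\big((1\otimes\mu)(\lambda\otimes1)+(\mu\otimes1)(1\otimes\lambda)\big)-(-1)^{|\lambda|}(1\otimes\varepsilon\mu\otimes1)(\lambda\otimes\lambda)$ and $(-1)^{|\lambda|}(1\otimes\varepsilon\mu\otimes1)(\lambda\otimes\lambda)=(-1)^{|\mu|}(\mu\otimes\mu)(1\otimes\lambda\eta\otimes1)$; (2) $(-1)^{|\mu|(|\lambda|+1)}(1\otimes\mu)(\tau\lambda\otimes1)+(-1)^{|\lambda|(|\mu|+1)}(\mu\tau\otimes1)(1\otimes\lambda)-(-1)^{|\lambda|+|\mu|}(\mu\tau\otimes\mu)(1\otimes\lambda\eta\otimes1)=(-1)^{|\lambda||\mu|}\tau(1\otimes\mu\tau)(\lambda\otimes1)-(-1)^{(|\lambda|+1)(|\mu|+1)}\tau(\mu\otimes1)(1\otimes\tau\lambda)-(-1)^{|\mu|}\tau(\mu\otimes\mu\tau)(1\otimes\lambda\eta\otimes1)$;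 (3) $(\mu\tau\otimes\mu)(1\otimes\lambda\eta\otimes1)=(1\otimes\varepsilon\mu\otimes1)(\tau\lambda\otimes\lambda)$ and $(\mu\otimes\mu\tau)(1\otimes\lambda\eta\otimes1)=(1\otimes\varepsilon\mu\otimes1)(\lambda\otimes\tau\lambda)$. *)

(* Defs.v *)
From HB Require Import structures.
From mathcomp Require Import all_boot all_order all_algebra generic_quotient.
From mathcomp Require Import boolp classical_sets functions cardinality fsbigop.
From mathcomp Require Import topology.

Set Implicit Arguments.
Unset Strict Implicit.
Unset Printing Implicit Defensive.

Import GRing.Theory.
Local Open Scope quotient_scope.
Local Open Scope classical_set_scope.
Local Open Scope ring_scope.

Section LinearAlgebra.
Variable k : fieldType.

Definition subspace (V : lmodType k) (U : set V) : Prop :=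
  U 0 /\ forall (c : k) u v, U u -> U v -> U (c *: u + v).

Definition linspan (V : lmodType k) (S : set V) : set V := smallest (@subspace V) S.

Lemma subspaceD (V : lmodType k) (U : set V) u v :
  subspace U -> U u -> U v -> U (u + v).
Proof. by move=> [_ h] uU vU; rewrite -[u]scale1r; apply: h. Qed.

Lemma subspaceZ (V : lmodType k) (U : set V) c u : subspace U -> U u -> U (c *: u).
Proof. by move=> [h0 h] uU; rewrite -[_ *: _]addr0; apply: h. Qed.

Lemma subspaceN (V : lmodType k) (U : set V) u : subspace U -> U u -> U (- u).
Proof. by move=> sU uU; rewrite -scaleN1r; apply: subspaceZ. Qed.

Lemma subspaceB (V : lmodType k) (U : set V) u v :
  subspace U -> U u -> U v -> U (u - v).
Proof. by move=> sU uU vU; apply: subspaceD => //; apply: subspaceN. Qed.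

Lemma subspaceT (V : lmodType k) : subspace (@setT V).
Proof. by split. Qed.

Lemma subspaceI (V : lmodType k) (U W : set V) :
  subspace U -> subspace W -> subspace (U `&` W).
Proof.
move=> [U0 hU] [W0 hW]; split=> // c u v [? ?] [? ?].
by split; [apply: hU|apply: hW].
Qed.

Lemma subspace0 (V : lmodType k) : subspace [set (0 : V)].
Proof. by split=> // c u v /= -> ->; rewrite scaler0 addr0. Qed.

Lemma linspan_subspace (V : lmodType k) (S : set V) : subspace (linspan S).
Proof.
split=> [W [[W0 _] _] //|c u v hu hv W hW].
by case: (hW) => -[_ h] _; apply: h; [apply: hu|apply: hv].
Qed.

Record subsp (V : lmodType k) := Subsp {
  subsp_set :> set V;
  subspP : subspace subsp_set }.

Definition pmod (I : Type) (X : I -> lmodType k) := forall i, X i.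

Section Product.
Variables (I : Type) (X : I -> lmodType k).
Local Notation P := (pmod X).

HB.instance Definition _ := gen_eqMixin P.
HB.instance Definition _ := gen_choiceMixin P.

Let zero : P := fun=> 0.
Let opp (x : P) : P := fun i => - x i.
Let add (x y : P) : P := fun i => x i + y i.
Let scale (c : k) (x : P) : P := fun i => c *: x i.

Let addA : associative add.
Proof. by move=> x y z; apply: functional_extensionality_dep => i; rewrite /add addrA. Qed.
Let addC : commutative add.
Proof. by move=> x y; apply: functional_extensionality_dep => i; rewrite /add addrC. Qed.
Let add0 : left_id zero add.
Proof. by move=> x; apply: functional_extensionality_dep => i; rewrite /add add0r. Qed.
Let addN : left_inverse zero opp add.
Proof. by move=> x; apply: functional_extensionality_dep => i; rewrite /add addNr. Qed.
HB.instance Definition _ := GRing.isZmodule.Build P addA addC add0 addN.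

Let scaleA c d (x : P) : scale c (scale d x) = scale (c * d) x.
Proof. by apply: functional_extensionality_dep => i; rewrite /scale scalerA. Qed.
Let scale1 : left_id 1 scale.
Proof. by move=> x; apply: functional_extensionality_dep => i; rewrite /scale scale1r. Qed.
Let scaleDr : right_distributive scale +%R.
Proof. by move=> c x y; apply: functional_extensionality_dep => i; rewrite /scale scalerDr. Qed.
Let scaleDl x : {morph scale^~ x : c d / c + d}.
Proof. by move=> c d; apply: functional_extensionality_dep => i; rewrite /scale scalerDl. Qed.
HB.instance Definition _ :=
  GRing.Zmodule_isLmodule.Build k P scaleA scale1 scaleDr scaleDl.

Lemma pmodD (x y : P) i : (x + y) i = x i + y i. Proof. by []. Qed.
Lemma pmodZ c (x : P) i : (c *: x) i = c *: x i. Proof. by []. Qed.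
Lemma pmod0 i : (0 : P) i = 0. Proof. by []. Qed.
End Product.

Section Sub.
Variables (V : lmodType k) (U : subsp V).

Record submod := Submod { submod_val :> V; submodP : subsp_set U submod_val }.

Lemma submod_inj (x y : submod) : x = y :> V -> x = y.
Proof.
case: x y => x hx [y hy] /= exy; case: y / exy hy => hy.
by rewrite (Prop_irrelevance hx hy).
Qed.

HB.instance Definition _ := gen_eqMixin submod.
HB.instance Definition _ := gen_choiceMixin submod.

Let zero := Submod (proj1 (subspP U)).
Let opp x := Submod (subspaceN (subspP U) (submodP x)).
Let add x y := Submod (subspaceD (subspP U) (submodP x) (submodP y)).
Let scale c x := Submod (subspaceZ c (subspP U) (submodP x)).

Let addA : associative add.
Proof. by move=> x y z; apply: submod_inj; rewrite /= addrA. Qed.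
Let addC : commutative add.
Proof. by move=> x y; apply: submod_inj; rewrite /= addrC. Qed.
Let add0 : left_id zero add.
Proof. by move=> x; apply: submod_inj; rewrite /= add0r. Qed.
Let addN : left_inverse zero opp add.
Proof. by move=> x; apply: submod_inj; rewrite /= addNr. Qed.
HB.instance Definition _ := GRing.isZmodule.Build submod addA addC add0 addN.

Let scaleA c d x : scale c (scale d x) = scale (c * d) x.
Proof. by apply: submod_inj; rewrite /= scalerA. Qed.
Let scale1 : left_id 1 scale.
Proof. by move=> x; apply: submod_inj; rewrite /= scale1r. Qed.
Let scaleDr : right_distributive scale +%R.
Proof. by move=> c x y; apply: submod_inj; rewrite /= scalerDr. Qed.
Let scaleDl x : {morph scale^~ x : c d / c + d}.
Proof. by move=> c d; apply: submod_inj; rewrite /= scalerDl. Qed.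
HB.instance Definition _ :=
  GRing.Zmodule_isLmodule.Build k submod scaleA scale1 scaleDr scaleDl.
End Sub.

(* [qmod S] is the quotient of V by the span of S; it is V / S when S is a
   subspace. *)
Section Quotient.
Variables (V : lmodType k) (S : set V).

Definition qequiv (x y : V) : bool := `[< linspan S (x - y) >].

Let qequiv_equiv : equiv_class_of qequiv.
Proof.
have sS := linspan_subspace S.
split=> [x|x y|y x z].
- by apply/asboolP; rewrite subrr; case: sS.
- by apply/idP/idP => /asboolP h; apply/asboolP; rewrite -opprB; apply: (subspaceN sS).
- move=> /asboolP h1 /asboolP h2; apply/asboolP.
  by rewrite -[x](addrNK y) -addrA; apply: (subspaceD sS).
Qed.

Canonical qequiv_equivrel := EquivRelPack qequiv_equiv.

Definition qmod := {eq_quot qequiv}.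
HB.instance Definition _ : EqQuotient V qequiv qmod := EqQuotient.on qmod.
HB.instance Definition _ := Choice.on qmod.

Definition qpi (x : V) : qmod := \pi_qmod x.

Lemma qpiP x y : qpi x = qpi y <-> linspan S (x - y).
Proof.
split; first by move/eqmodP/asboolP.
by move=> h; apply/eqmodP/asboolP.
Qed.

Lemma qpi_surj (q : qmod) : exists x, q = qpi x.
Proof. by exists (repr q); rewrite /qpi reprK. Qed.

Let zero := qpi 0.
Let opp (q : qmod) := qpi (- repr q).
Let add (q r : qmod) := qpi (repr q + repr r).
Let scale c (q : qmod) := qpi (c *: repr q).

Let reprB x : linspan S (repr (qpi x) - x).
Proof. by apply/qpiP; rewrite /qpi reprK. Qed.

Let qN x : opp (qpi x) = qpi (- x).
Proof.
apply/qpiP; rewrite -opprD; exact: (subspaceN (linspan_subspace S) (reprB x)).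
Qed.
Let qD x y : add (qpi x) (qpi y) = qpi (x + y).
Proof.
apply/qpiP; rewrite opprD addrACA.
exact: (subspaceD (linspan_subspace S) (reprB x) (reprB y)).
Qed.
Let qZ c x : scale c (qpi x) = qpi (c *: x).
Proof.
apply/qpiP; rewrite -scalerBr.
exact: (subspaceZ c (linspan_subspace S) (reprB x)).
Qed.

Let addA : associative add.
Proof.
move=> x y z; have [u ->] := qpi_surj x; have [v ->] := qpi_surj y; have [w ->] := qpi_surj z.
by rewrite !qD addrA.
Qed.
Let addC : commutative add.
Proof.
move=> x y; have [u ->] := qpi_surj x; have [v ->] := qpi_surj y.
by rewrite !qD addrC.
Qed.
Let add0 : left_id zero add.
Proof. by move=> x; have [u ->] := qpi_surj x; rewrite qD add0r. Qed.
Let addN : left_inverse zero opp add.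
Proof. by move=> x; have [u ->] := qpi_surj x; rewrite qN qD addNr. Qed.
HB.instance Definition _ := GRing.isZmodule.Build qmod addA addC add0 addN.

Lemma qpiD x y : qpi (x + y) = qpi x + qpi y. Proof. by rewrite -qD. Qed.

Let scaleA c d x : scale c (scale d x) = scale (c * d) x.
Proof. by have [u ->] := qpi_surj x; rewrite !qZ scalerA. Qed.
Let scale1 : left_id 1 scale.
Proof. by move=> x; have [u ->] := qpi_surj x; rewrite qZ scale1r. Qed.
Let scaleDr : right_distributive scale +%R.
Proof.
move=> c x y; have [u ->] := qpi_surj x; have [v ->] := qpi_surj y.
by rewrite -qpiD !qZ scalerDr qpiD.
Qed.
Let scaleDl x : {morph scale^~ x : c d / c + d}.
Proof.
by move=> c d; have [u ->] := qpi_surj x; rewrite !qZ scalerDl qpiD.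
Qed.
HB.instance Definition _ :=
  GRing.Zmodule_isLmodule.Build k qmod scaleA scale1 scaleDr scaleDl.

Lemma qpiZ c x : qpi (c *: x) = c *: qpi x. Proof. by rewrite -qZ. Qed.
Lemma qpi0 : qpi 0 = 0. Proof. by []. Qed.
Lemma qpiN x : qpi (- x) = - qpi x. Proof. by rewrite -qN. Qed.
End Quotient.

Definition findim (V : lmodType k) : Prop :=
  exists n (e : 'I_n -> V), forall v, exists c : 'I_n -> k, v = \sum_i c i *: e i.

Section DirectSum.
Variables (I : eqType) (X : I -> lmodType k).

Definition finsupp (x : pmod X) : Prop := finite_set [set i | x i != 0].

Lemma finsupp_subspace : subspace finsupp.
Proof.
split=> [|c u v hu hv].
  by rewrite /finsupp (_ : [set _ | _] = set0) // -subset0 => i; rewrite /= eqxx.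
apply: (@sub_finite_set _ _ ([set i | u i != 0] `|` [set i | v i != 0])); last first.
  by rewrite finite_setU.
move=> i /=; rewrite pmodD pmodZ; have [->|uN0] := eqVneq (u i) 0; last by left.
by rewrite scaler0 add0r; right.
Qed.

Definition summod := submod (Subsp finsupp_subspace).
HB.instance Definition _ := GRing.Lmodule.on summod.

Definition coord (x : summod) (i : I) : X i := (submod_val x : pmod X) i.

Definition single (i : I) (v : X i) : pmod X :=
  @dfwith I (fun j => X j) (fun=> 0) i v.

Lemma single_finsupp i (v : X i) : finsupp (single v).
Proof.
apply: (@sub_finite_set _ _ [set i]); last exact: finite_set1.
move=> j /=; have [->//|ji] := eqVneq j i.
by rewrite /single dfwith_out ?eqxx // eq_sym.
Qed.

Definition inj (i : I) (v : X i) : summod := @Submod _ (Subsp finsupp_subspace) _ (single_finsupp v).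
End DirectSum.

(* Algebraic tensor product: the free vector space on A * B modulo the
   bilinearity relations. *)
Section Tensor.
Variables A B : lmodType k.

Definition freemod := summod (fun _ : A * B => (k^o : lmodType k)).

Definition basis (a : A) (b : B) : freemod :=
  inj (X := fun _ : A * B => (k^o : lmodType k)) (i := (a, b)) 1.

Definition bilinear_rel : set freemod :=
  [set x | (exists c a a' b, x = basis (c *: a + a') b - (c *: basis a b + basis a' b)) \/
           (exists c a b b', x = basis a (c *: b + b') - (c *: basis a b + basis a b'))].

Definition tensor := qmod bilinear_rel.
HB.instance Definition _ := GRing.Lmodule.on tensor.

Definition pure (a : A) (b : B) : tensor := qpi bilinear_rel (basis a b).

Definition tlift (C : lmodType k) (f : A -> B -> C) (x : tensor) : C :=
  \sum_(p \in [set: A * B]) coord (repr x : freemod) p *: f p.1 p.2.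
End Tensor.

End LinearAlgebra.

HB.mixin Record isLinearlyTopologized (k : fieldType) V
    & Topological V & GRing.Lmodule k V := {
  open_translate : forall (a : V) (U : set V), open U -> open [set a + u | u in U];
  ltvs_hausdorff : hausdorff_space V;
  ltvs_nbhs0 : forall N : set V, nbhs (0 : V) N ->
    exists U : set V, [/\ open U, subspace U & U `<=` N]
}.

#[short(type="ltvsType")]
HB.structure Definition LTVS (k : fieldType) :=
  {V of Topological V & GRing.Lmodule k V & isLinearlyTopologized k V}.

HB.factory Record isLinearBase (k : fieldType) V & GRing.Lmodule k V := {
  lbase : set (set V);
  lbase_subspace : forall U, lbase U -> subspace U;
  lbase_ex : exists U, lbase U;
  lbase_dir : forall U W, lbase U -> lbase W ->
    exists2 Z, lbase Z & Z `<=` U `&` W;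
  lbase_sep : forall x, (forall U, lbase U -> U x) -> x = 0
}.

HB.builders Context (k : fieldType) V & isLinearBase k V.

Definition lin_nbhs (x : V) : set_system V :=
  [set N | exists2 U, lbase U & forall u, U u -> N (x + u)].

HB.instance Definition _ := hasNbhs.Build V lin_nbhs.

Let lin_filter x : ProperFilter (lin_nbhs x).
Proof.
apply: Build_ProperFilter_ex.
  by move=> N [U hU hN]; exists (x + 0); apply: hN; case: (lbase_subspace hU).
split.
- by have [U hU] := lbase_ex; exists U.
- move=> M N [U hU hM] [W hW hN]; have [Z hZ ZUW] := lbase_dir hU hW.
  by exists Z => // u /ZUW[Uu Wu]; split; [apply: hM|apply: hN].
- by move=> M N MN [U hU hM]; exists U => // u /hM /MN.
Qed.
Let lin_singleton x (N : set V) : lin_nbhs x N -> N x.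
Proof.
by move=> [U hU hN]; rewrite -[x]addr0; apply: hN; case: (lbase_subspace hU).
Qed.
Let lin_nbhs_nbhs x (N : set V) : lin_nbhs x N -> lin_nbhs x (lin_nbhs^~ N).
Proof.
move=> [U hU hN]; exists U => // u Uu; exists U => // v Uv; rewrite -addrA.
by apply: hN; apply: subspaceD (lbase_subspace hU) Uu Uv.
Qed.
HB.instance Definition _ :=
  Nbhs_isNbhsTopological.Build V lin_filter lin_singleton lin_nbhs_nbhs.

Let lin_openP (W : set V) : open W <-> forall x, W x -> lin_nbhs x W.
Proof. by rewrite openE. Qed.

Let lin_translate (a : V) (U : set V) : open U -> open [set a + u | u in U].
Proof.
move=> /lin_openP oU; apply/lin_openP => _ [u Uu <-].
have [W hW hu] := oU _ Uu; exists W => // w Ww; exists (u + w); first exact: hu.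
by rewrite addrA.
Qed.
Let lin_hausdorff : hausdorff_space V.
Proof.
move=> x y xy; apply/eqP; rewrite -subr_eq0; apply/eqP.
apply: lbase_sep => U hU; have sU := lbase_subspace hU.
have [||z [/= zx zy]] := xy [set x + u | u in U] [set y + u | u in U].
- by exists U => // u Uu; exists u.
- by exists U => // u Uu; exists u.
case: zx zy => u Uu <- [v Uv e].
have -> : x - y = v - u.
  by rewrite -[x](addrK u) -e addrAC [y + v]addrC addrK.
exact: subspaceB sU Uv Uu.
Qed.
Let lin_nbhs0 (N : set V) : nbhs (0 : V) N ->
  exists U : set V, [/\ open U, subspace U & U `<=` N].
Proof.
move=> [U hU hN]; have sU := lbase_subspace hU; exists U; split=> //.
  by apply/lin_openP => x Ux; exists U => // u Uu; apply: subspaceD sU Ux Uu.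
by move=> u Uu; rewrite -[u]add0r; apply: hN.
Qed.
HB.instance Definition _ :=
  isLinearlyTopologized.Build k V lin_translate lin_hausdorff lin_nbhs0.
HB.end.

Section LinearTopology.
Variable k : fieldType.

Definition open_subspace (A : ltvsType k) (U : set A) : Prop := open U /\ subspace U.

Lemma open_subspaceT (A : ltvsType k) : open_subspace (@setT A).
Proof. by split; [exact: openT|exact: subspaceT]. Qed.

Lemma open_subspaceI (A : ltvsType k) (U W : set A) :
  open_subspace U -> open_subspace W -> open_subspace (U `&` W).
Proof. by move=> [? ?] [? ?]; split; [exact: openI|exact: subspaceI]. Qed.

Lemma open_subspace_sep (A : ltvsType k) (x : A) :
  (forall U, open_subspace U -> U x) -> x = 0.
Proof.
move=> h; apply: ltvs_hausdorff => M N nM nN.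
have [U [oU sU UN]] := ltvs_nbhs0 _ nN.
by exists x; split; [exact: nbhs_singleton|apply: UN; apply: h].
Qed.

(* The open linear subspaces of a linear topology that need not be Hausdorff. *)
Record lintop (V : lmodType k) := Lintop {
  lopen : set (set V);
  lopen_subspace : forall U, lopen U -> subspace U;
  lopenT : lopen setT;
  lopenI : forall U W, lopen U -> lopen W -> lopen (U `&` W) }.

Definition ltvs_lintop (A : ltvsType k) : lintop A :=
  @Lintop A (@open_subspace A) (fun U hU => proj2 hU)
    (@open_subspaceT A) (@open_subspaceI A).

Lemma linspan_mono (V : lmodType k) (S T : set V) :
  S `<=` T -> linspan S `<=` linspan T.
Proof. by move=> ST x hx W [sW TW]; apply: hx; split=> // y /ST /TW. Qed.

Section Completion.
Variables (V : lmodType k) (T : lintop V).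

Definition lidx := {U : set V | lopen T U}.
Definition quotients (U : lidx) : lmodType k := qmod (sval U).

Definition compatible (x : pmod quotients) : Prop :=
  forall (U W : lidx) (v : V), sval U `<=` sval W ->
    x U = qpi (sval U) v -> x W = qpi (sval W) v.

Lemma compatible_subspace : subspace compatible.
Proof.
have mono (U W : lidx) v w : sval U `<=` sval W ->
    qpi (sval U) v = qpi (sval U) w -> qpi (sval W) v = qpi (sval W) w.
  by move=> UW /qpiP h; apply/qpiP; exact: linspan_mono h.
split=> [U W v UW|c x y hx hy U W v UW].
  by rewrite !pmod0 -!qpi0; exact: mono.
have [a xa] := qpi_surj (x U : qmod _); have [b yb] := qpi_surj (y U : qmod _).
rewrite !pmodD !pmodZ (hx _ _ _ UW xa) (hy _ _ _ UW yb) xa yb.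
by rewrite -!qpiZ -!qpiD; exact: mono.
Qed.

Definition completion := submod (Subsp compatible_subspace).
HB.instance Definition _ := GRing.Lmodule.on completion.

Definition residue (x : completion) (U : lidx) : qmod (sval U) :=
  (submod_val x : pmod quotients) U.

Lemma residueP (x : completion) (U W : lidx) v : sval U `<=` sval W ->
  residue x U = qpi (sval U) v -> residue x W = qpi (sval W) v.
Proof. exact: (submodP x). Qed.

Definition completion_base : set (set completion) :=
  [set N | exists U : lidx, N = [set x | residue x U = 0]].

Let base_subspace N : completion_base N -> subspace N.
Proof.
move=> [U ->]; split=> // c x y /= hx hy.
change (c *: residue x U + residue y U = 0).
by rewrite hx hy scaler0 addr0.
Qed.
Let base_ex : exists N, completion_base N.
Proof. by exists [set x | residue x (exist _ _ (lopenT T)) = 0]; eexists. Qed.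
Let base_dir N M : completion_base N -> completion_base M ->
  exists2 Z, completion_base Z & Z `<=` N `&` M.
Proof.
move=> [[U hU] ->] [[W hW] ->].
exists [set x | residue x (exist _ _ (lopenI hU hW)) = 0]; first by eexists.
move=> x /= hx; split; rewrite /= -qpi0.
- by apply: (@residueP x (exist _ _ (lopenI hU hW)) (exist _ U hU) 0) => [y []|].
- by apply: (@residueP x (exist _ _ (lopenI hU hW)) (exist _ W hW) 0) => [y []|].
Qed.
Let base_sep x : (forall N, completion_base N -> N x) -> x = 0.
Proof.
move=> h; apply: submod_inj; apply: functional_extensionality_dep => U.
by apply: (h [set y | residue y U = 0]); exists U.
Qed.
HB.instance Definition _ :=
  isLinearBase.Build k completion base_subspace base_ex base_dir base_sep.

Lemma canon_compatible (v : V) : compatible (fun U => qpi (sval U) v).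
Proof.
by move=> U W w UW /qpiP h; apply/qpiP; exact: linspan_mono h.
Qed.
Definition canon (v : V) : completion := @Submod _ _ (Subsp _) _ (@canon_compatible v).

(* The neighbourhood filter of x pulled back along canon. *)
Definition cauchy_filter (x : completion) : set_system V :=
  [set N | exists U : lidx, forall v, residue x U = qpi (sval U) v -> N v].

(* Extension by continuity; the limit exists and is unique when f is linear and
   continuous for T and C is complete. *)
Definition ext (C : ltvsType k) (f : V -> C) (x : completion) : C :=
  xget 0 [set y : C | f @ cauchy_filter x --> y].
End Completion.

Definition complete (A : ltvsType k) : Prop :=
  let i := @canon A (ltvs_lintop A) in
  continuous i /\
  exists j : completion (ltvs_lintop A) -> A,
    [/\ cancel i j, cancel j i & continuous j].

Section Subspace.
Variables (A : ltvsType k) (L : subsp A).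

Definition sub_ltvs := submod L.
HB.instance Definition _ := GRing.Lmodule.on sub_ltvs.

Definition sub_base : set (set sub_ltvs) :=
  [set N | exists2 U : set A, open_subspace U & N = [set x : sub_ltvs | U (submod_val x)]].

Let base_subspace N : sub_base N -> subspace N.
Proof. by move=> [U [_ [U0 hU]] ->]; split=> // c x y /= hx hy; apply: hU. Qed.
Let base_ex : exists N, sub_base N.
Proof. by eexists; exists setT; first exact: open_subspaceT. Qed.
Let base_dir N M : sub_base N -> sub_base M -> exists2 Z, sub_base Z & Z `<=` N `&` M.
Proof.
move=> [U hU ->] [W hW ->]; exists [set x : sub_ltvs | (U `&` W) (submod_val x)] => //.
by exists (U `&` W) => //; exact: open_subspaceI.
Qed.
Let base_sep x : (forall N, sub_base N -> N x) -> x = 0.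
Proof.
move=> h; apply: submod_inj; apply: open_subspace_sep => U hU.
by apply: (h [set x : sub_ltvs | U (submod_val x)]); exists U.
Qed.
HB.instance Definition _ :=
  isLinearBase.Build k sub_ltvs base_subspace base_ex base_dir base_sep.
End Subspace.

Definition linearly_compact (A : ltvsType k) : Prop :=
  complete A /\ forall U : set A, open_subspace U -> findim (qmod U).

Definition tate (A : ltvsType k) : Prop :=
  complete A /\ exists L : subsp A, open (subsp_set L) /\ linearly_compact (sub_ltvs L).

(* Direct sum with the finest linear topology making the inclusions continuous. *)
Section DirectSumTopology.
Variables (I : eqType) (X : I -> ltvsType k).

Definition dsum := summod X.
HB.instance Definition _ := GRing.Lmodule.on dsum.

Definition dsum_in (i : I) (v : X i) : dsum := inj v.

Definition dsum_base : set (set dsum) :=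
  [set N | subspace N /\ forall i, open [set v : X i | N (dsum_in v)]].

Let base_subspace N : dsum_base N -> subspace N. Proof. by case. Qed.
Let base_ex : exists N, dsum_base N.
Proof. by exists setT; split; [exact: subspaceT|move=> i; exact: openT]. Qed.
Let base_dir N M : dsum_base N -> dsum_base M -> exists2 Z, dsum_base Z & Z `<=` N `&` M.
Proof.
move=> [sN oN] [sM oM]; exists (N `&` M) => //; split; first exact: subspaceI.
by move=> i; exact: (openI (oN i) (oM i)).
Qed.
Let base_sep x : (forall N, dsum_base N -> N x) -> x = 0.
Proof.
move=> h; apply: submod_inj; apply: functional_extensionality_dep => i.
apply: open_subspace_sep => U [oU sU].
apply: (h [set y : dsum | U (coord y i)]); split.
  by case: sU => U0 hU; split=> // c y z /= hy hz; apply: (hU c).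
move=> j; have [<-|ij] := eqVneq i j.
  rewrite (_ : [set _ | _] = U) //; apply/seteqP; split=> v /=;
    by rewrite /dsum_in /coord /= /single dfwith_in.
rewrite (_ : [set _ | _] = setT); first exact: openT.
apply/seteqP; split=> v //= _; rewrite /dsum_in /coord /= /single dfwith_out 1?eq_sym //.
by case: sU.
Qed.
HB.instance Definition _ :=
  isLinearBase.Build k dsum base_subspace base_ex base_dir base_sep.
End DirectSumTopology.

Section ProductTopology.
Variables (I : eqType) (X : I -> ltvsType k).

Definition dprod := pmod X.
HB.instance Definition _ := GRing.Lmodule.on dprod.

Definition dprod_at (i : I) (x : dprod) : X i := (x : pmod X) i.

Definition dprod_base : set (set dprod) :=
  [set N | exists (F : set I) (U : forall i, set (X i)),
    [/\ finite_set F, forall i, open_subspace (U i) &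
        N = [set x | forall i, F i -> U i (dprod_at i x)]]].

Let base_subspace N : dprod_base N -> subspace N.
Proof.
move=> [F [U [_ hU ->]]]; split=> [i _|c x y /= hx hy i Fi]; case: (hU i) => _ [U0 h] //.
by apply: (h c); [exact: hx|exact: hy].
Qed.
Let base_ex : exists N, dprod_base N.
Proof.
by eexists; exists set0, (fun=> setT); split=> // i; exact: open_subspaceT.
Qed.
Let base_dir N M : dprod_base N -> dprod_base M ->
  exists2 Z, dprod_base Z & Z `<=` N `&` M.
Proof.
move=> [F [U [fF hU ->]]] [G [W [fG hW ->]]].
exists [set x | forall i, (F `|` G) i -> (U i `&` W i) (dprod_at i x)].
  exists (F `|` G), (fun i => U i `&` W i); split=> //; first by rewrite finite_setU.
  by move=> i; exact: open_subspaceI.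
by move=> x hx; split=> i hi; have [] := hx i; auto; [left|right].
Qed.
Let base_sep x : (forall N, dprod_base N -> N x) -> x = 0.
Proof.
move=> h; apply: functional_extensionality_dep => i.
apply: open_subspace_sep => U hU.
pose W j : set (X j) := dfwith (T := fun j => set (X j)) (fun=> setT) U j.
have := h [set y | forall j, [set i] j -> W j (dprod_at j y)].
rewrite /W /= => /(_ _ i erefl); rewrite dfwith_in; apply.
exists [set i], W; split=> //.
move=> j; rewrite /W; case: dfwithP => [|l _] //; exact: open_subspaceT.
Qed.
HB.instance Definition _ :=
  isLinearBase.Build k dprod base_subspace base_ex base_dir base_sep.
End ProductTopology.

Definition ground : Type := k.
HB.instance Definition _ := GRing.Lmodule.copy ground k^o.

Section Ground.
Definition ground_base : set (set ground) := [set [set 0]].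

Let base_subspace N : ground_base N -> subspace N.
Proof. by move=> ->; exact: subspace0. Qed.
Let base_ex : exists N, ground_base N. Proof. by exists [set 0]. Qed.
Let base_dir N M : ground_base N -> ground_base M ->
  exists2 Z, ground_base Z & Z `<=` N `&` M.
Proof. by move=> -> ->; exists [set 0]; rewrite ?setIid. Qed.
Let base_sep x : (forall N, ground_base N -> N x) -> x = 0.
Proof. by move=> /(_ [set 0]); apply. Qed.
HB.instance Definition _ :=
  isLinearBase.Build k ground base_subspace base_ex base_dir base_sep.
End Ground.

Section TensorTopology.
Variables A B : ltvsType k.

Definition star_open (Q : set (tensor A B)) : Prop :=
  [/\ subspace Q,
      exists (U : set A) (V : set B), [/\ open_subspace U, open_subspace V &
        forall a b, U a -> V b -> Q (pure a b)],
      forall a, exists2 V : set B, open_subspace V & forall b, V b -> Q (pure a b) &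
      forall b, exists2 U : set A, open_subspace U & forall a, U a -> Q (pure a b)].

Definition bang_open (Q : set (tensor A B)) : Prop :=
  subspace Q /\
  exists (U : set A) (V : set B), [/\ open_subspace U, open_subspace V &
    forall a b, U a \/ V b -> Q (pure a b)].

Let star_subspace Q : star_open Q -> subspace Q. Proof. by case. Qed.
Let starT : star_open setT.
Proof.
split; first exact: subspaceT.
- by exists setT, setT; split=> //; exact: open_subspaceT.
- by move=> ?; exists setT => //; exact: open_subspaceT.
- by move=> ?; exists setT => //; exact: open_subspaceT.
Qed.
Let starI P Q : star_open P -> star_open Q -> star_open (P `&` Q).
Proof.
move=> [sP [U [V [oU oV hP]]] hPa hPb] [sQ [U' [V' [oU' oV' hQ]]] hQa hQb].
split; first exact: subspaceI.
- exists (U `&` U'), (V `&` V'); split; [exact: open_subspaceI|exact: open_subspaceI|].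
  by move=> a b [? ?] [? ?]; split; [exact: hP|exact: hQ].
- move=> a; have [W oW hW] := hPa a; have [W' oW' hW'] := hQa a.
  exists (W `&` W'); first exact: open_subspaceI.
  by move=> b [? ?]; split; [exact: hW|exact: hW'].
- move=> b; have [W oW hW] := hPb b; have [W' oW' hW'] := hQb b.
  exists (W `&` W'); first exact: open_subspaceI.
  by move=> a [? ?]; split; [exact: hW|exact: hW'].
Qed.
Definition star_lintop : lintop (tensor A B) := Lintop star_subspace starT starI.

Let bang_subspace Q : bang_open Q -> subspace Q. Proof. by case. Qed.
Let bangT : bang_open setT.
Proof.
split; first exact: subspaceT.
by exists setT, setT; split=> //; exact: open_subspaceT.
Qed.
Let bangI P Q : bang_open P -> bang_open Q -> bang_open (P `&` Q).
Proof.
move=> [sP [U [V [oU oV hP]]]] [sQ [U' [V' [oU' oV' hQ]]]].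
split; first exact: subspaceI.
exists (U `&` U'), (V `&` V'); split; [exact: open_subspaceI|exact: open_subspaceI|].
by move=> a b [[? ?]|[? ?]]; split; ((apply: hP) || (apply: hQ)); auto.
Qed.
Definition bang_lintop : lintop (tensor A B) := Lintop bang_subspace bangT bangI.

Definition cstar : ltvsType k := completion star_lintop.
Definition cbang : ltvsType k := completion bang_lintop.

Definition ptstar (a : A) (b : B) : cstar := canon star_lintop (pure a b).
Definition ptbang (a : A) (b : B) : cbang := canon bang_lintop (pure a b).

(* Continuous linear maps out of the completed tensor products, from their
   values on pure tensors. *)
Definition star_lift (C : ltvsType k) (f : A -> B -> C) : cstar -> C := ext (tlift f).
Definition bang_lift (C : ltvsType k) (f : A -> B -> C) : cbang -> C := ext (tlift f).
End TensorTopology.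

Definition star_map (A A' B B' : ltvsType k) (f : A -> A') (g : B -> B') :
    cstar A B -> cstar A' B' :=
  star_lift (fun a b => ptstar (f a) (g b)).

Definition bang_map (A A' B B' : ltvsType k) (f : A -> A') (g : B -> B') :
    cbang A B -> cbang A' B' :=
  bang_lift (fun a b => ptbang (f a) (g b)).

Definition star_swap (A B : ltvsType k) : cstar A B -> cstar B A :=
  star_lift (fun a b => ptstar b a).

Definition bang_swap (A B : ltvsType k) : cbang A B -> cbang B A :=
  bang_lift (fun a b => ptbang b a).

(* a * (b * c) |-> (a * b) * c *)
Definition distl (A B C : ltvsType k) : cstar A (cbang B C) -> cbang (cstar A B) C :=
  star_lift (fun a => bang_map (ptstar a) id).

(* (a * b) * c |-> a * (b * c) *)
Definition distr (A B C : ltvsType k) : cstar (cbang A B) C -> cbang A (cstar B C) :=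
  star_lift (fun x c => bang_map id (fun b => ptstar b c) x).

Definition star_assoc (A B C : ltvsType k) :
    cstar (cstar A B) C -> cstar A (cstar B C) :=
  star_lift (fun x c => star_map id (fun b => ptstar b c) x).

Definition bang_assoc (A B C : ltvsType k) :
    cbang (cbang A B) C -> cbang A (cbang B C) :=
  bang_lift (fun x c => bang_map id (fun b => ptbang b c) x).

End LinearTopology.

(* The operators tlift and ext have their defining properties on linear and
   continuous data. *)
Section ExtensionTheory.
Variable k : fieldType.

Definition is_linear (V W : lmodType k) (f : V -> W) := forall c x y, f (c *: x + y) = c *: f x + f y.

Lemma fsum_sub (I : choiceType) (X : lmodType k) (F : I -> X) (P : set I) :
  finite_set P -> (forall i, F i != 0 -> P i) ->
  \sum_(i \in [set: I]) F i = \sum_(i \in P) F i.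
Proof.
move=> fP h; symmetry; apply: fsbig_widen => //.
move=> i /= [_ nP]; apply: contra_notP nP => /eqP; exact: h.
Qed.

Section bil.
Variables (A B C : lmodType k) (f : A -> B -> C).
Hypothesis fl : forall b, is_linear (fun a => f a b).
Hypothesis fr : forall a, is_linear (f a).
Let F (x : freemod A B) : C := \sum_(p \in [set: A * B]) coord x p *: f p.1 p.2.
Lemma Flin : is_linear F.
Proof.
move=> c x y; rewrite /F.
have fx := submodP x; have fy := submodP y.
pose P := [set p | coord x p != 0] `|` [set p | coord y p != 0].
have fP : finite_set P by rewrite finite_setU; split.
rewrite !(@fsum_sub _ _ _ P) //.
- rewrite !fsbig_finite //= scaler_sumr -big_split /=; apply: eq_bigr => p _.
  by rewrite scalerA -scalerDl.
- by move=> p; rewrite /P /=; have [->|] := eqVneq (coord y p) 0; [rewrite scale0r eqxx|move=> *; right].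
- by move=> p; rewrite /P /=; have [->|] := eqVneq (coord x p) 0; [rewrite scale0r eqxx|move=> *; left].
- move=> p; rewrite /P /=; have [e|] := eqVneq (coord x p) 0; last by left.
  have [e'|] := eqVneq (coord y p) 0; last by right.
  have -> : coord (c *: x + y) p *: f p.1 p.2 = (c * coord x p + coord y p) *: f p.1 p.2 by [].
  by rewrite e e' mulr0 addr0 scale0r eqxx.
Qed.
Lemma Fbasis a b : F (basis a b) = f a b.
Proof.
rewrite /F (@fsum_sub _ _ _ [set (a,b)]) //; last first.
  move=> p; have [-> _ //|pab] := eqVneq p (a, b).
  by rewrite /basis /coord /= /single dfwith_out ?scale0r ?eqxx // eq_sym.
by rewrite fsbig_set1 /basis /coord /= /single dfwith_in scale1r.
Qed.
Lemma tlift_pi x : tlift f (qpi (bilinear_rel (A:=A) (B:=B)) x) = F x.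
Proof.
rewrite /tlift -/(F _).
have /qpiP h : qpi (bilinear_rel (A:=A) (B:=B)) (repr (qpi (bilinear_rel (A:=A) (B:=B)) x)) = qpi _ x.
  by rewrite /qpi reprK.
have F0 : F 0 = 0 by have := Flin (-1) 0 0; rewrite scaleN1r addr0 oppr0 scaleN1r addNr.
have FB u v : F (u - v) = F u - F v.
  by have := Flin (-1) v u; rewrite !scaleN1r addrC => ->; rewrite addrC.
apply/eqP; rewrite -subr_eq0 -FB; apply/eqP.
apply: (h [set u | F u = 0]); split; first split=> //= c u v hu hv.
  by rewrite Flin hu hv scaler0 addr0.
move=> _ [[c [a [a' [b ->]]]]|[c [a [b [b' ->]]]]] /=.
  by rewrite FB Flin !Fbasis fl subrr.
by rewrite FB Flin !Fbasis fr subrr.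
Qed.
Lemma tlift_pure a b : tlift f (pure a b) = f a b.
Proof. by rewrite /pure tlift_pi Fbasis. Qed.
Lemma tlift_lin : is_linear (tlift f).
Proof.
move=> c x y; have [u ->] := qpi_surj x; have [v ->] := qpi_surj y.
by rewrite -qpiZ -qpiD !tlift_pi Flin.
Qed.
End bil.

Lemma linspan_id (V : lmodType k) (U : set V) : subspace U -> linspan U = U.
Proof.
move=> sU; apply/seteqP; split=> x.
  by move=> h; apply: h; split.
by move=> Ux W [_ UW]; exact: UW.
Qed.

Section E.
Variables (V : lmodType k) (T : lintop V) (C : ltvsType k) (f : V -> C).
Hypothesis fl : is_linear f.
Hypothesis fc : forall W, open_subspace W -> exists2 U, lopen T U & U `<=` f @^-1` W.

Lemma lin0 : f 0 = 0. Proof. by have := fl (-1) 0 0; rewrite scaleN1r addr0 oppr0 scaleN1r addNr. Qed.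
Lemma linB u v : f (u - v) = f u - f v.
Proof. by have := fl (-1) v u; rewrite !scaleN1r addrC => ->; rewrite addrC. Qed.

Lemma cauchyF x : ProperFilter (cauchy_filter (T:=T) x).
Proof.
apply: Build_ProperFilter_ex.
  move=> N [U h]; have [v e] := qpi_surj (residue x U); exists v; exact: h.
split.
- by exists (exist _ _ (lopenT T)).
- move=> M N [[U hU] hM] [[W hW] hN].
  exists (exist _ _ (lopenI hU hW)) => v e; split; [apply: hM|apply: hN].
    by apply: (residueP (W:=exist _ U hU)) e => y [].
  by apply: (residueP (W:=exist _ W hW)) e => y [].
- by move=> M N MN [U h]; exists U => v /h/MN.
Qed.

Lemma nbhs_sub (D : ltvsType k) (y : D) N : nbhs y N -> exists2 W, open_subspace W & forall w, W w -> N (y + w).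
Proof.
rewrite nbhsE => -[O [oO Oy] ON].
have o2 := open_translate (-y) _ oO.
have : nbhs (0:D) [set -y + u | u in O].
  by apply: open_nbhs_nbhs; split=> //; exists y => //; rewrite addNr.
move=> /ltvs_nbhs0 [U [oU sU h]]; exists U => // w /h [u Ou <-].
by rewrite addrA addrN add0r; apply: ON.
Qed.
Lemma sub_nbhs (D : ltvsType k) (y : D) W : open_subspace W -> nbhs y [set y + w | w in W].
Proof.
move=> [oW sW]; apply: open_nbhs_nbhs; split; first exact: open_translate.
by exists 0; [case: sW|rewrite addr0].
Qed.

Lemma ext_lim x y : (forall W, open_subspace W -> exists U : lidx T, forall v, residue x U = qpi (sval U) v -> W (f v - y)) ->
  ext f x = y.
Proof.
move=> h.
have cy : f @ cauchy_filter x --> y.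
  move=> N /nbhs_sub[W oW WN]; have [U hU] := h _ oW.
  exists U => v /hU /WN /=; by rewrite addrC subrK.
rewrite /ext; case: xgetP => [z _ /= cz|/(_ y)]; last by [].
have := cauchyF x => PF.
apply: (@ltvs_hausdorff k C) => M N nM nN.
have [v [Mv Nv]] : exists v, (f @^-1` M `&` f @^-1` N) v by apply: (@filter_ex _ (cauchy_filter x)); apply: filterI; [exact: cz|exact: cy].
by exists (f v).
Qed.

Lemma ext_canon v : ext f (canon T v) = f v.
Proof.
apply: ext_lim => W oW; have [U oU h] := fc oW; exists (exist _ U oU) => w /= /qpiP.
rewrite linspan_id; last exact: lopen_subspace oU.
move=> hv; rewrite -linB -opprB; apply: h; apply: subspaceN hv; apply: lopen_subspace oU.
Qed.
End E.

Lemma preim_open (A B : ltvsType k) (f : A -> B) W : is_linear f -> continuous f -> open_subspace W -> open_subspace (f @^-1` W).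
Proof.
move=> fl fc [oW sW]; split; first by apply: open_comp => // x _; exact: fc.
split; first by rewrite /= (lin0 fl); case: sW.
by move=> c x y /= hx hy; rewrite fl; apply: (proj2 sW).
Qed.

Lemma pureDl (A B : lmodType k) (b : B) : is_linear (fun a : A => pure a b).
Proof.
move=> c a a'; rewrite /pure -qpiZ -qpiD; apply/qpiP => W [_]; apply; left.
by exists c, a, a', b.
Qed.
Lemma pureDr (A B : lmodType k) (a : A) : is_linear (fun b : B => pure a b).
Proof.
move=> c b b'; rewrite /pure -qpiZ -qpiD; apply/qpiP => W [_]; apply; right.
by exists c, a, b, b'.
Qed.
Lemma canon_lin (V : lmodType k) (T : lintop V) : is_linear (canon T).
Proof.
move=> c x y; apply: submod_inj; apply: functional_extensionality_dep => U /=.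
by rewrite qpiD qpiZ.
Qed.
Lemma canon_cont (V : lmodType k) (T : lintop V) W : open_subspace W -> exists2 U, lopen T U & U `<=` canon T @^-1` W.
Proof.
move=> [oW sW]; have : nbhs (0 : completion T) W by apply: open_nbhs_nbhs; split=> //; case: sW.
move=> [N [[U hU] ->] h]; exists U => // v Uv /=.
rewrite -[canon _ _]add0r; apply: h => /=.
change (qpi U v = 0); rewrite -qpi0; apply/qpiP; rewrite subr0 linspan_id //; exact: lopen_subspace hU.
Qed.

Lemma star_map_pure (A A' B B' : ltvsType k) (f : A -> A') (g : B -> B') a b :
  is_linear f -> continuous f -> is_linear g -> continuous g ->
  star_map f g (ptstar a b) = ptstar (f a) (g b).
Proof.
move=> fl fc gl gc.
have bl b0 : is_linear (fun a => ptstar (f a) (g b0)).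
  by move=> c x y; rewrite fl /ptstar pureDl canon_lin.
have br a0 : is_linear (fun b => ptstar (f a0) (g b)).
  by move=> c x y; rewrite gl /ptstar pureDr canon_lin.
rewrite /star_map /star_lift /ptstar ext_canon; first by rewrite tlift_pure.
  exact: tlift_lin.
move=> W oW; have [Q [sQ hQ hQa hQb] QW] := canon_cont (T := star_lintop A' B') oW.
exists (tlift (fun a b => ptstar (f a) (g b)) @^-1` W) => //; split.
- split; first by rewrite /= lin0; [case: oW => _ []|exact: tlift_lin].
  by move=> c x y /= hx hy; rewrite tlift_lin //; apply: (proj2 (proj2 oW)).
- have [U [V [oU oV h]]] := hQ; exists (f @^-1` U), (g @^-1` V).
  split; [exact: preim_open|exact: preim_open|].
  by move=> x y /= hx hy; rewrite tlift_pure //; apply: QW; apply: h.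
- move=> x; have [V oV h] := hQa (f x); exists (g @^-1` V); first exact: preim_open.
  by move=> y /= hy; rewrite tlift_pure //; apply: QW; apply: h.
- move=> x; have [V oV h] := hQb (g x); exists (f @^-1` V); first exact: preim_open.
  by move=> y /= hy; rewrite tlift_pure //; apply: QW; apply: h.
Qed.

Lemma ext_cvg (V : lmodType k) (T : lintop V) (C : ltvsType k) (f : V -> C) (x : completion T) :
  is_linear f -> (forall W, open_subspace W -> exists2 U, lopen T U & U `<=` f @^-1` W) ->
  complete C -> forall W, open_subspace W -> exists U : lidx T, forall v, residue x U = qpi (sval U) v -> W (f v - ext f x).
Proof.
move=> fl fc [ci [j [ij ji cj]]].
pose T' := ltvs_lintop C.
have key (W : set C) : open_subspace W -> exists U : lidx T, sval U `<=` f @^-1` W.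
  by move=> /fc[U hU h]; exists (exist _ U hU).
pose Y (W : lidx T') : qmod (sval W) := qpi (sval W) (f (projT1 (cid (qpi_surj (residue x (projT1 (cid (key _ (svalP W))))))))).
have YP W (U : lidx T) v : sval U `<=` f @^-1` (sval W) -> residue x U = qpi _ v -> Y W = qpi _ (f v).
  move=> hU e; rewrite /Y; case: cid => U' hU' /=; case: cid => v' e' /=.
  apply/qpiP; rewrite linspan_id; last exact: (proj2 (svalP W)).
  rewrite -linB //.
  have [w ew] := qpi_surj (residue x (exist _ _ (lopenI (svalP U) (svalP U')))).
  have := residueP (W := U) _ ew => /(_ (fun y h => h.1)); rewrite e => /qpiP.
  rewrite linspan_id; last exact: lopen_subspace (svalP U). move=> /hU h1.
  have := residueP (W := U') _ ew => /(_ (fun y h => h.2)); rewrite e' => /qpiP.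
  rewrite linspan_id; last exact: lopen_subspace (svalP U'). move=> /hU' h2.
  have -> : v' - v = (v' - w) - (v - w) by rewrite opprB addrA subrK.
  by rewrite linB //; apply: subspaceB; [exact: (proj2 (svalP W))| |].
have Yc : compatible (T := T') Y.
  move=> W W' c WW' e; have [U hU] := key _ (svalP W).
  have [v ev] := qpi_surj (residue x U).
  rewrite (YP W' U v) //; last by apply: subset_trans hU _ => y /WW'.
  rewrite (YP W U v) // in e; apply/qpiP; apply: (linspan_mono WW'); exact/qpiP.
pose y := j (@Submod _ _ (Subsp (@compatible_subspace _ _ T')) _ Yc).
have yP W : open_subspace W -> exists U : lidx T, forall v, residue x U = qpi (sval U) v -> W (f v - y).
  move=> oW; have [U hU] := key _ oW; exists U => v ev.
  have := YP (exist _ W oW) U v hU ev.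
  have <- : residue (canon T' y) (exist _ W oW) = Y (exist _ W oW) by rewrite /y ji.
  move=> /esym/qpiP /=; rewrite linspan_id //; by case: oW.
by rewrite (ext_lim yP).
Qed.
End ExtensionTheory.

Section Graded.
Variable k : fieldType.

Definition gspace := int -> ltvsType k.

Definition gtate (A : gspace) : Prop := forall i, tate (A i).

(* A collection of maps A_i -> B_j for j = i + gdeg. The equation is an argument
   so that degrees which are equal but not convertible need no transport. Leibniz
   equality of gmaps is equality of the degrees and of all the components. *)
Record gmap (A B : gspace) := GMap {
  gdeg : int;
  gfun : forall i j : int, i + gdeg = j -> A i -> B j }.

Definition ghom (A B : gspace) (f : gmap A B) : Prop :=
  forall i j (e : i + gdeg f = j),
    is_linear (gfun e) /\ continuous (gfun e).

Definition sgn (n : int) : k := (-1) ^ n.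

Definition gscale (A B : gspace) (c : k) (f : gmap A B) : gmap A B :=
  {| gdeg := gdeg f; gfun := fun i j e x => c *: gfun e x |}.

(* The components of f, extended by 0 to the indices with j != i + gdeg f. *)
Definition gcomponent (A B : gspace) (f : gmap A B) (i j : int) (x : A i) : B j :=
  if eqP is ReflectT e then @gfun _ _ f i j e x else 0.

(* Meant for maps of the same degree. *)
Definition gadd (A B : gspace) (f g : gmap A B) : gmap A B :=
  {| gdeg := gdeg f; gfun := fun i j e x => gfun e x + gcomponent g j x |}.

Lemma gcomp_deg (i j d e : int) : i + (d + e) = j -> (i + d) + e = j.
Proof. by rewrite addrA. Qed.

Definition gcomp (A B C : gspace) (g : gmap B C) (f : gmap A B) : gmap A C :=
  {| gdeg := gdeg f + gdeg g;
     gfun := fun i j e x => gfun (gcomp_deg e) (gfun (erefl (i + gdeg f)) x) |}.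

Definition gcast (A : gspace) (i j : int) (e : i = j) : A i -> A j :=
  eq_rect i (fun j => A i -> A j) id j e.

Definition gid (A : gspace) : gmap A A :=
  {| gdeg := 0; gfun := fun i j e => gcast (etrans (esym (addr0 i)) e) |}.

Definition idx (n : int) := {p : int * int | p.1 + p.2 == n}.
Definition fst_idx n (s : idx n) : int := (sval s).1.
Definition snd_idx n (s : idx n) : int := (sval s).2.
Definition mkidx (n i j : int) (e : i + j = n) : idx n :=
  exist (fun p : int * int => p.1 + p.2 == n) (i, j) (introT eqP e).

Lemma idxP n (s : idx n) : fst_idx s + snd_idx s = n.
Proof. exact: (eqP (svalP s)). Qed.

Definition star_family (A B : gspace) (n : int) (s : idx n) : ltvsType k :=
  cstar (A (fst_idx s)) (B (snd_idx s)).
Definition bang_family (A B : gspace) (n : int) (s : idx n) : ltvsType k :=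
  cbang (A (fst_idx s)) (B (snd_idx s)).

Definition star (A B : gspace) : gspace := fun n => dsum (@star_family A B n).
Definition bang (A B : gspace) : gspace := fun n => dprod (@bang_family A B n).

Definition star_in (A B : gspace) (n i j : int) (e : i + j = n)
    (x : cstar (A i) (B j)) : star A B n :=
  dsum_in (X := @star_family A B n) (i := mkidx e) x.

Definition star_at (A B : gspace) (n : int) (x : star A B n) (s : idx n) :
    cstar (A (fst_idx s)) (B (snd_idx s)) :=
  coord (X := @star_family A B n) x s.

Definition bang_at (A B : gspace) (n i j : int) (e : i + j = n)
    (x : bang A B n) : cbang (A i) (B j) :=
  dprod_at (X := @bang_family A B n) (mkidx e) x.

Lemma shift_deg n n' d d' (s : idx n) :
  n + (d + d') = n' -> (fst_idx s + d) + (snd_idx s + d') = n'.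
Proof. by move=> <-; rewrite addrACA idxP. Qed.

Definition bang_mk (A B : gspace) (n : int)
    (x : forall t : idx n, cbang (A (fst_idx t)) (B (snd_idx t))) : bang A B n := x.

Definition star_tens (A A' B B' : gspace) (f : gmap A A') (g : gmap B B') :
    gmap (star A B) (star A' B') :=
  {| gdeg := gdeg f + gdeg g;
     gfun := fun n n' e x =>
       \sum_(s \in [set: idx n])
         star_in (shift_deg s e)
           (sgn (gdeg g * fst_idx s) *:
             star_map (gfun (erefl (fst_idx s + gdeg f)))
                      (gfun (erefl (snd_idx s + gdeg g))) (star_at x s)) |}.

Lemma unshift_deg n n' d d' (t : idx n') :
  n + (d + d') = n' -> (fst_idx t - d) + (snd_idx t - d') = n.
Proof. by rewrite addrACA idxP -opprD => <-; rewrite addrK. Qed.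

Definition bang_tens (A A' B B' : gspace) (f : gmap A A') (g : gmap B B') :
    gmap (bang A B) (bang A' B') :=
  {| gdeg := gdeg f + gdeg g;
     gfun := fun n n' e x => bang_mk (fun t : idx n' =>
       sgn (gdeg g * (fst_idx t - gdeg f)) *:
         bang_map (gfun (subrK (gdeg f) (fst_idx t)))
                  (gfun (subrK (gdeg g) (snd_idx t))) (bang_at (unshift_deg t e) x)) |}.

Lemma swap_deg n n' (s : idx n) : n + 0 = n' -> snd_idx s + fst_idx s = n'.
Proof. by rewrite addr0 => <-; rewrite addrC idxP. Qed.

Definition star_tau (A B : gspace) : gmap (star A B) (star B A) :=
  {| gdeg := 0;
     gfun := fun n n' e x =>
       \sum_(s \in [set: idx n])
         star_in (swap_deg s e)
           (sgn (fst_idx s * snd_idx s) *: star_swap (star_at x s)) |}.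

Lemma unswap_deg n n' (t : idx n') : n + 0 = n' -> snd_idx t + fst_idx t = n.
Proof. by rewrite addr0 => ->; rewrite addrC idxP. Qed.

Definition bang_tau (A B : gspace) : gmap (bang A B) (bang B A) :=
  {| gdeg := 0;
     gfun := fun n n' e x => bang_mk (fun t : idx n' =>
       sgn (fst_idx t * snd_idx t) *: bang_swap (bang_at (unswap_deg t e) x)) |}.

(* A * (B ! C) -> (A * B) ! C. The component in (A * B)_i ! C_j is the sum over
   (a, j') of A_a * (B ! C)_j' -> A_a * (B_(j' - j) ! C_j) -> (A_a * B_(j' - j)) ! C_j. *)
Lemma distl_deg1 n n' (s : idx n) (t : idx n') :
  (snd_idx s - snd_idx t) + snd_idx t = snd_idx s.
Proof. exact: subrK. Qed.

Lemma distl_deg2 n n' (s : idx n) (t : idx n') :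
  n + 0 = n' -> fst_idx s + (snd_idx s - snd_idx t) = fst_idx t.
Proof. by rewrite addr0 addrA idxP => ->; apply/eqP; rewrite subr_eq idxP. Qed.

Definition gdistl (A B C : gspace) : gmap (star A (bang B C)) (bang (star A B) C) :=
  {| gdeg := 0;
     gfun := fun n n' e x => bang_mk (fun t : idx n' =>
       \sum_(s \in [set: idx n])
         bang_map (star_in (distl_deg2 s t e)) id
           (distl (star_map id (bang_at (distl_deg1 s t)) (star_at x s)))) |}.

(* (A ! B) * C -> A ! (B * C), symmetrically. *)
Lemma distr_deg1 n n' (s : idx n) (t : idx n') :
  fst_idx t + (fst_idx s - fst_idx t) = fst_idx s.
Proof. by rewrite addrC subrK. Qed.

Lemma distr_deg2 n n' (s : idx n) (t : idx n') :
  n + 0 = n' -> (fst_idx s - fst_idx t) + snd_idx s = snd_idx t.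
Proof.
by rewrite addr0 addrAC idxP => ->; apply/eqP; rewrite subr_eq addrC idxP.
Qed.

Definition gdistr (A B C : gspace) : gmap (star (bang A B) C) (bang A (star B C)) :=
  {| gdeg := 0;
     gfun := fun n n' e x => bang_mk (fun t : idx n' =>
       \sum_(s \in [set: idx n])
         bang_map id (star_in (distr_deg2 s t e))
           (distr (star_map (bang_at (distr_deg1 s t)) id (star_at x s)))) |}.

(* Threefold products. The associativity isomorphisms are the comparison maps star3l,
   star3r from star3 to the two bracketings, and bang3l, bang3r from the two
   bracketings to bang3. *)
Definition idx3 (n : int) := {p : int * int * int | p.1.1 + p.1.2 + p.2 == n}.
Definition idx3_1 n (s : idx3 n) : int := (sval s).1.1.
Definition idx3_2 n (s : idx3 n) : int := (sval s).1.2.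
Definition idx3_3 n (s : idx3 n) : int := (sval s).2.

Lemma idx3P n (s : idx3 n) : idx3_1 s + idx3_2 s + idx3_3 s = n.
Proof. exact: (eqP (svalP s)). Qed.

Lemma idx3l_deg n n' (s : idx3 n) :
  n + 0 = n' -> (idx3_1 s + idx3_2 s) + idx3_3 s = n'.
Proof. by rewrite addr0 idx3P. Qed.

Lemma idx3r_deg n n' (s : idx3 n) :
  n + 0 = n' -> idx3_1 s + (idx3_2 s + idx3_3 s) = n'.
Proof. by rewrite addr0 addrA idx3P. Qed.

Lemma idx3l_deg' n n' (t : idx3 n') :
  n + 0 = n' -> (idx3_1 t + idx3_2 t) + idx3_3 t = n.
Proof. by rewrite addr0 => ->; rewrite idx3P. Qed.

Lemma idx3r_deg' n n' (t : idx3 n') :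
  n + 0 = n' -> idx3_1 t + (idx3_2 t + idx3_3 t) = n.
Proof. by rewrite addr0 addrA => ->; rewrite idx3P. Qed.

Definition star3 (A B C : gspace) : gspace := fun n =>
  dsum (fun s : idx3 n => cstar (cstar (A (idx3_1 s)) (B (idx3_2 s))) (C (idx3_3 s))).

Definition star3_at (A B C : gspace) n (x : star3 A B C n) (s : idx3 n) :
    cstar (cstar (A (idx3_1 s)) (B (idx3_2 s))) (C (idx3_3 s)) :=
  coord x s.

Definition bang3 (A B C : gspace) : gspace := fun n =>
  dprod (fun s : idx3 n => cbang (A (idx3_1 s)) (cbang (B (idx3_2 s)) (C (idx3_3 s)))).

Definition bang3_mk (A B C : gspace) n
    (x : forall t : idx3 n, cbang (A (idx3_1 t)) (cbang (B (idx3_2 t)) (C (idx3_3 t)))) :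
    bang3 A B C n := x.

Definition star3l (A B C : gspace) : gmap (star3 A B C) (star (star A B) C) :=
  {| gdeg := 0;
     gfun := fun n n' e x =>
       \sum_(s \in [set: idx3 n])
         star_in (idx3l_deg s e)
           (star_map (star_in (erefl (idx3_1 s + idx3_2 s))) id (star3_at x s)) |}.

Definition star3r (A B C : gspace) : gmap (star3 A B C) (star A (star B C)) :=
  {| gdeg := 0;
     gfun := fun n n' e x =>
       \sum_(s \in [set: idx3 n])
         star_in (idx3r_deg s e)
           (star_map id (star_in (erefl (idx3_2 s + idx3_3 s)))
             (star_assoc (star3_at x s))) |}.

Definition bang3l (A B C : gspace) : gmap (bang (bang A B) C) (bang3 A B C) :=
  {| gdeg := 0;
     gfun := fun n n' e x => bang3_mk (fun t : idx3 n' =>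
       bang_assoc (bang_map (bang_at (erefl (idx3_1 t + idx3_2 t))) id
         (bang_at (idx3l_deg' t e) x))) |}.

Definition bang3r (A B C : gspace) : gmap (bang A (bang B C)) (bang3 A B C) :=
  {| gdeg := 0;
     gfun := fun n n' e x => bang3_mk (fun t : idx3 n' =>
       bang_map id (bang_at (erefl (idx3_2 t + idx3_3 t)))
         (bang_at (idx3r_deg' t e) x)) |}.

(* The ground field in degree 0, and zero in the other degrees. *)
Definition gunit_set (n : int) : set (ground k) := [set x | n = 0 \/ x = 0].

Lemma gunit_subspace n : subspace (gunit_set n).
Proof.
split=> [|c u v]; first by right.
by move=> [->|->]; [left|move=> [->|->]; [left|right; rewrite scaler0 addr0]].
Qed.

Definition gunit : gspace := fun n => sub_ltvs (Subsp (gunit_subspace n)).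

Definition gunit_val n (x : gunit n) : k := submod_val x.

Definition gone : gunit 0 :=
  @Submod _ _ (Subsp (gunit_subspace 0)) (1 : k) (or_introl erefl).

(* A -> k * A and A -> A * k *)
Lemma lunit_deg (n n' : int) : n + 0 = n' -> 0 + n = n'.
Proof. by rewrite addrC. Qed.

Definition star_lunit (A : gspace) : gmap A (star gunit A) :=
  {| gdeg := 0; gfun := fun n n' e a => star_in (lunit_deg e) (ptstar gone a) |}.

Definition star_runit (A : gspace) : gmap A (star A gunit) :=
  {| gdeg := 0; gfun := fun n n' e a => star_in e (ptstar a gone) |}.

(* k ! A -> A and A ! k -> A *)
Lemma lunit_deg' (n n' : int) : n + 0 = n' -> 0 + n' = n.
Proof. by rewrite addr0 add0r. Qed.

Lemma runit_deg' (n n' : int) : n + 0 = n' -> n' + 0 = n.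
Proof. by rewrite !addr0. Qed.

Definition bang_lunit (A : gspace) : gmap (bang gunit A) A :=
  {| gdeg := 0; gfun := fun n n' e x =>
       bang_lift (fun c a => gunit_val c *: a) (bang_at (lunit_deg' e) x) |}.

Definition bang_runit (A : gspace) : gmap (bang A gunit) A :=
  {| gdeg := 0; gfun := fun n n' e x =>
       bang_lift (fun a c => gunit_val c *: a) (bang_at (runit_deg' e) x) |}.

End Graded.

Arguments gid {k} A.
Arguments star_tau {k} A B.
Arguments bang_tau {k} A B.
Arguments gdistl {k} A B C.
Arguments gdistr {k} A B C.
Arguments star3l {k} A B C.
Arguments star3r {k} A B C.
Arguments bang3l {k} A B C.
Arguments bang3r {k} A B C.
Arguments gunit k : clear implicits.
Arguments star_lunit {k} A.
Arguments star_runit {k} A.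
Arguments bang_lunit {k} A.
Arguments bang_runit {k} A.
Arguments sgn k n : clear implicits.

Declare Scope gmap_scope.
Delimit Scope gmap_scope with G.
Bind Scope gmap_scope with gmap.

Notation "g ∘ f" := (gcomp g f) (at level 40, left associativity) : gmap_scope.
Notation "f ⊗* g" := (star_tens f g) (at level 38, left associativity) : gmap_scope.
Notation "f ⊗! g" := (bang_tens f g) (at level 38, left associativity) : gmap_scope.
Notation "f + g" := (gadd f g) : gmap_scope.
Notation "c *: f" := (gscale c%R f) : gmap_scope.
Notation "1" := (gid _) : gmap_scope.
(* (-1)^n f *)
Notation "'±' n *: f" := (gscale (sgn _ n%R) f)
  (at level 41, n at level 30, f at level 40) : gmap_scope.

Local Open Scope gmap_scope.

Section Composites.
Variable k : fieldType.
Implicit Types A B C D X : gspace k.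

(* (1 ⊗ g)(f ⊗ 1) *)
Definition comp_left A B C D X (g : gmap (star C D) X) (f : gmap A (bang B C)) :
    gmap (star A D) (bang B X) :=
  (1 ⊗! g) ∘ gdistr B C D ∘ (f ⊗* 1).

(* (g ⊗ 1)(1 ⊗ f) *)
Definition comp_right A B C D X (g : gmap (star A B) X) (f : gmap D (bang B C)) :
    gmap (star A D) (bang X C) :=
  (g ⊗! 1) ∘ gdistl A B C ∘ (1 ⊗* f).

(* 1 ⊗ f ⊗ 1 for f : X -> B ⊗! C *)
Definition mid_out A B C D X (f : gmap X (bang B C)) :
    gmap (star A (star X D)) (bang (star A B) (star C D)) :=
  gdistl A B (star C D) ∘ (1 ⊗* (gdistr B C D ∘ (f ⊗* 1))).

(* 1 ⊗ f ⊗ 1 for f : B ⊗* C -> X *)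
Definition mid_in A B C D X (f : gmap (star B C) X) :
    gmap (star (bang A B) (bang C D)) (bang A (bang X D)) :=
  (1 ⊗! ((f ⊗! 1) ∘ gdistl B C D)) ∘ gdistr A B (bang C D).

(* 1 ⊗ e ⊗ 1 for an element e of B ⊗! C *)
Definition mid_elt A B C D (e : gmap (gunit k) (bang B C)) :
    gmap (star A D) (bang (star A B) (star C D)) :=
  mid_out A D e ∘ (1 ⊗* star_lunit D).

(* 1 ⊗ f ⊗ 1 for f : B ⊗* C -> k *)
Definition mid_form A B C D (f : gmap (star B C) (gunit k)) :
    gmap (star (bang A B) (bang C D)) (bang A D) :=
  (1 ⊗! bang_lunit D) ∘ mid_in A D f.

End Composites.

Section Bialgebras.
Variables (k : fieldType) (A : gspace k).
Variables (mu : gmap (star A A) A) (lam : gmap A (bang A A)).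
Variables (eta : gmap (gunit k) A) (eps : gmap A (gunit k)).

Local Notation m := (gdeg mu).
Local Notation l := (gdeg lam).

Definition associative_product : Prop :=
  ghom mu /\
  mu ∘ (mu ⊗* 1) ∘ star3l A A A = ± m *: (mu ∘ (1 ⊗* mu) ∘ star3r A A A).

Definition is_unit : Prop :=
  [/\ ghom eta,
      ± m *: (mu ∘ (eta ⊗* 1) ∘ star_lunit A) = 1 &
      1 = mu ∘ (1 ⊗* eta) ∘ star_runit A].

Definition coassociative_coproduct : Prop :=
  ghom lam /\
  bang3l A A A ∘ (lam ⊗! 1) ∘ lam = ± l *: (bang3r A A A ∘ (1 ⊗! lam) ∘ lam).

Definition is_counit : Prop :=
  [/\ ghom eps,
      bang_lunit A ∘ (eps ⊗! 1) ∘ lam = 1 &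
      1 = ± l *: (bang_runit A ∘ (1 ⊗! eps) ∘ lam)].

Definition biunital_structure : Prop :=
  [/\ gtate A, associative_product, is_unit, coassociative_coproduct & is_counit].

Definition copairing : gmap (gunit k) (bang A A) := ± (l * m + m) *: (lam ∘ eta).
Definition pairing : gmap (star A A) (gunit k) := ± l *: (eps ∘ mu).

Local Notation c := copairing.
Local Notation p := pairing.

Record biunital_coFrobenius_bialgebra : Prop := {
  coFrobenius_structure : biunital_structure;
  coFrobenius_lam_l : lam = comp_left mu c ∘ star_lunit A;
  coFrobenius_lam_r : lam = ± m *: (comp_right mu c ∘ star_runit A);
  coFrobenius_mu_l : mu = ± (m * l + l) *: (bang_lunit A ∘ comp_right p lam);
  coFrobenius_mu_r : mu = ± (m * l) *: (bang_runit A ∘ comp_left p lam);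
  coFrobenius_copairing : bang_tau A A ∘ c = ± l *: c;
  coFrobenius_pairing : p ∘ star_tau A A = ± m *: p }.

Local Notation taus := (star_tau A A).
Local Notation taub := (bang_tau A A).
Local Notation muop := (mu ∘ taus).
Local Notation lamop := (taub ∘ lam).

Record biunital_infinitesimal_antisymmetric_bialgebra : Prop := {
  infinitesimal_structure : biunital_structure;
  infinitesimal_1a :
    lam ∘ mu =
      ± (l * m) *: (comp_left mu lam + comp_right mu lam)
      + (- sgn k l) *: (mid_form A A (eps ∘ mu) ∘ (lam ⊗* lam));
  infinitesimal_1b :
    ± l *: (mid_form A A (eps ∘ mu) ∘ (lam ⊗* lam)) =
    ± m *: ((mu ⊗! mu) ∘ mid_elt A A (lam ∘ eta));
  infinitesimal_2 :
    ± (m * (l + 1)) *: comp_left mu lamop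
    + ± (l * (m + 1)) *: comp_right muop lam
    + (- sgn k (l + m)) *: ((muop ⊗! mu) ∘ mid_elt A A (lam ∘ eta))
    = ± (l * m) *: (taub ∘ comp_left muop lam)
      + (- sgn k ((l + 1) * (m + 1))) *: (taub ∘ comp_right mu lamop)
      + (- sgn k m) *: (taub ∘ (mu ⊗! muop) ∘ mid_elt A A (lam ∘ eta));
  infinitesimal_3a :
    (muop ⊗! mu) ∘ mid_elt A A (lam ∘ eta) =
    mid_form A A (eps ∘ mu) ∘ (lamop ⊗* lam);
  infinitesimal_3b :
    (mu ⊗! muop) ∘ mid_elt A A (lam ∘ eta) =
    mid_form A A (eps ∘ mu) ∘ (lam ⊗* lamop) }.

End Bialgebras.

(* Main.v *)
From mathcomp Require Import all_boot all_order all_algebra.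
From mathcomp Require Import boolp classical_sets functions cardinality fsbigop.
From mathcomp Require Import topology zify.
Require Import Defs.

(** Write the copairing as [c = c' ! c''] (a convergent sum) and the product of
    [a] and [b] as [ab].  The axioms express the coproduct in two ways,
    [lam a = ± c' ! c''a = ± ac' ! c''] ([lam_l], [lam_r]), and recover the
    product by contracting with the pairing ([unit_act_lam], [act_unit_lam]).

    Every term of the displayed identities that starts with two inputs [a], [b]
    becomes one of four expressions.  The chain of equalities for [lam mu] and
    the first infinitesimal relation only involve [ac' ! c''b]: substituting one
    of the two formulas for each occurrence of [lam] gives it for all the terms,
    with associativity for [lam (ab)] ([copairing_lr] and the lemmas after it).
    The anti-symmetry relation compares [c'a ! c''b] with [bc' ! ac''], and the
    symmetry of [c] makes these equal ([copairing_rrE]).  The last pair of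
    relations involves [c'a ! c''b] and [ac' ! bc''].  The identities that
    involve the unit, the counit, or three inputs follow by composing [eps] or
    [eta] with the axioms, together with [mid_in_copairing] and
    [mid_out_pairing].

    Since the tensor products are completed, [c] is not a finite sum, and these
    computations are made as follows.  Multiplication by a fixed element is
    continuous, so an expression such as [ac' ! c''b] is the image of the
    component of [c] under the map [bang_map] of two multiplications, and
    [bang_map_comp] replaces manipulations of [c'] and [c''].  Each structural
    map is evaluated on a pure tensor, component by component ([comp_left_pure],
    [comp_right_pure], [mid_elt_pure], [mid_form_pure]).  Two continuous maps on
    a star product that agree on pure tensors are equal ([eq_ghom_star]), which
    requires all the structural maps to be continuous.  The associativity
    isomorphism of the star product is the delicate one: its continuity is derived
    from local linear compactness ([star_assoc_cont]), and this is how the Tate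
    condition enters besides completeness. *)

Set Implicit Arguments.
Unset Strict Implicit.
Unset Printing Implicit Defensive.

Import GRing.Theory.

(** * Linear maps, tensors and completions *)

Section Topology.
Variable k : fieldType.
Local Open Scope classical_set_scope.
Local Open Scope ring_scope.

Section Linear.
Variables U V W : lmodType k.

Lemma is_linear0 (f : U -> V) : is_linear f -> f 0 = 0.
Proof. by move=> fl; have := fl (-1) 0 0; rewrite !scaleN1r !addNr. Qed.

Lemma is_linearD (f : U -> V) : is_linear f -> {morph f : x y / x + y}.
Proof. by move=> fl x y; have := fl 1 x y; rewrite !scale1r. Qed.

Lemma is_linearZ (f : U -> V) c : is_linear f -> {morph f : x / c *: x}.
Proof. by move=> fl x; have := fl c x 0; rewrite !addr0 is_linear0 // addr0. Qed.

Lemma is_linearB (f : U -> V) : is_linear f -> {morph f : x y / x - y}.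
Proof. by move=> fl x y; rewrite -scaleN1r is_linearD // is_linearZ // scaleN1r. Qed.

Lemma is_linear_comp (g : V -> W) (f : U -> V) :
  is_linear g -> is_linear f -> is_linear (fun x => g (f x)).
Proof. by move=> gl fl c x y; rewrite fl gl. Qed.

Lemma is_linear_sum (f : U -> V) (I : Type) (r : seq I) (F : I -> U) :
  is_linear f -> f (\sum_(i <- r) F i) = \sum_(i <- r) f (F i).
Proof.
move=> fl; elim: r => [|i r IH]; first by rewrite !big_nil is_linear0.
by rewrite !big_cons is_linearD // IH.
Qed.

End Linear.

Lemma eq_linear_tensor (A B V : lmodType k) (f g : tensor A B -> V) :
  is_linear f -> is_linear g -> (forall a b, f (pure a b) = g (pure a b)) ->
  forall x, f x = g x.
Proof.
move=> fl gl fg x; have [u ->] := qpi_surj x.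
have piL : is_linear (qpi (bilinear_rel (A:=A) (B:=B))).
  by move=> c v w; rewrite qpiD qpiZ.
have [r ur rP] : exists2 r : seq (A * B), uniq r & forall p, p \notin r -> coord u p = 0.
  have /finite_seqP[r rE] := submodP u; exists (undup r); first exact: undup_uniq.
  move=> p; rewrite mem_undup => pr; apply/eqP; apply: contraNT pr => up.
  by have : [set` r] p by rewrite -rE.
have -> : u = \sum_(p <- r) (coord u p : k) *: basis p.1 p.2.
  apply: submod_inj; apply: functional_extensionality_dep => q.
  have cl : is_linear (fun v : freemod A B => coord v q) by [].
  change (coord u q = coord (\sum_(p <- r) (coord u p : k) *: basis p.1 p.2) q).
  rewrite (is_linear_sum _ _ cl).
  have cb p : coord ((coord u p : k) *: basis p.1 p.2) q = if p == q then coord u p else 0.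
    rewrite (is_linearZ _ cl) /basis /coord /= /single.
    case: eqVneq => [->|pq]; first by case: q {cl} => a b; rewrite dfwith_in /GRing.scale /= mulr1.
    by rewrite dfwith_out; [exact: scaler0|case: p pq].
  under eq_bigr do rewrite cb.
  have [qr|qr] := boolP (q \in r).
    by rewrite (bigD1_seq q) //= eqxx big1 ?addr0 // => p /negPf ->.
  rewrite rP // big1_seq // => p /andP[_ pr].
  by case: eqP => // pq; rewrite -pq pr in qr.
rewrite !(is_linear_sum _ _ piL) (is_linear_sum _ _ fl) (is_linear_sum _ _ gl).
by apply: eq_bigr => p _; rewrite (is_linearZ _ piL) (is_linearZ _ fl) (is_linearZ _ gl) fg.
Qed.

Lemma tensor_ind (A B : lmodType k) (S : set (tensor A B)) :
  subspace S -> (forall a b, S (pure a b)) -> forall x, S x.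
Proof.
move=> sS h x.
have : qpi S x = 0.
  apply: (@eq_linear_tensor A B (qmod S) (qpi S) (fun=> 0)) => [c u v|c u v|a b].
  - by rewrite qpiD qpiZ.
  - by rewrite scaler0 addr0.
  - by rewrite -qpi0; apply/qpiP; rewrite subr0 linspan_id.
by rewrite -qpi0 => /qpiP; rewrite subr0 linspan_id.
Qed.

Definition clin (A B : ltvsType k) (f : A -> B) : Prop :=
  is_linear f /\ continuous f.

Lemma clinP (A B : ltvsType k) (f : A -> B) : is_linear f ->
  (forall W, open_subspace W -> exists2 U, open_subspace U & U `<=` f @^-1` W) ->
  clin f.
Proof.
move=> fl h; split=> // x N /nbhs_sub[W oW WN]; have [U oU UW] := h W oW.
apply: filterS (sub_nbhs x oU) => _ [u Uu <-] /=.
by rewrite is_linearD //; apply: WN; exact: UW.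
Qed.

Lemma clin_open (A B : ltvsType k) (f : A -> B) W :
  clin f -> open_subspace W -> open_subspace (f @^-1` W).
Proof. by case=> fl fc; exact: preim_open. Qed.

Lemma clin_id (A : ltvsType k) : clin (@id A).
Proof. by apply: clinP => // W oW; exists W. Qed.

Lemma clin_comp (A B C : ltvsType k) (g : B -> C) (f : A -> B) :
  clin g -> clin f -> clin (fun x => g (f x)).
Proof.
move=> cg cf; apply: clinP; first by apply: is_linear_comp; [case: cg|case: cf].
by move=> W oW; exists (f @^-1` (g @^-1` W)) => //; do 2!apply: clin_open => //.
Qed.

Lemma clin0 (A B : ltvsType k) : clin (fun _ : A => 0 : B).
Proof.
apply: clinP => [c u v|W [_ [W0 _]]]; first by rewrite scaler0 addr0.
by exists setT; [exact: open_subspaceT|move=> ? _].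
Qed.

Lemma clinD (A B : ltvsType k) (f g : A -> B) :
  clin f -> clin g -> clin (fun x => f x + g x).
Proof.
move=> cf cg; apply: clinP => [c u v|W oW].
  by case: cf cg => fl _ [gl _]; rewrite fl gl scalerDr addrACA.
exists (f @^-1` W `&` g @^-1` W); first by apply: open_subspaceI; exact: clin_open.
by move=> x [fx gx]; apply: subspaceD => //; case: oW.
Qed.

Lemma clinZ (A B : ltvsType k) (f : A -> B) c : clin f -> clin (fun x => c *: f x).
Proof.
move=> cf; apply: clinP => [d u v|W oW].
  by case: cf => fl _; rewrite fl scalerDr !scalerA mulrC.
exists (f @^-1` W); first exact: clin_open.
by move=> x fx; apply: subspaceZ => //; case: oW.
Qed.

Section Completion.
Variables (V : lmodType k) (T : lintop V).

Definition nbase (U : lidx T) : set (completion T) := [set x | residue x U = 0].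

Lemma nbase_open U : open_subspace (nbase U).
Proof.
have sN : subspace (nbase U).
  split=> // c x y /= hx hy.
  by change (c *: residue x U + residue y U = 0); rewrite hx hy scaler0 addr0.
split=> //; rewrite openE => x Nx; exists (nbase U); first by exists U.
by move=> u Nu; exact: subspaceD.
Qed.

Lemma nbase_sub (W : set (completion T)) : open_subspace W -> exists U, nbase U `<=` W.
Proof.
move=> [oW sW]; have : nbhs (0 : completion T) W.
  by apply: open_nbhs_nbhs; split=> //; case: sW.
by move=> [_ [U ->] h]; exists U => x /h; rewrite add0r.
Qed.

Lemma qpi_eq0 (U : lidx T) v : qpi (sval U) v = 0 <-> sval U v.
Proof.
have sU := lopen_subspace (svalP U).
rewrite -qpi0; split; first by move=> /qpiP; rewrite subr0 linspan_id.
by move=> h; apply/qpiP; rewrite subr0 linspan_id.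
Qed.

Lemma nbase_canon (U : lidx T) v : nbase U (canon T v) <-> sval U v.
Proof. exact: qpi_eq0. Qed.

Lemma nbaseB x y (U : lidx T) : nbase U (x - y) <-> residue x U = residue y U.
Proof.
change (residue x U - residue y U = 0 <-> residue x U = residue y U).
by split=> [/eqP|->]; [rewrite subr_eq0 => /eqP|rewrite subrr].
Qed.

Lemma canon_dense x (U : lidx T) : exists v, nbase U (x - canon T v).
Proof.
have [v e] := qpi_surj (residue x U); exists v.
exact/nbaseB.
Qed.

Lemma nbaseI (U W : lidx T) : exists Z : lidx T, nbase Z `<=` nbase U `&` nbase W.
Proof.
have [Z h] := nbase_sub (open_subspaceI (nbase_open U) (nbase_open W)).
by exists Z.
Qed.

(** An open subspace [W] is closed, so a condition that holds on the points of
    the dense image lying in [P] passes to the whole basic neighbourhood that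
    [P] defines. *)
Lemma clin_canon_sub (C : ltvsType k) (g : completion T -> C) W (P : set V) :
  clin g -> open_subspace W -> forall hP : lopen T P,
  (forall v, P v -> W (g (canon T v))) ->
  forall y, nbase (exist _ P hP) y -> W (g y).
Proof.
move=> cg oW hP h y yP.
have [U UW] := nbase_sub (clin_open cg oW).
have [Z ZUP] := nbaseI U (exist _ P hP).
have [v vZ] := canon_dense y Z; have [vU vP] := ZUP _ vZ.
have sN := (nbase_open (exist _ P hP)).2.
rewrite -(subrK (canon T v) y) (is_linearD cg.1).
apply: subspaceD oW.2 (UW _ vU) _; apply: h; apply/(nbase_canon (exist _ P hP)).
by rewrite -[canon T v](subKr y); apply: subspaceB.
Qed.

Lemma eq_clin_completion (C : ltvsType k) (f g : completion T -> C) :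
  clin f -> clin g -> (forall v, f (canon T v) = g (canon T v)) -> forall x, f x = g x.
Proof.
move=> cf cg fg x; apply/eqP; rewrite -subr_eq0; apply/eqP.
apply: open_subspace_sep => W oW.
have ch : clin (fun y => f y - g y).
  rewrite (_ : (fun y => _) = (fun y => f y + (-1) *: g y)).
    by apply: clinD => //; exact: clinZ.
  by apply: funext => y; rewrite scaleN1r.
apply: (@clin_canon_sub _ _ W setT ch oW (lopenT T) _ x).
  by move=> v _; rewrite fg subrr; case: (oW.2).
have [v hv] := canon_dense x (exist _ _ (lopenT T)).
rewrite -(subrK (canon T v) x); apply: subspaceD (nbase_open _).2 hv _.
exact/nbase_canon.
Qed.

(** Every open subspace of the completion contains a basic one, [nbase U].  A
    compatible family of residues modulo all open subspaces is therefore
    determined by its members modulo the [nbase U], and the residues modulo [U]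
    of representatives of these form a point of the completion. *)
Lemma completion_complete : complete (completion T).
Proof.
pose C : ltvsType k := completion T; pose T' := ltvs_lintop C.
have ci : clin (canon T').
  apply: clinP; first exact: canon_lin.
  by move=> W /canon_cont[U oU UW]; exists U.
split; first by case: ci.
pose N (U : lidx T) : lidx T' := exist _ (nbase U) (nbase_open U).
have key (Y : completion T') (U : lidx T) : exists y : C, residue Y (N U) = qpi _ y.
  exact: qpi_surj.
pose y Y U := projT1 (cid (key Y U)).
have yP Y U : residue Y (N U) = qpi _ (y Y U) by rewrite /y; case: cid.
have yE Y U z : residue Y (N U) = qpi _ z -> residue (y Y U) U = residue z U.
  rewrite yP => /qpiP; rewrite linspan_id; last exact: (nbase_open U).2.
  by move/nbaseB.
have jc (Y : completion T') : compatible (T := T) (fun U => residue (y Y U) U).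
  move=> U W v UW e.
  have NUW : sval (N U) `<=` sval (N W).
    move=> z /= hz; rewrite /nbase /= -qpi0.
    by apply: (residueP UW); rewrite hz qpi0.
  by rewrite (yE _ _ _ (residueP NUW (yP Y U))); exact: residueP e.
pose j Y : C := @Submod _ _ (Subsp (@compatible_subspace _ _ T)) _ (jc Y).
have ij : cancel (canon T') j.
  move=> z; apply: submod_inj; apply: functional_extensionality_dep => U.
  exact: (@yE (canon T' z) U z).
have ji : cancel j (canon T').
  move=> Y; apply: submod_inj; apply: functional_extensionality_dep => W.
  change (qpi (sval W) (j Y) = residue Y W).
  have [U UW] := nbase_sub (svalP W); symmetry; apply: (residueP (U := N U)) => //.
  rewrite yP; apply/qpiP; rewrite linspan_id; last exact: (nbase_open U).2.
  exact/nbaseB.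
exists j; split=> //.
suff [] : clin j by [].
apply: clinP.
  by move=> c X Y; apply: (can_inj ij); rewrite canon_lin !ji.
move=> W /nbase_sub[U UW].
have [oN sN] : open_subspace [set Y : completion T' | residue Y (N U) = 0].
  split; last first.
    split=> // c X Y /= hX hY.
    by change (c *: residue X (N U) + residue Y (N U) = 0); rewrite hX hY scaler0 addr0.
  rewrite openE => Y hY; exists [set Y : completion T' | residue Y (N U) = 0].
    by exists (N U).
  by move=> Z hZ; change (residue Y (N U) + residue Z (N U) = 0); rewrite hY hZ addr0.
exists [set Y : completion T' | residue Y (N U) = 0] => // Y /= hY; apply: UW.
change (residue (y Y U) U = 0); rewrite (@yE Y U 0) //.
Qed.

Section Extension.
Variables (C : ltvsType k) (f : V -> C).
Hypothesis fl : is_linear f.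
Hypothesis fc : forall W, open_subspace W -> exists2 U, lopen T U & U `<=` f @^-1` W.
Hypothesis cC : complete C.

Lemma ext_clin : clin (ext (T := T) f).
Proof.
have cvg x W (oW : open_subspace W) := ext_cvg x fl fc cC oW.
have nb (x : completion T) U v : residue x U = qpi _ v <-> nbase U (x - canon T v).
  by rewrite nbaseB.
apply: clinP => [c x y|W oW].
  apply: ext_lim => W oW.
  have [U hU] := cvg x W oW; have [U' hU'] := cvg y W oW.
  have [Z ZU] := nbaseI U U'.
  exists Z => v /nb hv; have [a ha] := canon_dense x Z.
  have -> : f v - (c *: ext f x + ext f y) =
            c *: (f a - ext f x) + (f (v - c *: a) - ext f y).
    by rewrite is_linearB // is_linearZ // scalerBr addrACA [c *: f a + _]addrC subrK opprD.
  apply: oW.2.2; first by apply/hU/nb; have [] := ZU _ ha.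
  apply/hU'/nb; suff /ZU[] : nbase Z (y - canon T (v - c *: a)) by [].
  have -> : y - canon T (v - c *: a) = (c *: x + y - canon T v) - c *: (x - canon T a).
    rewrite (is_linearB (@canon_lin _ _ T)) (is_linearZ _ (@canon_lin _ _ T)).
    by rewrite scalerBr !opprB -[c *: x + y - _]addrA [RHS]addrC [RHS]addrA subrK addrCA.
  have sZ := (nbase_open Z).2.
  by apply: subspaceB => //; exact: subspaceZ.
have [U oU UW] := fc oW; pose U1 : lidx T := exist _ U oU.
exists (nbase U1); first exact: nbase_open.
move=> x xU /=; have [U2 h] := cvg x W oW; have [Z ZU] := nbaseI U1 U2.
have [v hv] := canon_dense x Z; have [h1 h2] := ZU _ hv.
rewrite -[ext f x](subKr (f v)); apply: subspaceB oW.2 _ (h _ _); last exact/nb.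
apply: UW; apply/(nbase_canon U1); rewrite -[canon T v](subKr x).
exact: subspaceB (nbase_open U1).2 xU h1.
Qed.

End Extension.
End Completion.

End Topology.

(** * Continuous bilinear maps on completed tensor products *)

Section Bilinear.
Variable k : fieldType.
Local Open Scope classical_set_scope.
Local Open Scope ring_scope.

Definition bilin (A B C : lmodType k) (f : A -> B -> C) : Prop :=
  (forall b, is_linear (fun a => f a b)) /\ forall a, is_linear (f a).

(** Continuity of [f] at every point of [A * B], split by bilinearity into
    continuity at the origin and in each variable: these are the maps that the
    star tensor product linearizes. *)
Definition star_cont (A B C : ltvsType k) (f : A -> B -> C) : Prop :=
  bilin f /\ forall W, open_subspace W ->
  [/\ exists (U : set A) (V : set B), [/\ open_subspace U, open_subspace V &
        forall a b, U a -> V b -> W (f a b)],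
      forall a, exists2 V : set B, open_subspace V & forall b, V b -> W (f a b) &
      forall b, exists2 U : set A, open_subspace U & forall a, U a -> W (f a b)].

(** The bilinear maps that the bang tensor product linearizes. *)
Definition bang_cont (A B C : ltvsType k) (f : A -> B -> C) : Prop :=
  bilin f /\ forall W, open_subspace W ->
  exists (U : set A) (V : set B), [/\ open_subspace U, open_subspace V &
    forall a b, U a \/ V b -> W (f a b)].

Lemma star_cont_bang (A B C : ltvsType k) (f : A -> B -> C) :
  bang_cont f -> star_cont f.
Proof.
move=> [bf hf]; split=> // W /hf[U [V [oU oV h]]]; split.
- by exists U, V; split=> // a b Ua _; apply: h; left.
- by move=> a; exists V => // b Vb; apply: h; right.
- by move=> b; exists U => // a Ua; apply: h; left.
Qed.

Lemma star_contC (A B C : ltvsType k) (f : A -> B -> C) :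
  star_cont f -> star_cont (fun b a => f a b).
Proof.
move=> [[fl fr] hf]; split=> // W /hf[[U [V [oU oV h]]] ha hb]; split=> //.
by exists V, U; split=> // b a Vb Ua; exact: h.
Qed.

Lemma star_cont_clinl (A B C : ltvsType k) (f : A -> B -> C) b :
  star_cont f -> clin (fun a => f a b).
Proof. by move=> [[fl fr] hf]; apply: clinP => // W /hf[_ _ /(_ b)]. Qed.

Lemma star_cont_clinr (A B C : ltvsType k) (f : A -> B -> C) a :
  star_cont f -> clin (f a).
Proof. by move=> [[fl fr] hf]; apply: clinP => // W /hf[_ /(_ a)]. Qed.

Lemma bilin_comp (A A' B B' C D : lmodType k) (f : A -> B -> C)
    (h : A' -> A) (h' : B' -> B) (g : C -> D) :
  bilin f -> is_linear h -> is_linear h' -> is_linear g ->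
  bilin (fun a b => g (f (h a) (h' b))).
Proof.
by move=> [fl fr] hl hl' gl; split=> [b|a] c x y; rewrite ?hl ?hl' ?fl ?fr gl.
Qed.

Lemma star_cont_comp (A A' B B' C D : ltvsType k) (f : A -> B -> C)
    (h : A' -> A) (h' : B' -> B) (g : C -> D) :
  star_cont f -> clin h -> clin h' -> clin g ->
  star_cont (fun a b => g (f (h a) (h' b))).
Proof.
move=> [bf hf] ch ch' cg; split.
  exact: (bilin_comp bf ch.1 ch'.1 cg.1).
move=> W /(clin_open cg)/hf[[U [V [oU oV H]]] ha hb]; split.
- exists (h @^-1` U), (h' @^-1` V).
  by split; [exact: clin_open|exact: clin_open|move=> a b /= ? ?; exact: H].
- move=> a; have [V' oV' H'] := ha (h a); exists (h' @^-1` V'); first exact: clin_open.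
  by move=> b /= ?; exact: H'.
- move=> b; have [U' oU' H'] := hb (h' b); exists (h @^-1` U'); first exact: clin_open.
  by move=> a /= ?; exact: H'.
Qed.

Lemma bang_cont_comp (A A' B B' C D : ltvsType k) (f : A -> B -> C)
    (h : A' -> A) (h' : B' -> B) (g : C -> D) :
  bang_cont f -> clin h -> clin h' -> clin g ->
  bang_cont (fun a b => g (f (h a) (h' b))).
Proof.
move=> [bf hf] ch ch' cg; split.
  exact: (bilin_comp bf ch.1 ch'.1 cg.1).
move=> W /(clin_open cg)/hf[U [V [oU oV H]]]; exists (h @^-1` U), (h' @^-1` V).
by split; [exact: clin_open|exact: clin_open|move=> a b /= ?; exact: H].
Qed.

Lemma bilin_canon_pure (A B : lmodType k) (T : lintop (tensor A B)) :
  bilin (fun a b => canon T (pure a b)).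
Proof. by split=> [b|a] c x y; rewrite ?pureDl ?pureDr canon_lin. Qed.

Lemma ptstar_cont (A B : ltvsType k) : star_cont (@ptstar k A B).
Proof.
split; first exact: bilin_canon_pure.
move=> W /(canon_cont (T := star_lintop A B))[Q [sQ hQ ha hb] QW]; split.
- by have [U [V [oU oV h]]] := hQ; exists U, V; split=> // a b ? ?; apply/QW/h.
- by move=> a; have [V oV h] := ha a; exists V => // b ?; apply/QW/h.
- by move=> b; have [U oU h] := hb b; exists U => // a ?; apply/QW/h.
Qed.

Lemma ptbang_cont (A B : ltvsType k) : bang_cont (@ptbang k A B).
Proof.
split; first exact: bilin_canon_pure.
move=> W /(canon_cont (T := bang_lintop A B))[Q [sQ [U [V [oU oV h]]]] QW].
by exists U, V; split=> // a b ?; apply/QW/h.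
Qed.

Lemma tlift_preim (A B : lmodType k) (C : ltvsType k) (f : A -> B -> C) W :
  bilin f -> open_subspace W -> subspace (tlift f @^-1` W).
Proof.
move=> [fl fr] oW; have tl := tlift_lin fl fr.
split; first by rewrite /= is_linear0 //; case: (oW.2).
by move=> c x y /= hx hy; rewrite tl; exact: oW.2.2.
Qed.

Section Lift.
Variables (A B C : ltvsType k) (f : A -> B -> C).
Hypothesis cC : complete C.

Section Star.
Hypothesis cf : star_cont f.

Let fc W : open_subspace W ->
  exists2 Q, lopen (star_lintop A B) Q & Q `<=` tlift f @^-1` W.
Proof.
have [fl fr] := cf.1; have tp := tlift_pure fl fr.
move=> oW; exists (tlift f @^-1` W) => //; have [[U [V [oU oV h]]] ha hb] := cf.2 W oW.
split; first exact: tlift_preim cf.1 oW.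
- by exists U, V; split=> // a b ? ? /=; rewrite tp; exact: h.
- by move=> a; have [V' oV' h'] := ha a; exists V' => // b ? /=; rewrite tp; exact: h'.
- by move=> b; have [U' oU' h'] := hb b; exists U' => // a ? /=; rewrite tp; exact: h'.
Qed.

Lemma star_lift_clin : clin (star_lift f).
Proof. by apply: ext_clin => //; exact: tlift_lin cf.1.1 cf.1.2. Qed.

Lemma star_lift_pure a b : star_lift f (ptstar a b) = f a b.
Proof.
rewrite /star_lift /ptstar ext_canon //; last exact: tlift_lin cf.1.1 cf.1.2.
exact: tlift_pure cf.1.1 cf.1.2 a b.
Qed.
End Star.

Section Bang.
Hypothesis cf : bang_cont f.

Let fc W : open_subspace W ->
  exists2 Q, lopen (bang_lintop A B) Q & Q `<=` tlift f @^-1` W.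
Proof.
have [fl fr] := cf.1; have tp := tlift_pure fl fr.
move=> oW; exists (tlift f @^-1` W) => //; have [U [V [oU oV h]]] := cf.2 W oW.
split; first exact: tlift_preim cf.1 oW.
by exists U, V; split=> // a b ? /=; rewrite tp; exact: h.
Qed.

Lemma bang_lift_clin : clin (bang_lift f).
Proof. by apply: ext_clin => //; exact: tlift_lin cf.1.1 cf.1.2. Qed.

Lemma bang_lift_pure a b : bang_lift f (ptbang a b) = f a b.
Proof.
rewrite /bang_lift /ptbang ext_canon //; last exact: tlift_lin cf.1.1 cf.1.2.
exact: tlift_pure cf.1.1 cf.1.2 a b.
Qed.
End Bang.
End Lift.

Lemma eq_clin_tensor (A B : ltvsType k) (T : lintop (tensor A B)) (C : ltvsType k)
    (f g : completion T -> C) :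
  clin f -> clin g ->
  (forall a b, f (canon T (pure a b)) = g (canon T (pure a b))) -> forall x, f x = g x.
Proof.
move=> cf cg fg; apply: eq_clin_completion => //; apply: eq_linear_tensor => //.
- by apply: is_linear_comp; [exact: cf.1|exact: canon_lin].
- by apply: is_linear_comp; [exact: cg.1|exact: canon_lin].
Qed.

Lemma eq_clin_cstar (A B C : ltvsType k) (f g : cstar A B -> C) :
  clin f -> clin g -> (forall a b, f (ptstar a b) = g (ptstar a b)) -> forall x, f x = g x.
Proof. exact: eq_clin_tensor. Qed.

Lemma eq_clin_cbang (A B C : ltvsType k) (f g : cbang A B -> C) :
  clin f -> clin g -> (forall a b, f (ptbang a b) = g (ptbang a b)) -> forall x, f x = g x.
Proof. exact: eq_clin_tensor. Qed.

(** Joint continuity with a completed second variable.  A point [y] is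
    [canon v + y'] with [y'] small; [F a y'] is small uniformly for [a] in a
    neighbourhood, which leaves the dense image, where the hypothesis on
    [F a (canon v)] applies. *)
Lemma completion_star_cont (A D : ltvsType k) (V : lmodType k) (T : lintop V)
    (F : A -> completion T -> D) :
  (forall a, clin (F a)) ->
  (forall v, is_linear (fun a => F a (canon T v))) ->
  (forall v W, open_subspace W ->
     exists2 U : set A, open_subspace U & forall a, U a -> W (F a (canon T v))) ->
  (forall W, open_subspace W -> exists (U : set A) (P : set V),
     [/\ open_subspace U, lopen T P & forall a v, U a -> P v -> W (F a (canon T v))]) ->
  star_cont F.
Proof.
move=> Fc Fl Fv FU.
have Flin y : is_linear (fun a => F a y).
  move=> c a a'; apply: (@eq_clin_completion _ _ T D (F (c *: a + a'))
    (fun y => c *: F a y + F a' y)) => //; first by apply: clinD => //; exact: clinZ.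
  by move=> v; exact: (Fl v c a a').
split; first by split=> // a; exact: (Fc a).1.
move=> W oW.
have [U [P [oU oP h]]] := FU W oW; pose N := nbase (exist _ P oP).
have hN a y : U a -> N y -> W (F a y).
  by move=> Ua; apply: (clin_canon_sub (Fc a) oW) => v; exact: h.
split.
- by exists U, N; split=> //; exact: nbase_open.
- by move=> a; exists (F a @^-1` W) => //; exact: clin_open.
- move=> y; have [v hv] := canon_dense y (exist _ P oP); have [U' oU' h'] := Fv v W oW.
  exists (U `&` U'); first exact: open_subspaceI.
  move=> a [Ua U'a]; rewrite -(subrK (canon T v) y) (is_linearD (Fc a).1).
  by apply: subspaceD oW.2 _ (h' _ U'a); exact: hN.
Qed.

Lemma tensor_star_cont (A D B C : ltvsType k) (T : lintop (tensor B C))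
    (F : A -> completion T -> D) :
  (forall a, clin (F a)) ->
  (forall b c, clin (fun a => F a (canon T (pure b c)))) ->
  (forall W, open_subspace W -> exists (U : set A) (P : set (tensor B C)),
     [/\ open_subspace U, lopen T P & forall a v, U a -> P v -> W (F a (canon T v))]) ->
  star_cont F.
Proof.
move=> Fc Fp FU; apply: completion_star_cont => //.
- move=> v c a a'; move: v; apply: eq_linear_tensor.
  + exact: is_linear_comp (Fc _).1 (@canon_lin _ _ T).
  + apply: (is_linear_comp (g := fun y => c *: F a y + F a' y)) (@canon_lin _ _ T).
    exact: (clinD (clinZ c (Fc a)) (Fc a')).1.
  + by move=> b d; exact: ((Fp b d).1 c a a').
- move=> v W oW; move: v; apply: tensor_ind; first split.
  + exists setT; first exact: open_subspaceT.
    by move=> a _; rewrite (is_linear0 (@canon_lin _ _ T)) (is_linear0 (Fc a).1); case: (oW.2).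
  + move=> c x y [U oU hU] [U' oU' hU']; exists (U `&` U'); first exact: open_subspaceI.
    move=> a [Ua U'a]; rewrite canon_lin (Fc a).1; apply: oW.2.2; [exact: hU|exact: hU'].
  + by move=> b c; exists ((fun a => F a (canon T (pure b c))) @^-1` W) => //; exact: clin_open.
Qed.

Section Maps.
Variables A A' B B' : ltvsType k.
Variables (f : A -> A') (g : B -> B').
Hypotheses (cf : clin f) (cg : clin g).

Lemma star_map_cont : star_cont (fun a b => ptstar (f a) (g b)).
Proof. exact: star_cont_comp (@ptstar_cont A' B') cf cg (@clin_id k _). Qed.

Lemma bang_map_cont : bang_cont (fun a b => ptbang (f a) (g b)).
Proof. exact: bang_cont_comp (@ptbang_cont A' B') cf cg (@clin_id k _). Qed.

Lemma star_map_clin : clin (star_map f g).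
Proof. exact: star_lift_clin (@completion_complete _ _ _) star_map_cont. Qed.

Lemma bang_map_clin : clin (bang_map f g).
Proof. exact: bang_lift_clin (@completion_complete _ _ _) bang_map_cont. Qed.

Lemma star_mapE a b : star_map f g (ptstar a b) = ptstar (f a) (g b).
Proof. exact: star_lift_pure star_map_cont a b. Qed.

Lemma bang_mapE a b : bang_map f g (ptbang a b) = ptbang (f a) (g b).
Proof. exact: bang_lift_pure bang_map_cont a b. Qed.

End Maps.

Lemma star_swap_cont (A B : ltvsType k) : star_cont (fun (a : A) (b : B) => ptstar b a).
Proof. exact: star_contC (@ptstar_cont B A). Qed.

Lemma bang_swap_cont (A B : ltvsType k) : bang_cont (fun (a : A) (b : B) => ptbang b a).
Proof.
have [[fl fr] h] := @ptbang_cont B A; split=> // W /h[U [V [oU oV H]]].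
by exists V, U; split=> // a b [?|?]; apply: H; [right|left].
Qed.

Lemma star_swap_clin (A B : ltvsType k) : clin (@star_swap k A B).
Proof. exact: star_lift_clin (@completion_complete _ _ _) (@star_swap_cont A B). Qed.

Lemma star_swapE (A B : ltvsType k) (a : A) (b : B) :
  star_swap (ptstar a b) = ptstar b a.
Proof. exact: star_lift_pure (@star_swap_cont A B) a b. Qed.

Lemma bang_swap_clin (A B : ltvsType k) : clin (@bang_swap k A B).
Proof. exact: bang_lift_clin (@completion_complete _ _ _) (@bang_swap_cont A B). Qed.

Lemma bang_swapE (A B : ltvsType k) (a : A) (b : B) :
  bang_swap (ptbang a b) = ptbang b a.
Proof. exact: bang_lift_pure (@bang_swap_cont A B) a b. Qed.

(** The open sets in play for [(A * B) ! C] contain [Q ! C + (A * B) ! V] with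
    [Q] containing some [U * V'], so that all [a] in [U] send the same open
    subspace [V' ! C + B ! V] of [B ! C] into the given one. *)
Lemma distl_cont (A B C : ltvsType k) :
  star_cont (fun (a : A) (y : cbang B C) => bang_map (ptstar a) id y).
Proof.
have cp a : clin (@ptstar k A B a) := star_cont_clinr a (@ptstar_cont A B).
apply: tensor_star_cont => [a|b c|W oW].
- exact: bang_map_clin (cp a) (@clin_id _ _).
- rewrite (_ : (fun a => _) = fun a => ptbang (ptstar a b) c).
    apply: (@clin_comp _ _ _ _ (fun q => ptbang q c) (fun a => ptstar a b)).
      exact: star_cont_clinl (star_cont_bang (@ptbang_cont _ _)).
    exact: star_cont_clinl (@ptstar_cont _ _).
  by apply: funext => a; exact: (bang_mapE (cp a) (@clin_id k C) b c).
- have [Q [V [oQ oV h]]] := (@ptbang_cont (cstar A B) C).2 W oW.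
  have [[U [V' [oU oV' h']]] _ _] := (@ptstar_cont A B).2 Q oQ.
  pose P : set (tensor B C) := [set v | forall a, U a ->
    W (bang_map (ptstar a) id (canon (bang_lintop B C) v))].
  exists U, P; split=> //; last by move=> a v Ua /(_ a Ua).
  split.
    split.
      move=> a _; rewrite (is_linear0 (@canon_lin _ _ _)) (is_linear0 (bang_map_clin (cp a) (@clin_id _ _)).1).
      by case: (oW.2).
    move=> c x y hx hy a Ua; rewrite canon_lin (bang_map_clin (cp a) (@clin_id _ _)).1.
    by apply: oW.2.2; [exact: hx|exact: hy].
  exists V', V; split=> // b c bc a Ua.
  rewrite (bang_mapE (cp a) (@clin_id k C) b c : bang_map _ _ (canon _ _) = _).
  by apply: h; case: bc => ?; [left; exact: h'|right].
Qed.

Lemma distl_clin (A B C : ltvsType k) : clin (@distl k A B C).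
Proof. exact: star_lift_clin (@completion_complete _ _ _) (@distl_cont A B C). Qed.

Lemma distlE (A B C : ltvsType k) (a : A) (y : cbang B C) :
  distl (ptstar a y) = bang_map (ptstar a) id y.
Proof. exact: star_lift_pure (@distl_cont A B C) a y. Qed.

Lemma distr_cont (A B C : ltvsType k) :
  star_cont (fun (x : cbang A B) (c : C) => bang_map id (fun b => ptstar b c) x).
Proof.
apply: (@star_contC C (cbang A B) _ (fun c x => bang_map id (fun b => ptstar b c) x)).
have cp c : clin (fun b : B => ptstar b c) := star_cont_clinl c (@ptstar_cont B C).
apply: tensor_star_cont => [c|a b|W oW].
- exact: bang_map_clin (@clin_id _ _) (cp c).
- rewrite (_ : (fun c => _) = fun c : C => ptbang a (ptstar b c)).
    apply: (@clin_comp _ _ _ _ (ptbang a) (fun c => ptstar b c)).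
      exact: star_cont_clinr (star_cont_bang (@ptbang_cont _ _)).
    exact: star_cont_clinr (@ptstar_cont _ _).
  by apply: funext => c; exact: (bang_mapE (@clin_id k A) (cp c) a b).
- have [V [Q [oV oQ h]]] := (@ptbang_cont A (cstar B C)).2 W oW.
  have [[V' [U [oV' oU h']]] _ _] := (@ptstar_cont B C).2 Q oQ.
  pose P : set (tensor A B) := [set v | forall c, U c ->
    W (bang_map id (fun b => ptstar b c) (canon (bang_lintop A B) v))].
  exists U, P; split=> //; last by move=> a v Ua /(_ a Ua).
  split.
    split.
      move=> c _; rewrite (is_linear0 (@canon_lin _ _ _)) (is_linear0 (bang_map_clin (@clin_id _ _) (cp c)).1).
      by case: (oW.2).
    move=> d x y hx hy c Uc; rewrite canon_lin (bang_map_clin (@clin_id _ _) (cp c)).1.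
    by apply: oW.2.2; [exact: hx|exact: hy].
  exists V, V'; split=> // a b ab c Uc.
  rewrite (bang_mapE (@clin_id k A) (cp c) a b : bang_map _ _ (canon _ _) = _).
  by apply: h; case: ab => ?; [left|right; exact: h'].
Qed.

Lemma distr_clin (A B C : ltvsType k) : clin (@distr k A B C).
Proof. exact: star_lift_clin (@completion_complete _ _ _) (@distr_cont A B C). Qed.

Lemma distrE (A B C : ltvsType k) (x : cbang A B) (c : C) :
  distr (ptstar x c) = bang_map id (fun b => ptstar b c) x.
Proof. exact: star_lift_pure (@distr_cont A B C) x c. Qed.

Lemma bang_assoc_cont (A B C : ltvsType k) :
  bang_cont (fun (x : cbang A B) (c : C) => bang_map id (fun b => ptbang b c) x).
Proof.
have cp c : clin (fun b : B => ptbang b c) :=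
  star_cont_clinl c (star_cont_bang (@ptbang_cont B C)).
have cF c : clin (bang_map (@id A) (fun b : B => ptbang b c)) := bang_map_clin (@clin_id k A) (cp c).
have sE a b c : bang_map id (fun b => ptbang b c) (canon (bang_lintop A B) (pure a b)) =
    ptbang a (ptbang b c) := bang_mapE (@clin_id k A) (cp c) a b.
have [[pl pr] hp] := @ptbang_cont A (cbang B C).
have [[pl' pr'] hp'] := @ptbang_cont B C.
split.
  split=> [c|x]; first exact: (cF c).1.
  move=> d c c'; apply: (eq_clin_cbang (f := bang_map id (fun b => ptbang b (d *: c + c')))
    (g := fun x => d *: bang_map id (fun b => ptbang b c) x + bang_map id (fun b => ptbang b c') x)) x => //.
    by apply: clinD; [apply: clinZ|]; exact: cF.
  by move=> a b; rewrite !bang_mapE ?pr' ?pr //; exact: clin_id.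
move=> W oW; have [U [N [oU oN h]]] := hp W oW; have [V [V' [oV oV' h']]] := hp' N oN.
pose P : set (tensor A B) := [set v | forall c,
  W (bang_map id (fun b => ptbang b c) (canon (bang_lintop A B) v))]%classic.
have sP : subspace P.
  split=> [c|d x y hx hy c]; first by rewrite (is_linear0 (@canon_lin _ _ _)) (is_linear0 (cF c).1); case: (oW.2).
  by rewrite canon_lin (cF c).1; apply: oW.2.2.
have oP : lopen (bang_lintop A B) P.
  split=> //; exists U, V; split=> // a b ab c; rewrite sE.
  by apply: h; case: ab => ?; [left|right; apply: h'; left].
pose U0 : lidx (bang_lintop A B) := exist _ P oP.
exists (nbase U0), V'; split=> //; first exact: nbase_open.
move=> x c [xP|Vc].
  by apply: (clin_canon_sub (cF c) oW (hP := oP)) xP => v; exact.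
have [Z ZW] := nbase_sub (clin_open (cF c) oW); have [v hv] := canon_dense x Z.
rewrite -(subrK (canon _ v) x) (is_linearD (cF c).1).
apply: subspaceD oW.2 (ZW _ hv) _; move: v {hv}; apply: tensor_ind.
  split=> [|d u v hu hv]; first by rewrite (is_linear0 (@canon_lin _ _ _)) (is_linear0 (cF c).1); case: (oW.2).
  by rewrite canon_lin (cF c).1; apply: oW.2.2.
by move=> a b; rewrite sE; apply: h; right; apply: h'; right.
Qed.

Lemma bang_assoc_clin (A B C : ltvsType k) : clin (@bang_assoc k A B C).
Proof. exact: bang_lift_clin (@completion_complete _ _ _) (@bang_assoc_cont A B C). Qed.

End Bilinear.

(** * Linear compactness and the associativity of the star product *)

Section Compactness.
Variable k : fieldType.
Local Open Scope classical_set_scope.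
Local Open Scope ring_scope.

Lemma open_subspace_bigI (A : ltvsType k) n (G : 'I_n -> set A) :
  (forall i, open_subspace (G i)) ->
  exists2 V : set A, open_subspace V & forall i, V `<=` G i.
Proof.
move=> oG.
suff [V oV VG] : exists2 V : set A, open_subspace V &
    forall i, i \in enum 'I_n -> V `<=` G i.
  by exists V => // i; apply: VG; rewrite mem_enum.
elim: (enum _) => [|i r [V oV VG]]; first by exists setT => //; exact: open_subspaceT.
exists (G i `&` V) => [|j]; first exact: open_subspaceI.
by rewrite inE => /predU1P[-> x []//|jr] x [_ Vx]; exact: VG jr x Vx.
Qed.

(** Continuity alone gives, for each [b], a neighbourhood of [0] in [A]; on a
    linearly compact [L] one neighbourhood suffices, because [L] is spanned
    modulo an open subspace by finitely many elements. *)
Lemma star_cont_compact (A B C : ltvsType k) (f : A -> B -> C) (L : subsp B) W :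
  star_cont f -> linearly_compact (sub_ltvs L) -> open_subspace W ->
  exists2 U : set A, open_subspace U & forall a b, U a -> subsp_set L b -> W (f a b).
Proof.
move=> cf [_ fin] oW; have [[fl fr] _] := cf.
have [[U0 [V0 [oU0 oV0 h0]]] _ hb] := cf.2 W oW.
have oN : open_subspace [set x : sub_ltvs L | V0 (submod_val x)].
  split; last first.
    by split; [case: (oV0.2)|move=> c x y /= hx hy; exact: oV0.2.2].
  rewrite openE => x Nx; exists [set x : sub_ltvs L | V0 (submod_val x)]; first by exists V0.
  by move=> u Nu; exact: subspaceD oV0.2 Nx Nu.
have [n [e he]] := fin _ oN.
have [U1 oU1 hU1] := open_subspace_bigI (fun i =>
  clin_open (star_cont_clinl (submod_val (repr (e i))) cf) oW).
exists (U0 `&` U1); first exact: open_subspaceI.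
move=> a b [U0a U1a] Lb; pose b' : sub_ltvs L := Submod Lb.
have [c hc] := he (qpi _ b').
pose s : sub_ltvs L := \sum_i c i *: repr (e i).
have qs : qpi [set x : sub_ltvs L | V0 (submod_val x)] b' = qpi _ s.
  have ql : is_linear (qpi [set x : sub_ltvs L | V0 (submod_val x)]).
    by move=> d x y; rewrite qpiD qpiZ.
  rewrite hc (is_linear_sum _ _ ql); apply: eq_bigr => i _.
  by rewrite (is_linearZ _ ql) /qpi reprK.
have {qs} : V0 (submod_val (b' - s)) by move/qpiP: qs; rewrite linspan_id //; exact: oN.2.
have vl : is_linear (fun x : sub_ltvs L => submod_val x) by [].
move=> V0bs; have -> : f a b = f a (submod_val (b' - s)) + f a (submod_val s).
  by rewrite (is_linearB vl) -(is_linearD (fr a)) subrK.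
apply: subspaceD oW.2 (h0 _ _ U0a V0bs) _.
rewrite (is_linear_sum _ _ vl) (is_linear_sum _ _ (fr a)).
elim/big_ind: _ => [|x y hx hy|i _]; first by case: (oW.2).
  exact: subspaceD oW.2 hx hy.
rewrite (is_linearZ _ vl) (is_linearZ _ (fr a)).
by apply: subspaceZ oW.2 _; exact: hU1 U1a.
Qed.

(** The only place where local linear compactness matters.  For fixed [a], an
    open subspace of [A * (B * C)] contains [a * b * c] for [b] and [c] small,
    but how small [c] has to be depends on [a], whereas continuity on
    [(A * B) * C] asks for one neighbourhood in [C] that serves all [a].  A
    linearly compact open subspace of [C] is such a neighbourhood. *)
Lemma star_assoc_cont (A B C : ltvsType k) : tate C ->
  star_cont (fun (x : cstar A B) (c : C) => star_map id (fun b => ptstar b c) x).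
Proof.
move=> [_ [L [oL cL]]].
apply: (@star_contC k C (cstar A B) _ (fun c x => star_map id (fun b => ptstar b c) x)).
have cp c : clin (fun b : B => ptstar b c) := star_cont_clinl c (@ptstar_cont k B C).
have sE a b c : star_map id (fun b => ptstar b c) (canon (star_lintop A B) (pure a b)) =
    ptstar a (ptstar b c) := star_mapE (@clin_id k A) (cp c) a b.
have trib (a : A) (W : set (cstar A (cstar B C))) : open_subspace W -> exists2 V : set B, open_subspace V &
    forall b (c : C), V b -> subsp_set L c -> W (ptstar a (ptstar b c)).
  move=> oW; have [N oN hN] : exists2 N : set (cstar B C), open_subspace N &
      forall y, N y -> W (ptstar a y).
    exists (ptstar a @^-1` W); last by move=> y.
    exact: (clin_open (star_cont_clinr a (@ptstar_cont k A (cstar B C))) oW).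
  have [V oV hV] := star_cont_compact (@ptstar_cont k B C) cL oN.
  by exists V => // b c Vb Lc; apply: hN; exact: hV.
have tria (b : B) (W : set (cstar A (cstar B C))) : open_subspace W -> exists2 U : set A, open_subspace U &
    forall a (c : C), U a -> subsp_set L c -> W (ptstar a (ptstar b c)).
  have cf : star_cont (fun (a : A) (c : C) => ptstar a (ptstar b c)).
    apply: (star_cont_comp (@ptstar_cont k A (cstar B C)) (@clin_id k A) _ (@clin_id k _)).
    exact: star_cont_clinr (@ptstar_cont k B C).
  exact: star_cont_compact cf cL.
apply: tensor_star_cont => [c|a b|W oW].
- exact: star_map_clin (@clin_id _ _) (cp c).
- rewrite (_ : (fun c => _) = fun c : C => ptstar a (ptstar b c)); last exact: funext.
  apply: (@clin_comp _ _ _ _ (ptstar a) (ptstar b)); exact: star_cont_clinr (@ptstar_cont _ _ _).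
have [[U [N [oU oN h]]] _ _] := (@ptstar_cont k A (cstar B C)).2 W oW.
have [[V [V' [oV oV' h']]] _ _] := (@ptstar_cont k B C).2 N oN.
pose P : set (tensor A B) := [set v | forall c, (subsp_set L `&` V') c ->
  W (star_map id (fun b => ptstar b c) (canon (star_lintop A B) v))].
exists (subsp_set L `&` V'), P; split; last by move=> c v Lc /(_ c Lc).
  by apply: open_subspaceI => //; split=> //; exact: subspP.
split.
- split.
    move=> c _; rewrite (is_linear0 (@canon_lin _ _ _)).
    by rewrite (is_linear0 (star_map_clin (@clin_id _ _) (cp c)).1); case: (oW.2).
  move=> d x y hx hy c Lc; rewrite canon_lin (star_map_clin (@clin_id _ _) (cp c)).1.
  by apply: oW.2.2; [exact: hx|exact: hy].
- by exists U, V; split=> // a b Ua Vb c [_ Vc]; rewrite sE; apply: h => //; exact: h'.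
- move=> a; have [V1 oV1 h1] := trib a W oW; exists V1 => // b Vb c [Lc _].
  by rewrite sE; exact: h1.
- move=> b; have [U1 oU1 h1] := tria b W oW; exists U1 => // a Ua c [Lc _].
  by rewrite sE; exact: h1.
Qed.

Lemma star_assocE (A B C : ltvsType k) (a : A) (b : B) (c : C) : tate C ->
  star_assoc (ptstar (ptstar a b) c) = ptstar a (ptstar b c).
Proof.
move=> tC; have := @star_lift_pure k _ _ _ _ (@star_assoc_cont A B C tC) (ptstar a b) c.
rewrite /star_assoc => ->; rewrite star_mapE //; first exact: clin_id.
exact: star_cont_clinl (@ptstar_cont k B C).
Qed.

Lemma discrete_complete (A : ltvsType k) : open [set (0 : A)] -> complete A.
Proof.
move=> o0; have oU0 : open_subspace [set (0 : A)] by split=> //; exact: subspace0.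
pose T := ltvs_lintop A; pose U0 : lidx T := exist _ _ oU0.
have ci : clin (canon T).
  apply: clinP; first exact: canon_lin.
  by move=> W /canon_cont[U oU UW]; exists U.
split; first exact: ci.2.
pose j (Y : completion T) : A := repr (residue Y U0 : qmod _).
have jP Y : residue Y U0 = qpi _ (j Y) by rewrite /j /qpi reprK.
have ij : cancel (canon T) j.
  move=> z; apply/eqP; rewrite -subr_eq0; apply/eqP.
  have : qpi [set 0] (j (canon T z)) = qpi _ z by rewrite -[LHS]jP.
  by move/qpiP; rewrite linspan_id //; exact: subspace0.
have ji : cancel j (canon T).
  move=> Y; apply: submod_inj; apply: functional_extensionality_dep => W.
  symmetry; apply: (residueP (U := U0)); last exact: jP.
  by move=> _ ->; case: (svalP W).2.
exists j; split=> //; suff [] : clin j by [].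
apply: clinP; first by move=> c X Y; apply: (can_inj ij); rewrite canon_lin !ji.
move=> W oW; exists (nbase U0); first exact: nbase_open.
move=> Y hY; have -> : Y = 0; last first.
  by rewrite /= -(is_linear0 (@canon_lin _ _ T)) ij; case: (oW.2).
rewrite -[Y]ji; have : qpi [set 0] (j Y) = qpi _ 0 by rewrite -[LHS]jP qpi0; exact: hY.
move/qpiP; rewrite linspan_id; last exact: subspace0.
by rewrite subr0 => ->; rewrite (is_linear0 (@canon_lin _ _ T)).
Qed.
End Compactness.

(** * Direct sums and products *)

Section SumsProducts.
Variable k : fieldType.
Local Open Scope classical_set_scope.
Local Open Scope ring_scope.

Section Sum.
Variables (I : choiceType) (X : I -> ltvsType k).

Lemma coord_in i (v : X i) : coord (dsum_in v : dsum X) i = v.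
Proof. by rewrite /coord /= /single dfwith_in. Qed.

Lemma coord_out i j (v : X i) : j != i -> coord (dsum_in v : dsum X) j = 0.
Proof. by move=> ji; rewrite /coord /= /single dfwith_out // eq_sym. Qed.

Lemma dsum_ext (x y : dsum X) : (forall i, coord x i = coord y i) -> x = y.
Proof. by move=> h; apply: submod_inj; apply: functional_extensionality_dep. Qed.

Lemma coord_linear i : is_linear (fun x : dsum X => coord x i).
Proof. by []. Qed.

Lemma coord_lin i c (x y : dsum X) : coord (c *: x + y) i = c *: coord x i + coord y i.
Proof. by []. Qed.

Lemma dsum_in_lin i : is_linear (@dsum_in k I X i).
Proof.
move=> c v w; apply: dsum_ext => j; rewrite coord_lin.
have [->|ji] := eqVneq j i; first by rewrite !coord_in.
by rewrite !coord_out // scaler0 addr0.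
Qed.

Lemma dsum_open (N : set (dsum X)) : subspace N ->
  (forall i, open [set v : X i | N (dsum_in v)]) -> open_subspace N.
Proof.
move=> sN oN; split=> //; rewrite openE => x Nx; exists N => // u Nu.
exact: subspaceD sN Nx Nu.
Qed.

Lemma dsum_in_clin i : clin (@dsum_in k I X i).
Proof.
apply: clinP; first exact: dsum_in_lin.
move=> W [oW sW]; have : nbhs (0 : dsum X) W.
  by apply: open_nbhs_nbhs; split=> //; case: sW.
move=> [N [sN oN] NW]; exists [set v : X i | N (dsum_in v)]; last first.
  by move=> v /= /NW; rewrite add0r.
split=> //; split; first by rewrite /= (is_linear0 (@dsum_in_lin i)); case: sN.
by move=> c v w /= hv hw; rewrite dsum_in_lin; exact: sN.2.
Qed.

Lemma dsum_ind (S : set (dsum X)) :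
  subspace S -> (forall i v, S (@dsum_in k I X i v)) -> forall x, S x.
Proof.
move=> sS h x; have /finite_seqP[r0 r0E] := submodP x.
pose r := undup r0.
have xr j : j \notin r -> coord x j = 0.
  rewrite mem_undup => jr; apply/eqP; apply: contraNT jr => xj.
  by have : [set` r0] j by rewrite -r0E.
have -> : x = \sum_(i <- r) dsum_in (coord x i).
  apply: dsum_ext => j.
  have -> : coord (\sum_(i <- r) dsum_in (coord x i) : dsum X) j =
      \sum_(i <- r) coord (dsum_in (coord x i) : dsum X) j.
    exact: (is_linear_sum _ _ (@coord_linear j)).
  have [jr|jr] := boolP (j \in r).
    rewrite (bigD1_seq j) ?undup_uniq // coord_in big1 => [|i ij].
      exact: esym (addr0 _).
    by rewrite coord_out // eq_sym.
  rewrite xr // big1_seq // => i /andP[_ ir]; rewrite coord_out //.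
  by apply: contraNneq jr => ->.
elim/big_ind: _ => [|u v hu hv|i _]; [by case: sS|exact: subspaceD|exact: h].
Qed.

Lemma eq_linear_dsum (V : lmodType k) (f g : dsum X -> V) : is_linear f -> is_linear g ->
  (forall i v, f (@dsum_in k I X i v) = g (dsum_in v)) -> forall x, f x = g x.
Proof.
move=> fl gl fg; apply: dsum_ind => //; split=> [|c x y hx hy] /=.
  by rewrite !is_linear0.
by rewrite fl gl hx hy.
Qed.

Section Lift.
Variables (D : ltvsType k) (g : forall i, X i -> D).
Definition dsum_lift (x : dsum X) : D := \sum_(i \in [set: I]) g (coord x i).

Hypothesis gl : forall i, is_linear (@g i).

Lemma dsum_lift_lin : is_linear dsum_lift.
Proof.
move=> c x y; have fx := submodP x; have fy := submodP y.
pose P := [set i | coord x i != 0] `|` [set i | coord y i != 0].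
have fP : finite_set P by rewrite finite_setU; split.
rewrite /dsum_lift !(@fsum_sub _ _ _ _ P) //.
- rewrite !fsbig_finite // scaler_sumr -big_split; apply: eq_bigr => i _.
  by rewrite coord_lin gl.
- move=> i; have [->|yi] := eqVneq (coord y i) 0; last by right.
  by rewrite is_linear0 // eqxx.
- move=> i; have [->|xi] := eqVneq (coord x i) 0; last by left.
  by rewrite is_linear0 // eqxx.
- move=> i; have [xi|] := eqVneq (coord x i) 0; last by left.
  have [yi|] := eqVneq (coord y i) 0; last by right.
  by rewrite coord_lin xi yi scaler0 addr0 is_linear0 // eqxx.
Qed.

Lemma dsum_lift_in i (v : X i) : dsum_lift (dsum_in v) = g v.
Proof.
rewrite /dsum_lift (@fsum_sub _ _ _ _ [set i]) //; last first.
  move=> j; have [-> //|ji] := eqVneq j i.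
  by rewrite coord_out // is_linear0 // eqxx.
by rewrite fsbig_set1 coord_in.
Qed.

End Lift.

Lemma dsum_lift_clin (D : ltvsType k) (g : forall i, X i -> D) :
  (forall i, clin (@g i)) -> clin (dsum_lift g).
Proof.
move=> cg; have gl i := (cg i).1; apply: clinP; first exact: dsum_lift_lin.
move=> W oW; exists (dsum_lift g @^-1` W) => //; apply: dsum_open.
  split; first by rewrite /= (is_linear0 (dsum_lift_lin gl)); case: (oW.2).
  by move=> c x y /= hx hy; rewrite dsum_lift_lin //; exact: oW.2.2.
move=> i; rewrite (_ : [set _ | _] = @g i @^-1` W); first exact: (clin_open (cg i) oW).1.
by apply: funext => v /=; rewrite dsum_lift_in.
Qed.

End Sum.

Section Prod.
Variables (I : choiceType) (X : I -> ltvsType k).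

Lemma dprod_at_clin i : clin (@dprod_at k I X i).
Proof.
apply: clinP => // W oW.
pose U j : set (X j) := dfwith (T := fun j => set (X j)) (fun=> setT) W j.
have oU j : open_subspace (U j) by rewrite /U; case: dfwithP => // l _; exact: open_subspaceT.
pose N := [set x : dprod X | forall j, [set i] j -> U j (dprod_at j x)].
have bN : dprod_base (X := X) N by exists [set i], U.
have NE : N `<=` @dprod_at k I X i @^-1` W.
  by move=> x /(_ i erefl); rewrite /U dfwith_in.
exists N => //.
have sN : subspace N.
  split=> [j _|c x y hx hy j ij]; first by case: (oU j).2.
  by apply: (oU j).2.2; [exact: hx|exact: hy].
split=> //; rewrite openE => x Nx; exists N => // u Nu; exact: subspaceD sN Nx Nu.
Qed.

Lemma dprod_clin (D : ltvsType k) (f : D -> dprod X) :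
  (forall i, clin (fun x => dprod_at i (f x))) -> clin f.
Proof.
move=> cf; apply: clinP.
  move=> c x y; apply: functional_extensionality_dep => i; exact: (cf i).1 c x y.
move=> W [oW sW]; have : nbhs (0 : dprod X) W.
  by apply: open_nbhs_nbhs; split=> //; case: sW.
move=> [N [F [U [fF oU ->]]] NW].
have /finite_seqP[r rE] := fF.
have [V oV hV] : exists2 V : set D, open_subspace V &
    forall i, i \in r -> V `<=` (fun x => dprod_at i (f x)) @^-1` U i.
  elim: r {rE} => [|i r [V oV VG]]; first by exists setT => //; exact: open_subspaceT.
  exists ((fun x => dprod_at i (f x)) @^-1` U i `&` V) => [|j].
    by apply: open_subspaceI => //; exact: clin_open.
  by rewrite inE => /predU1P[-> x []//|jr] x [_ Vx]; exact: VG jr x Vx.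
exists V => // x Vx /=; rewrite -[f x]add0r; apply: NW => i Fi.
by apply: hV Vx; move: Fi; rewrite rE.
Qed.
End Prod.
End SumsProducts.

(** * Functoriality of completed tensor products *)

Section TensorMaps.
Variable k : fieldType.
Local Open Scope ring_scope.

Section Bang.
Variables A B A' B' A'' B'' : ltvsType k.

Lemma bang_map_comp (f' : A' -> A'') (g' : B' -> B'') (f : A -> A') (g : B -> B') x :
  clin f' -> clin g' -> clin f -> clin g ->
  bang_map f' g' (bang_map f g x) = bang_map (fun a => f' (f a)) (fun b => g' (g b)) x.
Proof.
move=> cf' cg' cf cg; have c1 := clin_comp cf' cf; have c2 := clin_comp cg' cg.
apply: (eq_clin_cbang (f := fun y => bang_map f' g' (bang_map f g y))) x.
- by apply: clin_comp; exact: bang_map_clin.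
- exact: bang_map_clin.
- by move=> a b; rewrite !bang_mapE.
Qed.

Lemma bang_mapZ c (f : A -> A') (g : B -> B') x : clin f -> clin g ->
  bang_map f g (c *: x) = c *: bang_map f g x.
Proof. by move=> cf cg; exact: (is_linearZ c (bang_map_clin cf cg).1). Qed.

Lemma bang_mapZl c (f : A -> A') (g : B -> B') x : clin f -> clin g ->
  bang_map (fun a => c *: f a) g x = c *: bang_map f g x.
Proof.
move=> cf cg; have cf' := clinZ c cf.
apply: (eq_clin_cbang (g := fun y => c *: bang_map f g y)) x.
- exact: bang_map_clin.
- by apply: clinZ; exact: bang_map_clin.
- move=> a b; rewrite !bang_mapE //; have [[bl _] _] := @ptbang_cont k A' B'.
  exact: (is_linearZ c (bl (g b))).
Qed.

Lemma bang_mapZr c (f : A -> A') (g : B -> B') x : clin f -> clin g ->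
  bang_map f (fun b => c *: g b) x = c *: bang_map f g x.
Proof.
move=> cf cg; have cg' := clinZ c cg.
apply: (eq_clin_cbang (g := fun y => c *: bang_map f g y)) x.
- exact: bang_map_clin.
- by apply: clinZ; exact: bang_map_clin.
- move=> a b; rewrite !bang_mapE //; have [[_ br] _] := @ptbang_cont k A' B'.
  exact: (is_linearZ c (br (f a))).
Qed.

Lemma bang_map_swap (f : A -> A') (g : B -> B') x : clin f -> clin g ->
  bang_swap (bang_map f g x) = bang_map g f (bang_swap x).
Proof.
move=> cf cg.
apply: (eq_clin_cbang (f := fun y => bang_swap (bang_map f g y))
  (g := fun y => bang_map g f (bang_swap y))) x.
- by apply: clin_comp; [exact: bang_swap_clin|exact: bang_map_clin].
- by apply: clin_comp; [exact: bang_map_clin|exact: bang_swap_clin].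
- by move=> a b; rewrite bang_mapE // !bang_swapE bang_mapE.
Qed.
End Bang.

Lemma gunit_discrete n : open [set (0 : gunit k n)]%classic.
Proof.
rewrite openE => x ->; exists [set (0 : gunit k n)]%classic.
  exists [set 0]%classic.
    split; last exact: subspace0.
    by rewrite openE => y ->; exists [set 0]%classic => // z ->; rewrite addr0.
  apply: funext => z; apply: propext; split=> [->//|/= z0]; exact: submod_inj.
by move=> y ->; rewrite addr0.
Qed.

Lemma gunit_complete n : complete (gunit k n).
Proof. exact: discrete_complete (@gunit_discrete n). Qed.

Lemma gunit_eq0 n (x : gunit k n) : n != 0 -> x = 0.
Proof. by move=> n0; apply: submod_inj; case: (submodP x) => // e; rewrite e eqxx in n0. Qed.

Section Units.
Variables (A : ltvsType k) (cA : complete A).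

Lemma unit_act_cont : bang_cont (fun (c : gunit k 0) (a : A) => gunit_val c *: a).
Proof.
split; first by split=> [a|c] d x y; rewrite ?scalerDl ?scalerA // scalerDr !scalerA mulrC.
move=> W oW; exists [set 0]%classic, W; split=> //.
  by split; [exact: gunit_discrete|exact: subspace0].
move=> c a [->|Wa]; last exact: subspaceZ oW.2 Wa.
by rewrite (scale0r a); case: (oW.2).
Qed.

Lemma act_unit_cont : bang_cont (fun (a : A) (c : gunit k 0) => gunit_val c *: a).
Proof.
have [[fl fr] h] := unit_act_cont; split=> // W /h[U [V [oU oV H]]].
by exists V, U; split=> // a c [?|?]; apply: H; [right|left].
Qed.

Definition unit_act : cbang (gunit k 0) A -> A :=
  bang_lift (fun c a => gunit_val c *: a).
Definition act_unit : cbang A (gunit k 0) -> A :=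
  bang_lift (fun a c => gunit_val c *: a).

Lemma unit_act_clin : clin unit_act.
Proof. exact: bang_lift_clin cA unit_act_cont. Qed.

Lemma act_unit_clin : clin act_unit.
Proof. exact: bang_lift_clin cA act_unit_cont. Qed.

Lemma unit_actE c a : unit_act (ptbang c a) = gunit_val c *: a.
Proof. exact: bang_lift_pure unit_act_cont c a. Qed.

Lemma act_unitE a c : act_unit (ptbang a c) = gunit_val c *: a.
Proof. exact: bang_lift_pure act_unit_cont a c. Qed.
End Units.

Lemma act_unit_map (A B : ltvsType k) (f : A -> B) (x : cbang A (gunit k 0)) :
  complete A -> complete B -> clin f -> act_unit (bang_map f id x) = f (act_unit x).
Proof.
move=> cA cB cf; have ci := @clin_id k (gunit k 0).
apply: (eq_clin_cbang (f := fun y => act_unit (bang_map f id y))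
  (g := fun y => f (act_unit y))) x.
- by apply: clin_comp; [exact: act_unit_clin|exact: bang_map_clin].
- by apply: clin_comp => //; exact: act_unit_clin.
- by move=> a b; rewrite bang_mapE // !act_unitE (is_linearZ _ cf.1).
Qed.

Lemma unit_act_swap (A : ltvsType k) (x : cbang A (gunit k 0)) :
  complete A -> unit_act (bang_swap x) = act_unit x.
Proof.
move=> cA; apply: (eq_clin_cbang (f := fun y => unit_act (bang_swap y))) x.
- by apply: clin_comp; [exact: unit_act_clin|exact: bang_swap_clin].
- exact: act_unit_clin.
- by move=> a b; rewrite bang_swapE unit_actE // act_unitE.
Qed.

End TensorMaps.

(** * Graded maps on pure tensors *)

Section Graded.
Variable k : fieldType.
Local Open Scope ring_scope.
Implicit Types A B C D : gspace k.

(** From here on the components of graded maps, of pure tensors and of elements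
    of a bang product are used through versions that take plain degrees and no
    proof that these add up, with value [0] when they do not.  Equal degrees can
    then be exchanged by rewriting, without transport. *)
Lemma gfunE A B (f : gmap A B) i j (e : i + gdeg f = j) x :
  gfun e x = gcomponent f j x.
Proof.
rewrite /gcomponent; case: eqP => // e'.
by rewrite (Prop_irrelevance e e').
Qed.

Lemma gcomponent_out A B (f : gmap A B) i j (x : A i) :
  i + gdeg f != j -> gcomponent f j x = 0.
Proof. by rewrite /gcomponent; case: eqP. Qed.

Lemma eq_gmap A B (f g : gmap A B) : gdeg f = gdeg g ->
  (forall i j (x : A i), i + gdeg f = j -> gcomponent f j x = gcomponent g j x) -> f = g.
Proof.
move=> dfg h; case: f g dfg h => [d f] [d' g] /= e; subst d' => h; congr GMap.
apply: functional_extensionality_dep => i; apply: functional_extensionality_dep => j.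
apply: functional_extensionality_dep => e; apply: functional_extensionality_dep => x.
by have := h i j x e; rewrite -(@gfunE _ _ (GMap f) i j e) -(@gfunE _ _ (GMap g) i j e).
Qed.

Lemma gcomponent_clin A B (f : gmap A B) i j : ghom f ->
  clin (gcomponent f j : A i -> B j).
Proof.
move=> hf; have [e|ne] := eqVneq (i + gdeg f) j.
  rewrite (_ : gcomponent f j = gfun e); first exact: hf.
  by apply: funext => x; rewrite gfunE.
rewrite (_ : (gcomponent f j : A i -> B j) = fun=> 0); first exact: clin0.
by apply: funext => x; rewrite gcomponent_out.
Qed.

Lemma gcomp_component A B C (g : gmap B C) (f : gmap A B) i j l (x : A i) :
  i + gdeg f = j -> gcomponent (g ∘ f)%G l x = gcomponent g l (gcomponent f j x).
Proof.
move=> <-; have [e|ne] := eqVneq (i + gdeg (g ∘ f)%G) l.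
  by rewrite -(gfunE e) /= !gfunE.
by rewrite !gcomponent_out //; apply: contraNneq ne => /= <-; rewrite addrA.
Qed.

Lemma gid_component A i (x : A i) : gcomponent (gid A) i x = x.
Proof.
have e : i + gdeg (gid A) = i by rewrite /= addr0.
rewrite -(gfunE e) /= /gcast; move: (etrans _ _) => e'.
by rewrite (Prop_irrelevance e' erefl).
Qed.

Lemma gscale_component A B c (f : gmap A B) i j (x : A i) :
  gcomponent (gscale c f) j x = c *: gcomponent f j x.
Proof.
have [e|ne] := eqVneq (i + gdeg f) j; last by rewrite !gcomponent_out ?scaler0.
by rewrite -(gfunE e) -(@gfunE _ _ (gscale c f) i j e).
Qed.

Lemma gadd_component A B (f g : gmap A B) i j (x : A i) : gdeg f = gdeg g ->
  gcomponent (f + g)%G j x = gcomponent f j x + gcomponent g j x.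
Proof.
move=> dfg; have [e|ne] := eqVneq (i + gdeg f) j; last by rewrite !gcomponent_out ?addr0 -?dfg.
by rewrite -(@gfunE _ _ (f + g)%G i j e) /= gfunE.
Qed.

Definition star_pure A B n i j (a : A i) (b : B j) : star A B n :=
  if @eqP _ (i + j) n is ReflectT e then star_in e (ptstar a b) else 0.

Definition bang_comp A B n i j (x : bang A B n) : cbang (A i) (B j) :=
  if @eqP _ (i + j) n is ReflectT e then bang_at e x else 0.

Lemma star_inE A B n i j (e : i + j = n) (a : A i) (b : B j) :
  star_in e (ptstar a b) = star_pure n a b.
Proof. by rewrite /star_pure; case: eqP => // e'; rewrite (Prop_irrelevance e e'). Qed.

Lemma star_pure_out A B n i j (a : A i) (b : B j) : i + j != n -> star_pure n a b = 0.
Proof. by rewrite /star_pure; case: eqP. Qed.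

Lemma bang_atE A B n i j (e : i + j = n) (x : bang A B n) : bang_at e x = bang_comp i j x.
Proof. by rewrite /bang_comp; case: eqP => // e'; rewrite (Prop_irrelevance e e'). Qed.

Lemma star_in_clin A B n i j (e : i + j = n) : clin (@star_in k A B n i j e).
Proof. exact: (@dsum_in_clin k _ (@star_family k A B n) (mkidx e)). Qed.

Lemma bang_at_clin A B n i j (e : i + j = n) : clin (@bang_at k A B n i j e).
Proof. exact: (@dprod_at_clin k _ (@bang_family k A B n) (mkidx e)). Qed.

Lemma bang_clin A B n (D : ltvsType k) (f : D -> bang A B n) :
  (forall t : idx n, clin (fun x => f x t)) -> clin f.
Proof. exact: (@dprod_clin k _ (@bang_family k A B n)). Qed.

Lemma star_pure_cont A B n i j : star_cont (@star_pure A B n i j).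
Proof.
have [e|ne] := eqVneq (i + j) n.
  rewrite (_ : @star_pure A B n i j = fun a b => star_in e (ptstar a b)).
    exact: (@star_cont_comp k _ _ _ _ _ (star A B n) (@ptstar k (A i) (B j)) id id (star_in e)
      (@ptstar_cont k (A i) (B j)) (@clin_id k _) (@clin_id k _) (star_in_clin A B e)).
  by apply: funext => a; apply: funext => b; rewrite star_inE.
rewrite (_ : @star_pure A B n i j = fun a b => 0).
  split; first by split=> ? ? ? ?; rewrite scaler0 addr0.
  move=> W [_ [W0 _]]; split.
  - by exists setT, setT; split=> //; exact: open_subspaceT.
  - by move=> ?; exists setT => //; exact: open_subspaceT.
  - by move=> ?; exists setT => //; exact: open_subspaceT.
by apply: funext => a; apply: funext => b; rewrite star_pure_out.
Qed.

Lemma star_pure_clinl A B n i j (b : B j) :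
  clin (fun a : A i => star_pure n a b).
Proof. exact: star_cont_clinl (@star_pure_cont A B n i j). Qed.

Lemma star_pure_clinr A B n i j (a : A i) :
  clin (fun b : B j => star_pure n a b).
Proof. exact: star_cont_clinr (@star_pure_cont A B n i j). Qed.

Lemma bang_comp_clin A B n i j : clin (@bang_comp A B n i j).
Proof.
have [e|ne] := eqVneq (i + j) n.
  rewrite (_ : @bang_comp A B n i j = bang_at e).
    exact: bang_at_clin.
  by apply: funext => x; rewrite bang_atE.
rewrite (_ : @bang_comp A B n i j = fun=> 0); first exact: clin0.
by apply: funext => x; rewrite /bang_comp; case: eqP ne => // ->; rewrite eqxx.
Qed.

Lemma idx_eta n (s : idx n) : s = mkidx (idxP s).
Proof. by case: s => -[i j] e; rewrite /mkidx; congr exist; exact: bool_irrelevance. Qed.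

Lemma bang_ext A B n (x y : bang A B n) :
  (forall i j, i + j = n -> bang_comp i j x = bang_comp i j y) -> x = y.
Proof.
move=> h; apply: functional_extensionality_dep => s; rewrite (idx_eta s).
by have := h _ _ (idxP s); rewrite -!(bang_atE (idxP s)).
Qed.

Lemma eq_clin_star A B n (D : ltvsType k) (f g : star A B n -> D) :
  clin f -> clin g ->
  (forall i j (a : A i) (b : B j), i + j = n ->
     f (star_pure n a b) = g (star_pure n a b)) -> forall x, f x = g x.
Proof.
move=> cf cg fg; apply: eq_linear_dsum cf.1 cg.1 _ => s v.
rewrite (idx_eta s) in v *.
have cin : clin (star_in (A := A) (B := B) (idxP s)) := star_in_clin A B (idxP s).
apply: (eq_clin_cstar (f := fun v => f (star_in (idxP s) v))
  (g := fun v => g (star_in (idxP s) v))) v.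
- exact: clin_comp cf cin.
- exact: clin_comp cg cin.
- by move=> a b; rewrite star_inE; apply: fg; exact: idxP.
Qed.

(** Pure tensors span a dense subspace of each summand. *)
Lemma eq_ghom_star A B C (f g : gmap (star A B) C) :
  ghom f -> ghom g -> gdeg f = gdeg g ->
  (forall i j l (a : A i) (b : B j), i + j + gdeg f = l ->
     gcomponent f l (star_pure (i + j) a b) = gcomponent g l (star_pure (i + j) a b)) ->
  f = g.
Proof.
move=> hf hg dfg h; apply: eq_gmap => // n l x e.
apply: (eq_clin_star (f := gcomponent f l) (g := gcomponent g l)) x => [||i j a b ij].
- exact: gcomponent_clin.
- exact: gcomponent_clin.
- by rewrite -{n} ij in e *; exact: h.
Qed.

Section Tensor.
Variables (A A' B B' C : gspace k).

Let star_tens_term (f : gmap A A') (g : gmap B B') n n' (e : n + (gdeg f + gdeg g) = n')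
    (s : idx n) (x : star_family A B s) : star A' B' n' :=
  star_in (shift_deg s e)
    (sgn k (gdeg g * fst_idx s) *:
      star_map (gfun (erefl (fst_idx s + gdeg f))) (gfun (erefl (snd_idx s + gdeg g))) x).

Let star_tens_term_clin f g n n' e s :
  ghom f -> ghom g -> clin (@star_tens_term f g n n' e s).
Proof.
move=> hf hg; apply: (clin_comp (star_in_clin _ _ _)).
by apply: clinZ; apply: star_map_clin; [exact: hf|exact: hg].
Qed.

Lemma star_tens_pure (f : gmap A A') (g : gmap B B') n n' i j i' j' (a : A i) (b : B j) :
  ghom f -> ghom g -> i + gdeg f = i' -> j + gdeg g = j' -> i + j = n ->
  gcomponent (f ⊗* g)%G n' (star_pure n a b) =
  sgn k (gdeg g * i) *: star_pure n' (gcomponent f i' a) (gcomponent g j' b).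
Proof.
move=> hf hg <- <- ij.
have [e|ne] := eqVneq (n + gdeg (f ⊗* g)%G) n'; last first.
  rewrite gcomponent_out // star_pure_out ?scaler0 //.
  by apply: contraNneq ne => /= <-; rewrite -ij addrACA.
rewrite -(gfunE e) -(star_inE ij).
have gl s := (star_tens_term_clin e s hf hg).1.
apply: etrans; first exact: (dsum_lift_in gl (i := mkidx ij)).
rewrite /star_tens_term /= (is_linearZ _ (star_in_clin _ _ _).1).
by rewrite star_mapE; [rewrite star_inE !gfunE|exact: hf|exact: hg].
Qed.

Lemma star_tens_ghom (f : gmap A A') (g : gmap B B') :
  ghom f -> ghom g -> ghom (f ⊗* g)%G.
Proof.
move=> hf hg n n' e.
exact: (dsum_lift_clin (fun s => star_tens_term_clin e s hf hg)).
Qed.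

Lemma bang_tens_comp (f : gmap A A') (g : gmap B B') n n' i j p q (x : bang A B n) :
  i + gdeg f = p -> j + gdeg g = q -> i + j = n -> p + q = n' ->
  bang_comp p q (gcomponent (f ⊗! g)%G n' x) =
  sgn k (gdeg g * i) *: bang_map (gcomponent f p) (gcomponent g q) (bang_comp i j x).
Proof.
move=> ip jq ij pq.
have ei : i = p - gdeg f by rewrite -ip addrK.
have ej : j = q - gdeg g by rewrite -jq addrK.
subst i j.
have e : n + gdeg (f ⊗! g)%G = n' by rewrite /= -pq -ij addrACA !subrK.
have fE : gfun (subrK (gdeg f) p) = gcomponent f p by apply: funext => z; exact: gfunE.
have gE : gfun (subrK (gdeg g) q) = gcomponent g q by apply: funext => z; exact: gfunE.
by rewrite -(gfunE e) -(bang_atE pq) -fE -gE -(bang_atE (unshift_deg (mkidx pq) e)).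
Qed.

Lemma bang_tens_ghom (f : gmap A A') (g : gmap B B') :
  ghom f -> ghom g -> ghom (f ⊗! g)%G.
Proof.
move=> hf hg n n' e; apply: bang_clin => t.
exact: (clinZ _ (clin_comp (bang_map_clin (hf _ _ (subrK (gdeg f) (fst_idx t)))
  (hg _ _ (subrK (gdeg g) (snd_idx t)))) (bang_at_clin A B (unshift_deg t e)))).
Qed.

Let star_tau_term n n' (e : n + 0 = n') (s : idx n) (x : star_family A B s) :
    star B A n' :=
  star_in (swap_deg s e) (sgn k (fst_idx s * snd_idx s) *: star_swap x).

Let star_tau_term_clin n n' e s : clin (@star_tau_term n n' e s).
Proof.
apply: (clin_comp (star_in_clin _ _ _)).
by apply: clinZ; exact: star_swap_clin.
Qed.

Lemma star_tau_pure n n' i j (a : A i) (b : B j) : i + j = n ->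
  gcomponent (star_tau A B) n' (star_pure n a b) = sgn k (i * j) *: star_pure n' b a.
Proof.
move=> ij; have [e|ne] := eqVneq (n + gdeg (star_tau A B)) n'; last first.
  rewrite gcomponent_out // star_pure_out ?scaler0 //.
  by apply: contraNneq ne => /= <-; rewrite -ij addr0 addrC.
rewrite -(gfunE e) -(star_inE ij).
have gl s := (star_tau_term_clin e s).1.
apply: etrans; first exact: (dsum_lift_in gl (i := mkidx ij)).
by rewrite /star_tau_term /= (is_linearZ _ (star_in_clin _ _ _).1) star_swapE star_inE.
Qed.

Lemma star_tau_ghom : ghom (star_tau A B).
Proof. by move=> n n' e; exact: (dsum_lift_clin (star_tau_term_clin e)). Qed.

Lemma bang_tau_comp n n' p q (x : bang A B n) : q + p = n -> n = n' ->
  bang_comp p q (gcomponent (bang_tau A B) n' x) = sgn k (p * q) *: bang_swap (bang_comp q p x).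
Proof.
move=> pq nn'; have pq' : p + q = n' by rewrite addrC pq.
have e : n + gdeg (bang_tau A B) = n' by rewrite /= addr0.
by rewrite -(gfunE e) -(bang_atE pq') /bang_at /dprod_at /= /bang_mk /= bang_atE.
Qed.

Lemma bang_tau_ghom : ghom (bang_tau A B).
Proof.
move=> n n' e; apply: bang_clin => t.
exact: (clinZ _ (clin_comp (@bang_swap_clin k _ _) (bang_at_clin A B (unswap_deg t e)))).
Qed.

Let gdistl_term n n' (e : n + 0 = n') (t : idx n') (s : idx n)
    (x : star_family A (bang B C) s) : cbang (star A B (fst_idx t)) (C (snd_idx t)) :=
  bang_map (star_in (distl_deg2 s t e)) id
    (distl (star_map id (bang_at (distl_deg1 s t)) x)).

Let gdistl_at_clin n n' (t : idx n') (s : idx n) :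
  clin (@bang_at k B C _ _ _ (distl_deg1 s t)).
Proof. exact: bang_at_clin. Qed.

Let gdistl_term_clin n n' e t s : clin (@gdistl_term n n' e t s).
Proof.
apply: (clin_comp (bang_map_clin (star_in_clin _ _ _) (@clin_id k _))).
apply: (clin_comp (@distl_clin k _ _ _)).
by apply: star_map_clin; [exact: clin_id|exact: gdistl_at_clin].
Qed.

Lemma gdistl_comp n n' i j p q r (a : A i) (y : bang B C j) :
  i + j = n -> n = n' -> i + r = p -> r + q = j ->
  bang_comp p q (gcomponent (gdistl A B C) n' (star_pure n a y)) =
  bang_map (fun b : B r => star_pure p a b) id (bang_comp r q y).
Proof.
move=> ij nn' ir rq; have er : r = j - q by rewrite -rq addrK.
subst r; have pq : p + q = n' by rewrite -nn' -ij -ir -addrA rq.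
have e : n + gdeg (gdistl A B C) = n' by rewrite /= addr0.
rewrite -(gfunE e) -(bang_atE pq) -(star_inE ij).
have gl s := (gdistl_term_clin e (mkidx pq) s).1.
apply: etrans; first exact: (dsum_lift_in gl (i := mkidx ij)).
rewrite /gdistl_term /= star_mapE; [|exact: clin_id|exact: gdistl_at_clin].
rewrite distlE bang_map_comp; [|exact: star_in_clin|exact: clin_id| |exact: clin_id]; last first.
  exact: star_cont_clinr (@ptstar_cont k _ _).
have sE : (fun b : B (j - q) => star_pure p a b) =
    fun b => star_in (distl_deg2 (mkidx ij) (mkidx pq) e) (ptstar a b).
  by apply: funext => b; exact: esym (star_inE _ a b).
by rewrite sE -(bang_atE (distl_deg1 (mkidx ij) (mkidx pq))).
Qed.

Lemma gdistl_ghom : ghom (gdistl A B C).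
Proof.
move=> n n' e; apply: bang_clin => t.
exact: (dsum_lift_clin (gdistl_term_clin e t)).
Qed.

Let gdistr_term n n' (e : n + 0 = n') (t : idx n') (s : idx n)
    (x : star_family (bang A B) C s) : cbang (A (fst_idx t)) (star B C (snd_idx t)) :=
  bang_map id (star_in (distr_deg2 s t e))
    (distr (star_map (bang_at (distr_deg1 s t)) id x)).

Let gdistr_at_clin n n' (t : idx n') (s : idx n) :
  clin (@bang_at k A B _ _ _ (distr_deg1 s t)).
Proof. exact: bang_at_clin. Qed.

Let gdistr_term_clin n n' e t s : clin (@gdistr_term n n' e t s).
Proof.
apply: (clin_comp (bang_map_clin (@clin_id k _) (star_in_clin _ _ _))).
apply: (clin_comp (@distr_clin k _ _ _)).
by apply: star_map_clin; [exact: gdistr_at_clin|exact: clin_id].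
Qed.

Lemma gdistr_comp n n' i j p q r (x : bang A B i) (c : C j) :
  i + j = n -> n = n' -> r + j = q -> p + r = i ->
  bang_comp p q (gcomponent (gdistr A B C) n' (star_pure n x c)) =
  bang_map id (fun b : B r => star_pure q b c) (bang_comp p r x).
Proof.
move=> ij nn' rj pr; have er : r = i - p by rewrite -pr addrC addKr.
subst r; have pq : p + q = n' by rewrite -nn' -ij -rj addrA pr.
have e : n + gdeg (gdistr A B C) = n' by rewrite /= addr0.
rewrite -(gfunE e) -(bang_atE pq) -(star_inE ij).
have gl s := (gdistr_term_clin e (mkidx pq) s).1.
apply: etrans; first exact: (dsum_lift_in gl (i := mkidx ij)).
rewrite /gdistr_term /= star_mapE; [|exact: gdistr_at_clin|exact: clin_id].
rewrite distrE bang_map_comp; [|exact: clin_id|exact: star_in_clin|exact: clin_id|]; last first.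
  exact: star_cont_clinl (@ptstar_cont k _ _).
have sE : (fun b : B (i - p) => star_pure q b c) =
    fun b => star_in (distr_deg2 (mkidx ij) (mkidx pq) e) (ptstar b c).
  by apply: funext => b; exact: esym (star_inE _ b c).
by rewrite sE -(bang_atE (distr_deg1 (mkidx ij) (mkidx pq))).
Qed.

Lemma gdistr_ghom : ghom (gdistr A B C).
Proof.
move=> n n' e; apply: bang_clin => t.
exact: (dsum_lift_clin (gdistr_term_clin e t)).
Qed.

Definition mkidx3 n i j l (e : i + j + l = n) : idx3 n :=
  exist (fun p : int * int * int => p.1.1 + p.1.2 + p.2 == n) (i, j, l) (introT eqP e).

Definition star3_pure i j l (a : A i) (b : B j) (c : C l) : star3 A B C (i + j + l) :=
  @dsum_in k _ (fun s : idx3 (i + j + l) =>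
    cstar (cstar (A (idx3_1 s)) (B (idx3_2 s))) (C (idx3_3 s)))
    (mkidx3 erefl) (ptstar (ptstar a b) c).

Lemma star3l_pure i j l n' (a : A i) (b : B j) (c : C l) : i + j + l = n' ->
  gcomponent (star3l A B C) n' (star3_pure a b c) = star_pure n' (star_pure (i + j) a b) c.
Proof.
move=> nn'; have e : (i + j + l) + gdeg (star3l A B C) = n' by rewrite /= addr0.
rewrite -(gfunE e) /=.
have cs (s : idx3 (i + j + l)) : clin (fun x : cstar (cstar (A (idx3_1 s)) (B (idx3_2 s))) (C (idx3_3 s)) =>
  star_in (idx3l_deg s e) (star_map (star_in (erefl (idx3_1 s + idx3_2 s))) id x)
    : star (star A B) C n').
  apply: (clin_comp (star_in_clin _ _ _)).
  by apply: star_map_clin; [exact: star_in_clin|exact: clin_id].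
apply: etrans; first exact: (@dsum_lift_in k _ (fun s : idx3 (i + j + l) =>
    cstar (cstar (A (idx3_1 s)) (B (idx3_2 s))) (C (idx3_3 s))) _ _ (fun s => (cs s).1) (mkidx3 erefl)).
rewrite /=; by rewrite star_mapE; [rewrite !star_inE|exact: star_in_clin|exact: clin_id].
Qed.

Lemma star3r_pure i j l n' (a : A i) (b : B j) (c : C l) : (forall l, tate (C l)) -> i + j + l = n' ->
  gcomponent (star3r A B C) n' (star3_pure a b c) = star_pure n' a (star_pure (j + l) b c).
Proof.
move=> tC nn'; have e : (i + j + l) + gdeg (star3r A B C) = n' by rewrite /= addr0.
rewrite -(gfunE e) /=.
have cs (s : idx3 (i + j + l)) : clin (fun x : cstar (cstar (A (idx3_1 s)) (B (idx3_2 s))) (C (idx3_3 s)) =>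
  star_in (idx3r_deg s e) (star_map id (star_in (erefl (idx3_2 s + idx3_3 s))) (star_assoc x))
    : star A (star B C) n').
  apply: (clin_comp (star_in_clin _ _ _)).
  apply: (clin_comp (star_map_clin (@clin_id k _) (star_in_clin _ _ _))).
  by apply: star_lift_clin; [exact: completion_complete|exact: star_assoc_cont].
apply: etrans; first exact: (@dsum_lift_in k _ (fun s : idx3 (i + j + l) =>
    cstar (cstar (A (idx3_1 s)) (B (idx3_2 s))) (C (idx3_3 s))) _ _ (fun s => (cs s).1) (mkidx3 erefl)).
rewrite /= star_assocE //.
by rewrite star_mapE; [rewrite !star_inE|exact: clin_id|exact: star_in_clin].
Qed.

Lemma star_lunit_component n' i (a : A i) :
  gcomponent (star_lunit A) n' a = star_pure n' (gone k) a.
Proof.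
have [e|ne] := eqVneq (i + gdeg (star_lunit A)) n'.
  by rewrite -(gfunE e) /= star_inE.
by rewrite gcomponent_out // star_pure_out //; apply: contraNneq ne => <-; rewrite addr0 add0r.
Qed.

Lemma star_runit_component n' i (a : A i) :
  gcomponent (star_runit A) n' a = star_pure n' a (gone k).
Proof.
have [e|ne] := eqVneq (i + gdeg (star_runit A)) n'.
  by rewrite -(gfunE e) /= star_inE.
by rewrite gcomponent_out // star_pure_out.
Qed.

Lemma bang_lunit_component n (x : bang (gunit k) A n) :
  gcomponent (bang_lunit A) n x = unit_act (bang_comp 0 n x).
Proof.
have e : n + gdeg (bang_lunit A) = n by rewrite /= addr0.
by rewrite -(gfunE e) /= bang_atE.
Qed.

Lemma bang_runit_component n (x : bang A (gunit k) n) :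
  gcomponent (bang_runit A) n x = act_unit (bang_comp n 0 x).
Proof.
have e : n + gdeg (bang_runit A) = n by rewrite /= addr0.
by rewrite -(gfunE e) /= bang_atE.
Qed.

Lemma star_lunit_ghom : ghom (star_lunit A).
Proof.
move=> n n' e; apply: (clin_comp (star_in_clin _ _ _)).
exact: star_cont_clinr (@ptstar_cont k _ _).
Qed.

Lemma star_runit_ghom : ghom (star_runit A).
Proof.
move=> n n' e; apply: (clin_comp (star_in_clin _ _ _)).
exact: star_cont_clinl (@ptstar_cont k _ _).
Qed.

Lemma bang_lunit_ghom : (forall i, complete (A i)) -> ghom (bang_lunit A).
Proof.
move=> cA n n' e; exact: (clin_comp (unit_act_clin (cA n')) (bang_at_clin (gunit k) A (lunit_deg' e))).
Qed.

Lemma bang_runit_ghom : (forall i, complete (A i)) -> ghom (bang_runit A).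
Proof.
move=> cA n n' e; exact: (clin_comp (act_unit_clin (cA n')) (bang_at_clin A (gunit k) (runit_deg' e))).
Qed.

Lemma gid_ghom : ghom (gid A).
Proof.
move=> i j e; have e' : i = j by rewrite -e /= addr0.
case: j / e' e => e.
rewrite (_ : gfun e = id); first exact: clin_id.
by apply: funext => x; rewrite gfunE gid_component.
Qed.

Lemma gcomp_ghom (g : gmap B C) (f : gmap A B) : ghom g -> ghom f -> ghom (g ∘ f)%G.
Proof. by move=> hg hf i j e; exact: clin_comp (hg _ _ _) (hf _ _ _). Qed.

Lemma gscale_ghom c (f : gmap A B) : ghom f -> ghom (gscale c f).
Proof. by move=> hf i j e; exact: clinZ (hf _ _ _). Qed.

Lemma gadd_ghom (f g : gmap A B) : ghom f -> ghom g -> ghom (f + g)%G.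
Proof.
by move=> hf hg i j e; apply: clinD; [exact: hf|exact: gcomponent_clin].
Qed.

End Tensor.
End Graded.

(** * Signs *)

Section Signs.
Variable k : fieldType.
Local Open Scope ring_scope.

(** Degrees enter the signs modulo 2 only, which makes every identity between
    signs a finite check. *)
Definition parity (n : int) : bool := odd `|n|%N.

Lemma parityD a b : parity (a + b) = parity a (+) parity b.
Proof. rewrite /parity; lia. Qed.
Lemma parityM a b : parity (a * b) = parity a && parity b.
Proof. by rewrite /parity abszM oddM. Qed.
Lemma parityN a : parity (- a) = parity a.
Proof. by rewrite /parity abszN. Qed.
Lemma parity0 : parity 0 = false. Proof. by []. Qed.
Lemma parity1 : parity 1 = true. Proof. by []. Qed.
Definition parityE := (parityD, parityM, parityN, parity0, parity1).

Lemma sgnE n : sgn k n = if parity n then -1 else 1.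
Proof.
rewrite /sgn /parity; case: n => n.
  by rewrite -exprnP -signr_odd /=; case: (odd n).
by rewrite NegzE -exprnN -signr_odd abszN /=; case: (~~ odd n); rewrite ?invrN1 ?invr1.
Qed.

Lemma eq_sgn a b : parity a = parity b -> sgn k a = sgn k b.
Proof. by rewrite !sgnE => ->. Qed.

Lemma sgnD a b : sgn k (a + b) = sgn k a * sgn k b.
Proof. by rewrite !sgnE parityD; case: parity; case: parity; rewrite /= ?mulrNN ?mulr1 ?mul1r. Qed.

Lemma sgnMM a : sgn k a * sgn k a = 1.
Proof. by rewrite sgnE; case: parity; rewrite ?mulrNN mulr1. Qed.

End Signs.

(** * Composites of a product and a coproduct on pure tensors *)

Ltac deg := by rewrite /=; lia.

Section Composites.
Variable k : fieldType.
Local Open Scope ring_scope.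
Implicit Types A B C D X Y : gspace k.

Lemma bang_compZ A B n i j c (x : bang A B n) :
  bang_comp i j (c *: x) = c *: bang_comp i j x.
Proof. exact: (is_linearZ c (@bang_comp_clin k A B n i j).1). Qed.

Lemma gcomponentZ A B (f : gmap A B) i j c (x : A i) :
  ghom f -> gcomponent f j (c *: x) = c *: gcomponent f j x.
Proof. by move=> hf; exact: (is_linearZ c (gcomponent_clin i j hf).1). Qed.

Lemma sgn0 : sgn k 0 = 1. Proof. by []. Qed.

Lemma gid_fun A i : (gcomponent (gid A) i : A i -> A i) = id.
Proof. by apply: funext => x; rewrite gid_component. Qed.

Lemma comp_left_ghom A B C D X (g : gmap (star C D) X) (f : gmap A (bang B C)) :
  ghom g -> ghom f -> ghom (comp_left g f).
Proof.
move=> hg hf; apply: gcomp_ghom; first apply: gcomp_ghom.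
- by apply: bang_tens_ghom => //; exact: gid_ghom.
- exact: gdistr_ghom.
- by apply: star_tens_ghom => //; exact: gid_ghom.
Qed.

Lemma comp_right_ghom A B C D X (g : gmap (star A B) X) (f : gmap D (bang B C)) :
  ghom g -> ghom f -> ghom (comp_right g f).
Proof.
move=> hg hf; apply: gcomp_ghom; first apply: gcomp_ghom.
- by apply: bang_tens_ghom => //; exact: gid_ghom.
- exact: gdistl_ghom.
- by apply: star_tens_ghom => //; exact: gid_ghom.
Qed.

Lemma mid_out_ghom A B C D X (f : gmap X (bang B C)) : ghom f -> ghom (mid_out A D f).
Proof.
move=> hf; apply: gcomp_ghom; first exact: gdistl_ghom.
apply: star_tens_ghom; first exact: gid_ghom.
apply: gcomp_ghom; first exact: gdistr_ghom.
by apply: star_tens_ghom => //; exact: gid_ghom.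
Qed.

Lemma mid_in_ghom A B C D X (f : gmap (star B C) X) : ghom f -> ghom (mid_in A D f).
Proof.
move=> hf; apply: gcomp_ghom; last exact: gdistr_ghom.
apply: bang_tens_ghom; first exact: gid_ghom.
apply: gcomp_ghom; last exact: gdistl_ghom.
by apply: bang_tens_ghom => //; exact: gid_ghom.
Qed.

Lemma mid_elt_ghom A B C D (e : gmap (gunit k) (bang B C)) :
  ghom e -> ghom (mid_elt A D e).
Proof.
move=> he; apply: gcomp_ghom; first exact: mid_out_ghom.
by apply: star_tens_ghom; [exact: gid_ghom|exact: star_lunit_ghom].
Qed.

Lemma mid_form_ghom A B C D (f : gmap (star B C) (gunit k)) :
  (forall i, complete (D i)) -> ghom f -> ghom (mid_form A D f).
Proof.
move=> cD hf; apply: gcomp_ghom; last exact: mid_in_ghom.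
by apply: bang_tens_ghom; [exact: gid_ghom|exact: bang_lunit_ghom].
Qed.

(** In Sweedler notation [f a] is a sum of [a' ! a''], and the composite sends
    [a * d] to the sum of [± a' ! g(a'' * d)].  The component [(p, q)] of the
    result involves only the component [(p, r)] of [f a]. *)
Lemma comp_left_pure A B C D X (g : gmap (star C D) X) (f : gmap A (bang B C))
    n n' i j p q r (a : A i) (d : D j) :
  ghom g -> ghom f -> i + j = n -> p + q = n' ->
  i + gdeg f = p + r -> r + j + gdeg g = q ->
  bang_comp p q (gcomponent (comp_left g f) n' (star_pure n a d)) =
  sgn k (gdeg g * p) *: bang_map id (fun x : C r => gcomponent g q (star_pure (r + j) x d))
                         (bang_comp p r (gcomponent f (p + r) a)).
Proof.
move=> hg hf ij pq ip rq.
rewrite /comp_left (gcomp_component _ _ _ (j := p + r + j)); last deg.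
rewrite (star_tens_pure _ _ _ hf (@gid_ghom k D) (i' := p + r) (j' := j)) //; last deg.
rewrite gid_component mul0r sgn0 scale1r.
rewrite (gcomp_component _ _ _ (j := p + r + j)); last deg.
rewrite (bang_tens_comp _ _ _ (i := p) (j := r + j)) //; [|deg|deg].
rewrite gid_fun (gdistr_comp _ _ _ _ _ (r := r)) //.
rewrite bang_map_comp //; first exact: clin_id.
- exact: gcomponent_clin.
- exact: clin_id.
- exact: star_pure_clinl.
Qed.

Lemma comp_right_pure A B C D X (g : gmap (star A B) X) (f : gmap D (bang B C))
    n n' i j p q r (a : A i) (d : D j) :
  ghom g -> ghom f -> i + j = n -> p + q = n' ->
  j + gdeg f = r + q -> i + r + gdeg g = p ->
  bang_comp p q (gcomponent (comp_right g f) n' (star_pure n a d)) =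
  sgn k (gdeg f * i) *: bang_map (fun x : B r => gcomponent g p (star_pure (i + r) a x)) id
                         (bang_comp r q (gcomponent f (r + q) d)).
Proof.
move=> hg hf ij pq jq rp.
rewrite /comp_right (gcomp_component _ _ _ (j := i + (r + q))); last deg.
rewrite (star_tens_pure _ _ _ (@gid_ghom k A) hf (i' := i) (j' := r + q)) //; last deg.
rewrite gid_component gcomponentZ; last first.
  by apply: gcomp_ghom; [apply: bang_tens_ghom => //; exact: gid_ghom|exact: gdistl_ghom].
rewrite bang_compZ; congr (_ *: _).
rewrite (gcomp_component _ _ _ (j := i + (r + q))); last deg.
rewrite (bang_tens_comp _ _ _ (i := i + r) (j := q)) //; [|deg|deg].
rewrite mul0r sgn0 scale1r gid_fun (gdistl_comp _ _ _ _ _ (r := r)) //.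
rewrite bang_map_comp //; last exact: clin_id.
- exact: gcomponent_clin.
- exact: clin_id.
- exact: star_pure_clinr.
Qed.

Lemma mid_elt_pure A B C D X Y (e : gmap (gunit k) (bang B C))
    (g : gmap (star A B) X) (h : gmap (star C D) Y)
    n n' i j p q x y (a : A i) (d : D j) :
  ghom g -> ghom h -> ghom e -> i + j = n -> p + q = n' -> gdeg e = x + y ->
  i + x + gdeg g = p -> y + j + gdeg h = q ->
  bang_comp p q (gcomponent ((g ⊗! h) ∘ mid_elt A D e)%G n' (star_pure n a d)) =
  sgn k (gdeg e * i + gdeg h * (i + x)) *:
    bang_map (fun u : B x => gcomponent g p (star_pure (i + x) a u))
             (fun v : C y => gcomponent h q (star_pure (y + j) v d))
             (bang_comp x y (gcomponent e (x + y) (gone k))).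
Proof.
move=> hg hh he ij pq exy ixp yjq.
have hr : ghom (gdistr B C D ∘ (e ⊗* 1))%G.
  apply: gcomp_ghom; first exact: gdistr_ghom.
  by apply: star_tens_ghom => //; exact: gid_ghom.
rewrite (gcomp_component _ _ _ (j := i + (x + y + j))); last deg.
rewrite (bang_tens_comp _ _ _ (i := i + x) (j := y + j)) //; last deg.
rewrite /mid_elt /mid_out.
rewrite (gcomp_component _ _ _ (j := i + j)); last deg.
rewrite (star_tens_pure _ _ _ (@gid_ghom k A) (@star_lunit_ghom k D) (i' := i) (j' := j)) //=; [|deg|deg].
rewrite mul0r sgn0 scale1r gid_component star_lunit_component.
rewrite (gcomp_component _ _ _ (j := i + (x + y + j))); last deg.
rewrite (star_tens_pure _ _ _ (@gid_ghom k A) hr (i' := i) (j' := x + y + j)) //; [|deg|deg].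
rewrite gid_component (gcomp_component _ _ _ (j := x + y + j)); last deg.
rewrite (star_tens_pure _ _ _ he (@gid_ghom k D) (i' := x + y) (j' := j)) //; [|deg|deg|deg].
rewrite mul0r sgn0 scale1r gid_component.
rewrite (gcomponentZ _ _ _ (@gdistl_ghom k _ _ _)).
rewrite bang_compZ.
rewrite (gdistl_comp _ _ _ _ _ (r := x)) //; last deg.
rewrite (gdistr_comp _ _ _ _ _ (r := y)) //.
have ci V := @clin_id k V.
have c1 := star_pure_clinr B (i + x) x a.
have c2 := star_pure_clinl C (y + j) y d.
have cg := gcomponent_clin (i + x) p hg.
have ch := gcomponent_clin (y + j) q hh.
rewrite bang_mapZ // scalerA -sgnD /= !addr0 addrC.
rewrite bang_map_comp //; last exact: ci.
by rewrite bang_map_comp //; exact: clin_comp cg c1.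
Qed.

Lemma mid_in_pure A B C D X (f : gmap (star B C) X)
    n n' i j p q r (x : bang A B i) (y : bang C D j) :
  ghom f -> i + j = n -> p + q = n' -> p + r = i -> r + j + gdeg f = q ->
  bang_comp p q (gcomponent (mid_in A D f) n' (star_pure n x y)) =
  sgn k (gdeg f * p) *:
    bang_map id (fun z : B r =>
      gcomponent ((f ⊗! 1) ∘ gdistl B C D)%G q (star_pure (r + j) z y)) (bang_comp p r x).
Proof.
move=> hf ij pq pr rq.
have hh : ghom ((f ⊗! 1) ∘ gdistl B C D)%G.
  by apply: gcomp_ghom; [apply: bang_tens_ghom => //; exact: gid_ghom|exact: gdistl_ghom].
rewrite /mid_in (gcomp_component _ _ _ (j := i + j)); last deg.
rewrite (bang_tens_comp _ _ _ (i := p) (j := r + j)) //; [|deg|deg|deg].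
rewrite gid_fun (gdistr_comp _ _ _ _ _ (r := r)) //.
rewrite bang_map_comp; [|exact: clin_id|exact: gcomponent_clin|exact: clin_id|exact: star_pure_clinl].
by rewrite /= addr0 add0r.
Qed.

(** The contraction of the two middle factors is expressed through
    [bang_lunit D ∘ comp_right f v], the composite that the axioms of a
    coFrobenius bialgebra evaluate.  That composite contains [1 ⊗* v], whose
    Koszul sign is compensated by the summand [gdeg v * r]. *)
Lemma mid_form_pure A B C D U V (f : gmap (star B C) (gunit k))
    (u : gmap U (bang A B)) (v : gmap V (bang C D)) n n' i j p q r (a : U i) (b : V j) :
  (forall i, complete (D i)) -> ghom f -> ghom u -> ghom v ->
  i + j = n -> p + q = n' -> i + gdeg u = p + r -> r + j + gdeg v + gdeg f = q ->
  bang_comp p q (gcomponent (mid_form A D f ∘ (u ⊗* v))%G n' (star_pure n a b)) =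
  sgn k (gdeg v * i + gdeg f * p + gdeg v * r) *:
    bang_map id (fun z : B r =>
        gcomponent (bang_lunit D ∘ comp_right f v)%G q (star_pure (r + j) z b))
      (bang_comp p r (gcomponent u (p + r) a)).
Proof.
move=> cD hf hu hv ij pq ipr rq.
have hh : ghom ((f ⊗! 1) ∘ gdistl B C D)%G.
  by apply: gcomp_ghom; [apply: bang_tens_ghom => //; exact: gid_ghom|exact: gdistl_ghom].
have hl := @bang_lunit_ghom k D cD.
rewrite (gcomp_component _ _ _ (j := p + r + (j + gdeg v))); last deg.
rewrite (star_tens_pure _ _ _ hu hv (i' := p + r) (j' := j + gdeg v)) //.
rewrite (gcomponentZ _ _ _ (mid_form_ghom cD hf)).
rewrite bang_compZ.
rewrite /mid_form (gcomp_component _ _ _ (j := p + q)); last deg.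
rewrite (bang_tens_comp _ _ _ (i := p) (j := q)) //; [|deg|deg].
rewrite gid_fun (mid_in_pure (r := r)) //; last deg.
rewrite bang_mapZ; [|exact: clin_id|exact: gcomponent_clin].
rewrite bang_map_comp; [|exact: clin_id|exact: gcomponent_clin|exact: clin_id|]; last first.
  exact: (clin_comp (gcomponent_clin _ q hh) (star_pure_clinl _ _ _ _)).
rewrite !scalerA.
have cc : clin (fun z : B r => gcomponent (bang_lunit D ∘ comp_right f v)%G q (star_pure (r + j) z b)).
  apply: (clin_comp (gcomponent_clin _ _ _)); last exact: star_pure_clinl.
  by apply: gcomp_ghom => //; exact: comp_right_ghom.
have E : (fun z : B r => gcomponent (bang_lunit D) q (gcomponent ((f ⊗! 1) ∘ gdistl B C D)%G q
      (star_pure (r + (j + gdeg v)) z (gcomponent v (j + gdeg v) b)))) =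
    fun z => sgn k (gdeg v * r) *: gcomponent (bang_lunit D ∘ comp_right f v)%G q (star_pure (r + j) z b).
  apply: funext => z; rewrite (gcomp_component (bang_lunit D) _ _ (j := q)); last deg.
  rewrite /comp_right (gcomp_component ((f ⊗! 1) ∘ gdistl B C D)%G _ _ (j := r + (j + gdeg v))); last deg.
  rewrite (star_tens_pure _ _ _ (@gid_ghom k B) hv (i' := r) (j' := j + gdeg v)) //; last deg.
  rewrite gid_component (gcomponentZ _ _ _ hh).
  by rewrite (gcomponentZ _ _ _ hl) scalerA sgnMM scale1r.
rewrite E bang_mapZr //; last exact: clin_id.
by rewrite !scalerA /= mul0r sgn0 mulr1 -!sgnD.
Qed.
End Composites.

(** * Composition and scaling of graded maps *)

Section GmapAlgebra.
Variable k : fieldType.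
Local Open Scope ring_scope.
Implicit Types A B C D X : gspace k.

Lemma eq_sgnZ (V : lmodType k) a b (x : V) :
  parity a = parity b -> sgn k a *: x = sgn k b *: x.
Proof. by move/eq_sgn => ->. Qed.

Lemma gcompA A B C D (h : gmap C D) (g : gmap B C) (f : gmap A B) :
  ((h ∘ g) ∘ f = h ∘ (g ∘ f))%G.
Proof.
apply: eq_gmap => [|i j x e]; first by rewrite /= addrA.
rewrite (gcomp_component _ _ _ (j := i + gdeg f)) //.
rewrite (gcomp_component _ _ _ (j := i + gdeg f + gdeg g)) //.
rewrite (gcomp_component _ _ _ (j := i + gdeg f + gdeg g)) ?addrA //.
by rewrite (gcomp_component _ _ _ (j := i + gdeg f)).
Qed.

Lemma gcomp4A A B C D X (h : gmap D X) (g : gmap C D) (f : gmap B C) (e : gmap A B) :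
  (h ∘ g ∘ f ∘ e = h ∘ (g ∘ f ∘ e))%G.
Proof. by rewrite !gcompA. Qed.

Lemma gcomp1f A B (f : gmap A B) : (1 ∘ f = f)%G.
Proof.
apply: eq_gmap => [|i j x e]; first by rewrite /= addr0.
rewrite /= addr0 in e.
by rewrite (gcomp_component _ _ _ (j := j)) // gid_component.
Qed.

Lemma gcompf1 A B (f : gmap A B) : (f ∘ 1 = f)%G.
Proof.
apply: eq_gmap => [|i j x e]; first by rewrite /= add0r.
by rewrite (gcomp_component _ _ _ (j := i)) ?gid_component //= addr0.
Qed.

Lemma gscale_comp A B C c (g : gmap B C) (f : gmap A B) :
  (gscale c g ∘ f = gscale c (g ∘ f))%G.
Proof. by []. Qed.

Lemma gcomp_scale A B C c (g : gmap B C) (f : gmap A B) : ghom g ->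
  (g ∘ gscale c f = gscale c (g ∘ f))%G.
Proof.
move=> hg; apply: eq_gmap => // i j x e.
rewrite (gcomp_component _ _ _ (j := i + gdeg f)) // !gscale_component.
by rewrite gcomponentZ // (gcomp_component _ _ _ (j := i + gdeg f)).
Qed.

Lemma gscaleA A B c d (f : gmap A B) : gscale c (gscale d f) = gscale (c * d) f.
Proof. by apply: eq_gmap => // i j x e; rewrite !gscale_component scalerA. Qed.

Lemma gscale1 A B (f : gmap A B) : gscale 1 f = f.
Proof. by apply: eq_gmap => // i j x e; rewrite !gscale_component scale1r. Qed.

Lemma gscale_sgnK A B n (f : gmap A B) : gscale (sgn k n) (gscale (sgn k n) f) = f.
Proof. by rewrite gscaleA sgnMM gscale1. Qed.

Lemma eq_gscale_sgn A B a b (f : gmap A B) :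
  parity a = parity b -> gscale (sgn k a) f = gscale (sgn k b) f.
Proof. by move/eq_sgn => ->. Qed.

Lemma eq_ghom_star_bang A B C D (f g : gmap (star A B) (bang C D)) :
  ghom f -> ghom g -> gdeg f = gdeg g ->
  (forall i j p q (a : A i) (b : B j), p + q = i + j + gdeg f ->
     bang_comp p q (gcomponent f (p + q) (star_pure (i + j) a b)) =
     bang_comp p q (gcomponent g (p + q) (star_pure (i + j) a b))) -> f = g.
Proof.
move=> hf hg dfg h; apply: eq_ghom_star => // i j n a b e.
by apply: bang_ext => p q pq; rewrite -{n}pq in e *; exact: h.
Qed.

End GmapAlgebra.

(** * Contraction with the unit *)

Section MoreGhom.
Variable k : fieldType.
Local Open Scope ring_scope.
Implicit Types A B C D X : gspace k.

Lemma bang3l_ghom A B C : ghom (bang3l A B C).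
Proof.
move=> n n' e; apply: (@dprod_clin k _ (fun s : idx3 n' =>
  cbang (A (idx3_1 s)) (cbang (B (idx3_2 s)) (C (idx3_3 s))))) => t.
exact: (clin_comp (bang_assoc_clin _ _ _) (clin_comp (bang_map_clin
  (bang_at_clin A B (erefl (idx3_1 t + idx3_2 t))) (@clin_id k _))
  (bang_at_clin (bang A B) C (idx3l_deg' t e)))).
Qed.

Lemma bang3r_ghom A B C : ghom (bang3r A B C).
Proof.
move=> n n' e; apply: (@dprod_clin k _ (fun s : idx3 n' =>
  cbang (A (idx3_1 s)) (cbang (B (idx3_2 s)) (C (idx3_3 s))))) => t.
exact: (clin_comp (bang_map_clin (@clin_id k _)
  (bang_at_clin B C (erefl (idx3_2 t + idx3_3 t))))
  (bang_at_clin A (bang B C) (idx3r_deg' t e))).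
Qed.

Lemma unit_actC (x : cbang (gunit k 0) (gunit k 0)) : unit_act x = act_unit x.
Proof.
have cg := @gunit_complete k 0.
apply: (eq_clin_cbang (f := @unit_act k (gunit k 0)) (g := @act_unit k (gunit k 0))) x.
- exact: unit_act_clin.
- exact: act_unit_clin.
- by move=> a b; rewrite unit_actE // act_unitE //; apply: submod_inj; exact: mulrC.
Qed.

Lemma lunit_comp_right A B C D (f : gmap (star A B) (gunit k)) (v : gmap D (bang B C))
    n q i j r (a : A i) (d : D j) :
  ghom f -> ghom v -> i + j = n -> i + r + gdeg f = 0 -> j + gdeg v = r + q ->
  complete (C q) ->
  gcomponent (bang_lunit C ∘ comp_right f v)%G q (star_pure n a d) =
  sgn k (gdeg v * i) *: unit_act (bang_map
    (fun x : B r => gcomponent f 0 (star_pure (i + r) a x)) id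
    (bang_comp r q (gcomponent v (r + q) d))).
Proof.
move=> hf hv ij ir jr cC.
rewrite (gcomp_component _ _ _ (j := q)); last deg.
rewrite bang_lunit_component (comp_right_pure _ _ (r := r)) //; last deg.
by rewrite (is_linearZ _ (unit_act_clin cC).1).
Qed.

Lemma runit_comp_left A B C D (g : gmap (star C D) (gunit k)) (f : gmap A (bang B C))
    n p i j r (a : A i) (d : D j) :
  ghom g -> ghom f -> i + j = n -> r + j + gdeg g = 0 -> i + gdeg f = p + r ->
  complete (B p) ->
  gcomponent (bang_runit B ∘ comp_left g f)%G p (star_pure n a d) =
  sgn k (gdeg g * p) *: act_unit (bang_map id
    (fun x : C r => gcomponent g 0 (star_pure (r + j) x d))
    (bang_comp p r (gcomponent f (p + r) a))).
Proof.
move=> hg hf ij rj ip cB.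
rewrite (gcomp_component _ _ _ (j := p)); last deg.
rewrite bang_runit_component (comp_left_pure _ _ (r := r)) //; last deg.
by rewrite (is_linearZ _ (act_unit_clin cB).1).
Qed.

End MoreGhom.

(** * CoFrobenius bialgebras *)

Ltac ghom_step := match goal with
  | H : ghom ?f |- ghom ?f => exact: H
  | |- forall _, complete _ => assumption
  | |- ghom (gid _) => exact: gid_ghom
  | |- ghom (star_tau _ _) => exact: star_tau_ghom
  | |- ghom (bang_tau _ _) => exact: bang_tau_ghom
  | |- ghom (star_lunit _) => exact: star_lunit_ghom
  | |- ghom (star_runit _) => exact: star_runit_ghom
  | |- ghom (bang_lunit _) => apply: bang_lunit_ghom
  | |- ghom (bang_runit _) => apply: bang_runit_ghom
  | |- ghom (gdistl _ _ _) => exact: gdistl_ghom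
  | |- ghom (gdistr _ _ _) => exact: gdistr_ghom
  | |- ghom (bang3l _ _ _) => exact: bang3l_ghom
  | |- ghom (bang3r _ _ _) => exact: bang3r_ghom
  | |- ghom (gscale _ _) => apply: gscale_ghom
  | |- ghom (gadd _ _) => apply: gadd_ghom
  | |- ghom (comp_left _ _) => apply: comp_left_ghom
  | |- ghom (comp_right _ _) => apply: comp_right_ghom
  | |- ghom (mid_elt _ _ _) => apply: mid_elt_ghom
  | |- ghom (mid_form _ _ _) => apply: mid_form_ghom
  | |- ghom (mid_in _ _ _) => apply: mid_in_ghom
  | |- ghom (mid_out _ _ _) => apply: mid_out_ghom
  | |- ghom (star_tens _ _) => apply: star_tens_ghom
  | |- ghom (bang_tens _ _) => apply: bang_tens_ghom
  | |- ghom (gcomp _ _) => apply: gcomp_ghom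
  end.
Ltac ghom_done := repeat ghom_step.

Ltac parity_done := rewrite !parityE;
  repeat match goal with |- context [parity ?x] => case: (parity x) end; done.
Ltac sgn_done := apply: eq_sgnZ; parity_done.

Section CoFrobenius.
Variables (k : fieldType) (A : gspace k).
Local Open Scope ring_scope.
Variables (mu : gmap (star A A) A) (lam : gmap A (bang A A)).
Variables (eta : gmap (gunit k) A) (eps : gmap A (gunit k)).
Hypothesis H : biunital_coFrobenius_bialgebra mu lam eta eps.

Local Notation m := (gdeg mu).
Local Notation l := (gdeg lam).
Local Notation c := (copairing mu lam eta).
Local Notation p := (pairing mu lam eps).

Let tA : gtate A. Proof. by case: (coFrobenius_structure H). Qed.
Let cA i : complete (A i). Proof. by case: (tA i). Qed.
Let hmu : ghom mu. Proof. by case: (coFrobenius_structure H) => _ []. Qed.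
Let hlam : ghom lam. Proof. by case: (coFrobenius_structure H) => _ _ _ []. Qed.
Let heta : ghom eta. Proof. by case: (coFrobenius_structure H) => _ _ []. Qed.
Let heps : ghom eps. Proof. by case: (coFrobenius_structure H) => _ _ _ _ []. Qed.
Let hc : ghom c. Proof. by apply: gscale_ghom; exact: gcomp_ghom. Qed.
Let hp : ghom p. Proof. by apply: gscale_ghom; exact: gcomp_ghom. Qed.

Let deg_eta : gdeg eta = - m.
Proof.
have [_ _ [_ /(f_equal (@gdeg k A A)) e _] _ _] := coFrobenius_structure H.
by rewrite /= in e; lia.
Qed.

Let deg_eps : gdeg eps = - l.
Proof.
have [_ _ _ _ [_ /(f_equal (@gdeg k A A)) e _]] := coFrobenius_structure H.
by rewrite /= in e; lia.
Qed.

Let deg_c : gdeg c = l - m. Proof. by rewrite /= deg_eta addrC. Qed.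
Let deg_lam_eta x y : x + y = l - m -> gdeg (lam ∘ eta)%G = x + y.
Proof. by move=> ->; rewrite -deg_c. Qed.
Let deg_p : gdeg p = m - l. Proof. by rewrite /= deg_eps. Qed.

(** The letters [a], [b] stand for elements of degrees [i], [j], and [c' ! c'']
    for the copairing, of degree [l - m]; [copairing_at x y] collects the terms
    with [c'] of degree [x] and [c''] of degree [y]. *)
Definition gmul i j q (a : A i) (b : A j) : A q := gcomponent mu q (star_pure (i + j) a b).

Definition copairing_at x y : cbang (A x) (A y) := bang_comp x y (gcomponent c (l - m) (gone k)).

Let mulr_clin i j q (a : A i) : clin (fun b : A j => gmul q a b).
Proof. exact: (clin_comp (gcomponent_clin _ _ hmu) (star_pure_clinr _ _ _ _)). Qed.

Let mull_clin i j q (b : A j) : clin (fun a : A i => gmul q a b).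
Proof. exact: (clin_comp (gcomponent_clin _ _ hmu) (star_pure_clinl _ _ _ _)). Qed.

Let id_clin i : clin (@id (A i)) := @clin_id k (A i).

Lemma comp_right_gmul D (f : gmap D (bang A A)) n n' i j q r x (a : A i) (d : D j) :
  ghom f -> i + j = n -> r + q = n' -> j + gdeg f = x + q -> i + x + m = r ->
  bang_comp r q (gcomponent (comp_right mu f) n' (star_pure n a d)) =
  sgn k (gdeg f * i) *: bang_map (fun u : A x => gmul r a u) id
                          (bang_comp x q (gcomponent f (x + q) d)).
Proof. exact: comp_right_pure. Qed.

Lemma comp_left_gmul D (f : gmap D (bang A A)) n n' i j q r y (d : D i) (b : A j) :
  ghom f -> i + j = n -> r + q = n' -> i + gdeg f = r + y -> y + j + m = q ->
  bang_comp r q (gcomponent (comp_left mu f) n' (star_pure n d b)) =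
  sgn k (m * r) *: bang_map id (fun v : A y => gmul q v b)
                     (bang_comp r y (gcomponent f (r + y) d)).
Proof. exact: comp_left_pure. Qed.

(** On elements, the first axiom reads [lam a = ± c' ! c''a]. *)
Lemma lam_l i n q r y (a : A i) : r + y = l - m -> y + i + m = q -> r + q = n ->
  bang_comp r q (gcomponent lam n a) =
  sgn k (m * r) *: bang_map id (fun v : A y => gmul q v a) (copairing_at r y).
Proof.
move=> ry yi rq.
have -> : gcomponent lam n a = gcomponent (comp_left mu c ∘ star_lunit A)%G n a.
  by rewrite -(coFrobenius_lam_l H).
rewrite (gcomp_component _ _ _ (j := i)); last deg.
rewrite star_lunit_component (comp_left_pure _ _ (r := y)) //; [|deg|by rewrite deg_c; lia].
by rewrite ry.
Qed.

(** On elements, the second axiom reads [lam a = ± ac' ! c'']. *)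
Lemma lam_r i n q r x (a : A i) : x + q = l - m -> i + x + m = r -> r + q = n ->
  bang_comp r q (gcomponent lam n a) =
  sgn k (m + (l - m) * i) *: bang_map (fun u : A x => gmul r a u) id (copairing_at x q).
Proof.
move=> xq ix rq.
have -> : gcomponent lam n a =
    gcomponent (gscale (sgn k m) (comp_right mu c ∘ star_runit A))%G n a.
  by rewrite -(coFrobenius_lam_r H).
rewrite gscale_component bang_compZ (gcomp_component _ _ _ (j := i)); last deg.
rewrite star_runit_component (comp_right_pure _ _ (r := x)) //; [|deg|by rewrite deg_c; lia].
by rewrite scalerA -sgnD deg_c xq.
Qed.

Lemma copairing_at_swap x y : x + y = l - m ->
  bang_swap (copairing_at x y) = sgn k (l + x * y) *: copairing_at y x.
Proof.
move=> xy; have yx : y + x = l - m by rewrite addrC.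
have := f_equal (fun f => bang_comp y x (gcomponent f (l - m) (gone k))) (coFrobenius_copairing H).
rewrite /= gscale_component bang_compZ (gcomp_component _ _ _ (j := l - m)); last by rewrite deg_c; lia.
rewrite bang_tau_comp // -/(copairing_at x y) -/(copairing_at y x) => e.
have -> : bang_swap (copairing_at x y) = sgn k (y * x) *: (sgn k (y * x) *: bang_swap (copairing_at x y)).
  by rewrite scalerA sgnMM scale1r.
rewrite e scalerA -sgnD; sgn_done.
Qed.

Lemma gmul_assoc i j h r s q (a : A i) (b : A j) (d : A h) :
  i + j + m = r -> j + h + m = s ->
  gmul q (gmul r a b) d = sgn k (m + m * i) *: gmul q a (gmul s b d).
Proof.
move=> ij jh; have [_ [_ assoc] _ _ _] := coFrobenius_structure H.
have := f_equal (fun f => gcomponent f q (star3_pure a b d)) assoc.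
rewrite /= gscale_component.
rewrite (gcomp_component _ _ _ (j := i + j + h)); last deg.
rewrite (gcomp_component _ _ _ (j := r + h)); last deg.
rewrite star3l_pure // (star_tens_pure _ _ _ hmu (@gid_ghom k A) (i' := r) (j' := h)) //; last deg.
rewrite (gcomp_component _ _ _ (j := i + j + h)); last deg.
rewrite (gcomp_component _ _ _ (j := i + s)); last deg.
rewrite star3r_pure // (star_tens_pure _ _ _ (@gid_ghom k A) hmu (i' := i) (j' := s)) //; [|deg|deg].
by rewrite !gid_component mul0r sgn0 scale1r gcomponentZ // scalerA -sgnD.
Qed.

Local Notation muop := (mu ∘ star_tau A A)%G.
Local Notation lamop := (bang_tau A A ∘ lam)%G.

Let hmuop : ghom muop. Proof. by apply: gcomp_ghom => //; exact: star_tau_ghom. Qed.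
Let hlamop : ghom lamop. Proof. by apply: gcomp_ghom => //; exact: bang_tau_ghom. Qed.

Lemma muopE i j n q (a : A i) (b : A j) : i + j = n ->
  gcomponent muop q (star_pure n a b) = sgn k (i * j) *: gmul q b a.
Proof.
move=> ij; rewrite (gcomp_component _ _ _ (j := j + i)); last deg.
by rewrite star_tau_pure // gcomponentZ.
Qed.


Let swapZ i j d (x : cbang (A i) (A j)) : bang_swap (d *: x) = d *: bang_swap x.
Proof. exact: is_linearZ (@bang_swap_clin k _ _).1 _. Qed.

(** [tau (lam a) = ± c'a ! c''], by the symmetry of the copairing. *)
Lemma lamop_l i n s y r (a : A i) : y + s = l - m -> y + i + m = r -> r + s = n ->
  bang_comp r s (gcomponent lamop n a) =
  sgn k (i * s + l) *: bang_map (fun u : A y => gmul r u a) id (copairing_at y s).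
Proof.
move=> ys yi rs; have sy : s + y = l - m by rewrite addrC.
rewrite (gcomp_component _ _ _ (j := n)); last lia.
rewrite bang_tau_comp //; last lia.
rewrite (lam_l _ sy yi); last lia.
rewrite swapZ bang_map_swap // copairing_at_swap // bang_mapZ // !scalerA -!sgnD.
apply: eq_sgnZ; rewrite -yi; parity_done.
Qed.

(** [tau (lam a) = ± c' ! ac''], from the other expression of [lam a]. *)
Lemma lamop_r i n q x y (a : A i) : y + x = l - m -> i + x + m = q -> y + q = n ->
  bang_comp y q (gcomponent lamop n a) =
  sgn k (m + (l - m) * i + i * y + m * y + l) *:
    bang_map id (fun v : A x => gmul q a v) (copairing_at y x).
Proof.
move=> yx ix yq; have xy : x + y = l - m by rewrite addrC.
rewrite (gcomp_component _ _ _ (j := n)); last lia.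
rewrite bang_tau_comp //; last lia.
rewrite (lam_r _ xy ix); last lia.
rewrite swapZ bang_map_swap // copairing_at_swap // bang_mapZ // !scalerA -!sgnD.
apply: eq_sgnZ; rewrite -ix; parity_done.
Qed.

Definition pairing_at i j (a : A i) (b : A j) : gunit k 0 := gcomponent p 0 (star_pure (i + j) a b).

Let pairing_atr_clin i j (a : A i) : clin (fun b : A j => pairing_at a b).
Proof. exact: (clin_comp (gcomponent_clin _ _ hp) (star_pure_clinr _ _ _ _)). Qed.

Let pairing_atl_clin i j (b : A j) : clin (fun a : A i => pairing_at a b).
Proof. exact: (clin_comp (gcomponent_clin _ _ hp) (star_pure_clinl _ _ _ _)). Qed.

Lemma pairing_atC i j (a : A i) (b : A j) : pairing_at a b = sgn k (m + i * j) *: pairing_at b a.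
Proof.
have := f_equal (fun f => gcomponent f 0 (star_pure (i + j) a b)) (coFrobenius_pairing H).
rewrite /= gscale_component (gcomp_component _ _ _ (j := j + i)); last deg.
rewrite star_tau_pure // gcomponentZ // -!/(pairing_at _ _) => e.
have -> : pairing_at a b = sgn k m *: (sgn k m *: pairing_at a b) by rewrite scalerA sgnMM scale1r.
by rewrite -e scalerA -sgnD.
Qed.

(** The axiom that recovers [mu] as [(p ⊗ 1)(1 ⊗ lam)], on elements. *)
Lemma unit_act_lam i j t q (a : A i) (b : A j) : i + t + m = l -> t + q = j + l ->
  unit_act (bang_map (fun x : A t => pairing_at a x) id (bang_comp t q (gcomponent lam (t + q) b))) =
  sgn k (m * l + l + l * i) *: gmul q a b.
Proof.
move=> it tq.
have e : gmul q a b = sgn k (m * l + l) *: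
    gcomponent (bang_lunit A ∘ comp_right p lam)%G q (star_pure (i + j) a b).
  by rewrite -gscale_component -(coFrobenius_mu_l H).
rewrite e (lunit_comp_right _ _ _ (r := t)) //; last by rewrite deg_p; lia.
rewrite !scalerA -!sgnD -[LHS]scale1r -[1](sgn0 k); sgn_done.
Qed.

Lemma act_unit_lam i j s t (a : A i) (b : A j) : t + j + m = l -> s + t = i + l ->
  act_unit (bang_map id (fun x : A t => pairing_at x b) (bang_comp s t (gcomponent lam (s + t) a))) =
  sgn k (m * l + (m - l) * s) *: gmul s a b.
Proof.
move=> tj st.
have e : gmul s a b = sgn k (m * l) *:
    gcomponent (bang_runit A ∘ comp_left p lam)%G s (star_pure (i + j) a b).
  by rewrite -gscale_component -(coFrobenius_mu_r H).
rewrite e (runit_comp_left _ _ _ (r := t)) //; last by rewrite deg_p; lia.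
rewrite deg_p !scalerA -!sgnD -[LHS]scale1r -[1](sgn0 k); sgn_done.
Qed.

(** By the symmetry of the pairing, contracting [a] with the second factor of
    [lam b] is contracting that factor with [a], which gives [ba]. *)
Lemma unit_act_lamop i j t q (a : A i) (b : A j) : i + t + m = l -> t + q = j + l ->
  unit_act (bang_map (fun x : A t => pairing_at a x) id (bang_comp t q (gcomponent lamop (t + q) b))) =
  sgn k (t * q + m + i * t + m * l + (m - l) * q) *: gmul q b a.
Proof.
move=> it tq.
rewrite (gcomp_component _ _ _ (j := q + t)); last lia.
rewrite bang_tau_comp //; last lia.
rewrite bang_mapZ // (is_linearZ _ (unit_act_clin (cA q)).1) -bang_map_swap // unit_act_swap //.
have -> : (fun x : A t => pairing_at a x) = fun x => sgn k (m + i * t) *: pairing_at x a.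
  by apply: funext => x; exact: pairing_atC.
rewrite bang_mapZr // (is_linearZ _ (act_unit_clin (cA q)).1) act_unit_lam; [|by lia|by lia].
rewrite !scalerA -!sgnD; sgn_done.
Qed.

Section Form.
Variables (f : gmap (star A A) (gunit k)) (z : k).
Hypotheses (hf : ghom f) (df : gdeg f = m - l).
Hypothesis fE : forall n (t : star A A n), gcomponent f 0 t = z *: gcomponent p 0 t.

Let f_pairing_at i j (a : A i) :
  (fun b : A j => gcomponent f 0 (star_pure (i + j) a b)) = fun b => z *: pairing_at a b.
Proof. by apply: funext => b; rewrite fE. Qed.

(** Stated for a multiple [f] of the pairing so as to apply both to [p] and to
    [eps ∘ mu]. *)
Lemma form_lam D (u : gmap D (bang A A)) n n' i j r q w (d : D i) (b : A j) :
  ghom u -> i + j = n -> r + q = n' -> i + gdeg u = r + w -> w + j + m = q ->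
  bang_comp r q (gcomponent (mid_form A A f ∘ (u ⊗* lam))%G n' (star_pure n d b)) =
  (z * sgn k (l * i + (m - l) * r + l * w + m * l + l)) *:
    bang_map id (fun v : A w => gmul q v b) (bang_comp r w (gcomponent u (r + w) d)).
Proof.
move=> hu ij rq ir wj.
rewrite (mid_form_pure (r := w)) //; last by rewrite df; lia.
have -> : (fun v : A w => gcomponent (bang_lunit A ∘ comp_right f lam)%G q (star_pure (w + j) v b)) =
    fun v => (z * sgn k (m * l + l)) *: gmul q v b.
  apply: funext => v; rewrite (lunit_comp_right _ _ _ (r := l - m - w)) //; [|by rewrite df; lia|by lia].
  rewrite f_pairing_at bang_mapZl // (is_linearZ _ (unit_act_clin (cA q)).1).
  rewrite unit_act_lam; [|by lia|by lia]; rewrite !scalerA -mulrA mulrCA -sgnD.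
  by congr ((_ * _) *: _); apply: eq_sgn; parity_done.
rewrite bang_mapZr // df scalerA mulrCA -sgnD.
by congr ((_ * _) *: _); apply: eq_sgn; parity_done.
Qed.

Lemma form_lamop D (u : gmap D (bang A A)) n n' i j r q w (d : D i) (b : A j) :
  ghom u -> i + j = n -> r + q = n' -> i + gdeg u = r + w -> w + j + m = q ->
  bang_comp r q (gcomponent (mid_form A A f ∘ (u ⊗* lamop))%G n' (star_pure n d b)) =
  (z * sgn k (l * i + (m - l) * r + w * j + l * w + m + m * l)) *:
    bang_map id (fun v : A w => gmul q b v) (bang_comp r w (gcomponent u (r + w) d)).
Proof.
move=> hu ij rq ir wj.
rewrite (mid_form_pure (r := w)) //; last by rewrite df /=; lia.
have -> : (fun v : A w => gcomponent (bang_lunit A ∘ comp_right f lamop)%G q (star_pure (w + j) v b)) =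
    fun v => (z * sgn k (w * j + m + m * l)) *: gmul q b v.
  apply: funext => v; rewrite (lunit_comp_right _ _ _ (r := l - m - w)) //; [|by rewrite df; lia|by rewrite /=; lia].
  rewrite f_pairing_at bang_mapZl // (is_linearZ _ (unit_act_clin (cA q)).1).
  rewrite unit_act_lamop; [|by lia|by lia]; rewrite !scalerA -mulrA mulrCA -sgnD.
  congr ((_ * _) *: _); apply: eq_sgn; rewrite /= -wj; parity_done.
rewrite bang_mapZr // df scalerA mulrCA -sgnD.
by congr ((_ * _) *: _); apply: eq_sgn; rewrite /=; parity_done.
Qed.

End Form.

Lemma lam_eta x y : x + y = l - m ->
  bang_comp x y (gcomponent (lam ∘ eta)%G (x + y) (gone k)) = sgn k (l * m + m) *: copairing_at x y.
Proof.
move=> xy; rewrite /copairing_at gscale_component bang_compZ scalerA sgnMM scale1r.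
by rewrite xy.
Qed.

Section TwoElements.
Variables (i j : int) (a : A i) (b : A j).

Section Lr.
Variables (r q x y : int).
Hypotheses (xy : x + y = l - m) (ix : i + x + m = r) (yj : y + j + m = q).

(** [ac' ! c''b] *)
Definition copairing_lr : cbang (A r) (A q) :=
  bang_map (fun u : A x => gmul r a u) (fun v : A y => gmul q v b) (copairing_at x y).

Lemma comp_right_lr :
  bang_comp r q (gcomponent (comp_right mu lam) (r + q) (star_pure (i + j) a b)) =
  sgn k (l * i + m * x) *: copairing_lr.
Proof.
rewrite (comp_right_gmul (x := x)) //; last lia.
by rewrite (lam_l _ xy yj) // bang_mapZ // bang_map_comp // scalerA -sgnD.
Qed.

Lemma comp_left_lr :
  bang_comp r q (gcomponent (comp_left mu lam) (r + q) (star_pure (i + j) a b)) =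
  sgn k (l * i + m * x) *: copairing_lr.
Proof.
rewrite (comp_left_gmul (y := y)) //; last lia.
rewrite (lam_r _ xy ix) // bang_mapZ // bang_map_comp // scalerA -sgnD.
apply: eq_sgnZ; rewrite -ix; parity_done.
Qed.

Lemma mid_elt_lr :
  bang_comp r q (gcomponent ((mu ⊗! mu) ∘ mid_elt A A c)%G (r + q) (star_pure (i + j) a b)) =
  sgn k (l * i + m * x) *: copairing_lr.
Proof.
rewrite (mid_elt_pure _ _ (x := x) (y := y)) //; last by rewrite deg_c.
rewrite deg_c xy -/(copairing_at x y) -/copairing_lr; sgn_done.
Qed.

Lemma mid_elt_lam_eta_lr :
  bang_comp r q (gcomponent ((mu ⊗! mu) ∘ mid_elt A A (lam ∘ eta))%G (r + q) (star_pure (i + j) a b)) =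
  sgn k (l * m + m + l * i + m * x) *: copairing_lr.
Proof.
rewrite (mid_elt_pure _ _ (x := x) (y := y)) //; [|exact: gcomp_ghom|exact: deg_lam_eta].
rewrite -[fun u => gcomponent mu r _]/(fun u : A x => gmul r a u).
rewrite -[fun v => gcomponent mu q _]/(fun v : A y => gmul q v b).
rewrite lam_eta // bang_mapZ // scalerA -sgnD; apply: eq_sgnZ; rewrite /= deg_eta; parity_done.
Qed.

(** [lam (ab)] is [c' ! c''(ab)], and [c''(ab) = ± (c''a)b] turns this into
    [a' ! a''b]. *)
Lemma lam_mu_lr :
  bang_comp r q (gcomponent (lam ∘ mu)%G (r + q) (star_pure (i + j) a b)) =
  sgn k (l * m + l * i + m * x) *: copairing_lr.
Proof.
have e1 : r + (y - i - m) = l - m by lia.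
have -> : sgn k (l * m + l * i + m * x) *: copairing_lr =
    sgn k (l * m) *: (sgn k (l * i + m * x) *: copairing_lr) by rewrite scalerA -sgnD addrA.
rewrite -comp_left_lr (comp_left_gmul (y := y)) //; last lia.
rewrite (lam_l _ e1) //; last lia.
rewrite (gcomp_component _ _ _ (j := i + j + m)) //.
rewrite (lam_l _ e1 (q := q)) //; last lia.
rewrite bang_mapZ // bang_map_comp // !scalerA -!sgnD.
have -> : (fun v : A (y - i - m) => gmul q (gmul y v a) b) =
    fun v => sgn k (m + m * (y - i - m)) *: gmul q v (gmul (i + j + m) a b).
  by apply: funext => v; apply: gmul_assoc; lia.
rewrite bang_mapZr // scalerA -sgnD; apply: eq_sgnZ.
have -> : r = l - m - (y - i - m) by lia.
parity_done.
Qed.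

Lemma mid_form_lr f z : ghom f -> gdeg f = m - l ->
  (forall n (t : star A A n), gcomponent f 0 t = z *: gcomponent p 0 t) ->
  bang_comp r q (gcomponent (mid_form A A f ∘ (lam ⊗* lam))%G (r + q) (star_pure (i + j) a b)) =
  (z * sgn k (l * m + l * i + m * x)) *: copairing_lr.
Proof.
move=> hf df fE; rewrite (form_lam hf df fE (w := y)) //; last lia.
rewrite (lam_r _ xy ix) // bang_mapZ // bang_map_comp // scalerA -mulrA -sgnD.
by congr ((_ * _) *: _); apply: eq_sgn; rewrite -ix (_ : y = l - m - x); [parity_done|lia].
Qed.
End Lr.

Section Rr.
Variables (r q x y : int).
Hypotheses (xy : x + y = l - m) (xi : x + i + m = r) (yj : y + j + m = q).

(** [c'a ! c''b] *)
Definition copairing_rr : cbang (A r) (A q) :=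
  bang_map (fun u : A x => gmul r u a) (fun v : A y => gmul q v b) (copairing_at x y).

Lemma comp_left_lamop_rr :
  bang_comp r q (gcomponent (comp_left mu lamop) (r + q) (star_pure (i + j) a b)) =
  sgn k (m * r + i * y + l) *: copairing_rr.
Proof.
rewrite (comp_left_gmul (y := y)) //; [|by rewrite /=; lia..].
rewrite (lamop_l _ xy xi) // bang_mapZ // bang_map_comp // scalerA -sgnD.
sgn_done.
Qed.

Lemma comp_right_muop_rr :
  bang_comp r q (gcomponent (comp_right muop lam) (r + q) (star_pure (i + j) a b)) =
  sgn k (l * i + i * x + m * x) *: copairing_rr.
Proof.
rewrite (comp_right_pure _ _ (r := x)) //; [|by rewrite /=; lia..].
have -> : (fun u : A x => gcomponent muop r (star_pure (i + x) a u)) =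
    fun u => sgn k (i * x) *: gmul r u a by apply: funext => u; rewrite muopE.
rewrite bang_mapZl // (lam_l _ xy yj) // bang_mapZ // bang_map_comp // !scalerA -!sgnD.
sgn_done.
Qed.

Lemma mid_elt_muop_rr :
  bang_comp r q (gcomponent ((muop ⊗! mu) ∘ mid_elt A A (lam ∘ eta))%G (r + q) (star_pure (i + j) a b)) =
  sgn k ((l - m) * i + m * (i + x) + i * x + l * m + m) *: copairing_rr.
Proof.
rewrite (mid_elt_pure _ _ (x := x) (y := y)) //; [|exact: gcomp_ghom|exact: deg_lam_eta|by rewrite /=; lia].
have -> : (fun u : A x => gcomponent muop r (star_pure (i + x) a u)) =
    fun u => sgn k (i * x) *: gmul r u a by apply: funext => u; rewrite muopE.
rewrite -[fun v => gcomponent mu q _]/(fun v : A y => gmul q v b).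
rewrite bang_mapZl // lam_eta // bang_mapZ // /= deg_eta !scalerA -!sgnD -/copairing_rr.
sgn_done.
Qed.

Lemma mid_form_lamop_rr f z : ghom f -> gdeg f = m - l ->
  (forall n (t : star A A n), gcomponent f 0 t = z *: gcomponent p 0 t) ->
  bang_comp r q (gcomponent (mid_form A A f ∘ (lamop ⊗* lam))%G (r + q) (star_pure (i + j) a b)) =
  (z * sgn k (l * i + (m - l) * r + l * y + m * l + i * y)) *: copairing_rr.
Proof.
move=> hf df fE; rewrite (form_lam hf df fE (w := y)) //; [|by rewrite /=; lia..].
rewrite (lamop_l _ xy xi) // bang_mapZ // bang_map_comp // scalerA -mulrA -sgnD.
by congr ((_ * _) *: _); apply: eq_sgn; parity_done.
Qed.
End Rr.

Section LlSwap.
Variables (r q x y : int).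
Hypotheses (yx : y + x = l - m) (jy : j + y + m = r) (ix : i + x + m = q).

(** [bc' ! ac''] *)
Definition copairing_ll_swap : cbang (A r) (A q) :=
  bang_map (fun u : A y => gmul r b u) (fun v : A x => gmul q a v) (copairing_at y x).

Let xy : x + y = l - m. Proof. by lia. Qed.

Let swap_ll :
  bang_swap (bang_map (fun v : A x => gmul q a v) (fun u : A y => gmul r b u) (copairing_at x y)) =
  sgn k (l + x * y) *: copairing_ll_swap.
Proof. by rewrite bang_map_swap // copairing_at_swap // bang_mapZ. Qed.

Lemma tau_comp_left_muop :
  bang_comp r q (gcomponent (bang_tau A A ∘ comp_left muop lam)%G (r + q) (star_pure (i + j) a b)) =
  sgn k (r * q + m * q + y * j + m + (l - m) * i + l + x * y) *: copairing_ll_swap.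
Proof.
rewrite (gcomp_component _ _ _ (j := q + r)); last by rewrite /=; lia.
rewrite bang_tau_comp //; last lia.
rewrite (comp_left_pure _ _ (r := y)) //; [|by rewrite /=; lia..].
have -> : (fun v : A y => gcomponent muop r (star_pure (y + j) v b)) =
    fun v => sgn k (y * j) *: gmul r b v by apply: funext => v; rewrite muopE.
rewrite bang_mapZr // (lam_r _ xy ix) // bang_mapZ // bang_map_comp // !swapZ.
rewrite swap_ll !scalerA -!sgnD; apply: eq_sgnZ; rewrite /=; parity_done.
Qed.

Lemma tau_comp_right_lamop :
  bang_comp r q (gcomponent (bang_tau A A ∘ comp_right mu lamop)%G (r + q) (star_pure (i + j) a b)) =
  sgn k (r * q + l * i + m + (l - m) * j + j * x + m * x + x * y) *: copairing_ll_swap.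
Proof.
rewrite (gcomp_component _ _ _ (j := q + r)); last by rewrite /=; lia.
rewrite bang_tau_comp //; last lia.
rewrite (comp_right_gmul (x := x)) //; [|by rewrite /=; lia..].
rewrite (lamop_r _ xy jy) // bang_mapZ // bang_map_comp // !swapZ.
rewrite swap_ll !scalerA -!sgnD; apply: eq_sgnZ; rewrite /=; parity_done.
Qed.

Lemma tau_mid_elt_muop :
  bang_comp r q (gcomponent (bang_tau A A ∘ (mu ⊗! muop) ∘ mid_elt A A (lam ∘ eta))%G
    (r + q) (star_pure (i + j) a b)) =
  sgn k (r * q + (l - m) * i + m * (i + x) + y * j + l * m + m + l + x * y) *: copairing_ll_swap.
Proof.
rewrite gcompA (gcomp_component _ _ _ (j := q + r)); last by rewrite /=; lia.
rewrite bang_tau_comp //; last lia.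
rewrite (mid_elt_pure _ _ (x := x) (y := y)) //; [|exact: gcomp_ghom|exact: deg_lam_eta|by rewrite /=; lia].
have -> : (fun v : A y => gcomponent muop r (star_pure (y + j) v b)) =
    fun v => sgn k (y * j) *: gmul r b v by apply: funext => v; rewrite muopE.
rewrite -[fun u => gcomponent mu _ _]/(fun u : A x => gmul _ a u).
rewrite bang_mapZr // lam_eta // bang_mapZ // !swapZ.
rewrite swap_ll !scalerA -!sgnD; apply: eq_sgnZ; rewrite /= deg_eta; parity_done.
Qed.
End LlSwap.

(** The two expressions of [tau (lam a)] give [c'a ! c'' = ± c' ! ac''], hence
    [c'a ! c''b = ± c' ! (ac'')b = ± c' ! a(c''b)].  The two expressions of
    [lam b] then give [c' ! c''b = ± bc' ! c'']. *)
Lemma copairing_rrE r q x y x' y' : x + y = l - m -> x + i + m = r -> y + j + m = q ->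
  y' + x' = l - m -> j + y' + m = r -> i + x' + m = q ->
  copairing_rr r q x y =
  sgn k (i * y + (l - m) * i + i * r + m * i + m + (l - m) * j) *: copairing_ll_swap r q x' y'.
Proof.
move=> xy xi yj yx' jy' ix'.
(* [y - i - m] is the degree of [c''] in [c' ! ac'']. *)
have e1 : r + (y - i - m) = l - m by lia.
have e2 : i + (y - i - m) + m = y by lia.
have e3 : y - i - m + j + m = x' by lia.
have e : bang_map (fun u : A x => gmul r u a) id (copairing_at x y) =
    sgn k (i * y + l) *: (sgn k (m + (l - m) * i + i * r + m * r + l) *:
    bang_map id (fun v : A (y - i - m) => gmul y a v) (copairing_at r (y - i - m))).
  rewrite -(lamop_r a e1 e2 (erefl (r + y))) (lamop_l a xy xi (erefl (r + y))).
  by rewrite scalerA sgnMM scale1r.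
have -> : copairing_rr r q x y = bang_map id (fun v : A y => gmul q v b)
    (bang_map (fun u : A x => gmul r u a) id (copairing_at x y)) by rewrite bang_map_comp.
rewrite e !bang_mapZ // bang_map_comp //.
have -> : (fun v : A (y - i - m) => gmul q (gmul y a v) b) =
    fun v => sgn k (m + m * i) *: gmul q a (gmul x' v b).
  by apply: funext => v; apply: gmul_assoc; lia.
rewrite bang_mapZr //; last exact: clin_comp.
have -> : bang_map id (fun v : A (y - i - m) => gmul q a (gmul x' v b)) (copairing_at r (y - i - m)) =
    bang_map id (fun v : A x' => gmul q a v)
      (bang_map id (fun v : A (y - i - m) => gmul x' v b) (copairing_at r (y - i - m))).
  by rewrite bang_map_comp.
have -> : bang_map id (fun v : A (y - i - m) => gmul x' v b) (copairing_at r (y - i - m)) =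
    sgn k (m * r) *: (sgn k (m + (l - m) * j) *: bang_map (fun u : A y' => gmul r b u) id (copairing_at y' x')).
  rewrite -(lam_r b yx' jy' (erefl (r + x'))) (lam_l b e1 e3 (erefl (r + x'))).
  by rewrite scalerA sgnMM scale1r.
rewrite !bang_mapZ // bang_map_comp // !scalerA -!sgnD.
sgn_done.
Qed.

Section Ll.
Variables (r q x y : int).
Hypotheses (xy : x + y = l - m) (ix : i + x + m = r) (yj : y + j + m = q).

(** [ac' ! bc''] *)
Definition copairing_ll : cbang (A r) (A q) :=
  bang_map (fun u : A x => gmul r a u) (fun v : A y => gmul q b v) (copairing_at x y).

Lemma mid_elt_muop_ll :
  bang_comp r q (gcomponent ((mu ⊗! muop) ∘ mid_elt A A (lam ∘ eta))%G (r + q) (star_pure (i + j) a b)) =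
  sgn k ((l - m) * i + m * (i + x) + y * j + l * m + m) *: copairing_ll.
Proof.
rewrite (mid_elt_pure _ _ (x := x) (y := y)) //; [|exact: gcomp_ghom|exact: deg_lam_eta|by rewrite /=; lia].
have -> : (fun v : A y => gcomponent muop q (star_pure (y + j) v b)) =
    fun v => sgn k (y * j) *: gmul q b v by apply: funext => v; rewrite muopE.
rewrite -[fun u => gcomponent mu _ _]/(fun u : A x => gmul _ a u).
rewrite bang_mapZr // lam_eta // bang_mapZ // !scalerA -!sgnD; apply: eq_sgnZ; rewrite /= deg_eta; parity_done.
Qed.

Lemma mid_form_lamop_ll f z : ghom f -> gdeg f = m - l ->
  (forall n (t : star A A n), gcomponent f 0 t = z *: gcomponent p 0 t) ->
  bang_comp r q (gcomponent (mid_form A A f ∘ (lam ⊗* lamop))%G (r + q) (star_pure (i + j) a b)) =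
  (z * sgn k (l * i + (m - l) * r + y * j + l * y + m * l + (l - m) * i)) *: copairing_ll.
Proof.
move=> hf df fE; rewrite (form_lamop hf df fE (w := y)) //; last lia.
rewrite (lam_r _ xy ix) // bang_mapZ // bang_map_comp // scalerA -mulrA -sgnD.
by congr ((_ * _) *: _); apply: eq_sgn; parity_done.
Qed.
End Ll.
End TwoElements.

Let deg2 i j r q : r + q = i + j + (l + m) -> exists x y,
  [/\ x + y = l - m, i + x + m = r & y + j + m = q].
Proof. by move=> e; exists (r - i - m), (q - j - m); split; lia. Qed.

Lemma comp_right_left : comp_right mu lam = comp_left mu lam.
Proof.
apply: eq_ghom_star_bang => [||/=|i j r q a b /= rq]; [ghom_done|ghom_done|lia|].
have [|x [y [xy ix yj]]] := @deg2 i j r q; first lia.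
by rewrite (comp_right_lr a b xy ix yj) (comp_left_lr a b xy ix yj).
Qed.

Lemma comp_left_mid_elt : comp_left mu lam = ((mu ⊗! mu) ∘ mid_elt A A c)%G.
Proof.
apply: eq_ghom_star_bang => [||/=|i j r q a b /= rq]; [ghom_done|ghom_done|rewrite deg_eta; lia|].
have [|x [y [xy ix yj]]] := @deg2 i j r q; first lia.
by rewrite (comp_left_lr a b xy ix yj) (mid_elt_lr a b xy ix yj).
Qed.

Lemma lam_mu : (lam ∘ mu)%G = gscale (sgn k (l * m)) (comp_left mu lam).
Proof.
apply: eq_ghom_star_bang => [||/=|i j r q a b /= rq]; [ghom_done|ghom_done|lia|].
have [|x [y [xy ix yj]]] := @deg2 i j r q; first lia.
rewrite gscale_component bang_compZ (comp_left_lr a b xy ix yj) scalerA -sgnD.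
by rewrite (lam_mu_lr a b xy ix yj) addrA.
Qed.

Lemma mid_form_lam_lam f z : ghom f -> gdeg f = m - l ->
  (forall n (t : star A A n), gcomponent f 0 t = z *: gcomponent p 0 t) ->
  (mid_form A A f ∘ (lam ⊗* lam))%G = gscale z (lam ∘ mu)%G.
Proof.
move=> hf df fE.
apply: eq_ghom_star_bang => [||/=|i j r q a b /= rq]; [ghom_done|ghom_done|rewrite df; lia|].
have [|x [y [xy ix yj]]] := @deg2 i j r q; first by rewrite df in rq; lia.
rewrite gscale_component bang_compZ (lam_mu_lr a b xy ix yj) scalerA.
by rewrite (mid_form_lr a b xy ix yj hf df fE).
Qed.

Let h_epsmu : ghom (eps ∘ mu)%G. Proof. exact: gcomp_ghom. Qed.
Let d_epsmu : gdeg (eps ∘ mu)%G = m - l. Proof. by rewrite /= deg_eps. Qed.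
Let epsmuE n (t : star A A n) :
  gcomponent (eps ∘ mu)%G 0 t = sgn k l *: gcomponent p 0 t.
Proof. by rewrite gscale_component scalerA sgnMM scale1r. Qed.
Let pE n (t : star A A n) : gcomponent p 0 t = 1 *: gcomponent p 0 t.
Proof. by rewrite scale1r. Qed.

Lemma mid_form_pairing : (mid_form A A p ∘ (lam ⊗* lam) = lam ∘ mu)%G.
Proof. by rewrite (mid_form_lam_lam hp deg_p pE) gscale1. Qed.

(** The three terms on the left are equal up to sign, and so are the three on
    the right; in both cases the signs leave one copy, [c'a ! c''b] on the left
    and [bc' ! ac''] on the right, which [copairing_rrE] identifies. *)
Lemma infinitesimal_op :
  (± (m * (l + 1)) *: comp_left mu lamop
    + ± (l * (m + 1)) *: comp_right muop lam
    + (- sgn k (l + m)) *: ((muop ⊗! mu) ∘ mid_elt A A (lam ∘ eta))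
    = ± (l * m) *: (bang_tau A A ∘ comp_left muop lam)
      + (- sgn k ((l + 1) * (m + 1))) *: (bang_tau A A ∘ comp_right mu lamop)
      + (- sgn k m) *: (bang_tau A A ∘ (mu ⊗! muop) ∘ mid_elt A A (lam ∘ eta)))%G.
Proof.
apply: eq_ghom_star_bang => [||/=|i j r q a b /= rq]; [ghom_done|ghom_done|lia|].
have [|x [y [xy ix yj]]] := @deg2 i j r q; first lia.
have xi : x + i + m = r by lia.
have yx' : (r - j - m) + (q - i - m) = l - m by lia.
have jy' : j + (r - j - m) + m = r by lia.
have ix' : i + (q - i - m) + m = q by lia.
rewrite !gadd_component; try by rewrite /= ?deg_eta; lia.
rewrite !(is_linearD (@bang_comp_clin k _ _ _ _ _).1) !gscale_component !bang_compZ.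
rewrite (comp_left_lamop_rr a b xy xi yj) (comp_right_muop_rr a b xy xi yj) (mid_elt_muop_rr a b xy xi yj).
rewrite (tau_comp_left_muop a b yx' jy' ix') (tau_comp_right_lamop a b yx' jy' ix').
rewrite (tau_mid_elt_muop a b yx' jy' ix').
rewrite (copairing_rrE a b xy xi yj yx' jy' ix') !scaleNr !scalerA -!sgnD.
rewrite -!scaleNr -!scalerDl.
have sgn_sum e1 e2 e3 f1 f2 f3 : parity e2 = parity e1 -> parity e3 = parity e1 ->
    parity f1 = parity e1 -> parity f2 = ~~ parity e1 -> parity f3 = parity e1 ->
    sgn k e1 + sgn k e2 - sgn k e3 = sgn k f1 - sgn k f2 - sgn k f3.
  move=> h2 h3 h1' h2' h3'; rewrite !sgnE h2 h3 h1' h2' h3'.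
  by case: (parity e1); rewrite /= ?opprK.
have xE : x = r - i - m by lia.
have yE : y = q - j - m by lia.
have qE : q = i + j + l + m - r by lia.
congr (_ *: _); apply: sgn_sum; rewrite ?xE ?yE ?qE; parity_done.
Qed.


Lemma infinitesimal_op_l :
  ((muop ⊗! mu) ∘ mid_elt A A (lam ∘ eta) = mid_form A A (eps ∘ mu) ∘ (lamop ⊗* lam))%G.
Proof.
apply: eq_ghom_star_bang => [||/=|i j r q a b /= rq]; [ghom_done|ghom_done|rewrite deg_eta deg_eps; lia|].
have [|x [y [xy ix yj]]] := @deg2 i j r q; first by rewrite deg_eta in rq; lia.
have xi : x + i + m = r by lia.
rewrite (mid_elt_muop_rr a b xy xi yj) (mid_form_lamop_rr a b xy xi yj h_epsmu d_epsmu epsmuE) -sgnD.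
have xE : x = l - m - y by lia.
by apply: eq_sgnZ; rewrite -xi xE; parity_done.
Qed.

Lemma infinitesimal_op_r :
  ((mu ⊗! muop) ∘ mid_elt A A (lam ∘ eta) = mid_form A A (eps ∘ mu) ∘ (lam ⊗* lamop))%G.
Proof.
apply: eq_ghom_star_bang => [||/=|i j r q a b /= rq]; [ghom_done|ghom_done|rewrite deg_eta deg_eps; lia|].
have [|x [y [xy ix yj]]] := @deg2 i j r q; first by rewrite deg_eta in rq; lia.
rewrite (mid_elt_muop_ll a b xy ix yj) (mid_form_lamop_ll a b xy ix yj h_epsmu d_epsmu epsmuE) -sgnD.
have xE : x = l - m - y by lia.
by apply: eq_sgnZ; rewrite -ix xE; parity_done.
Qed.

(** Contracting [c''] with the first factor of the second copairing is
    [(mu ⊗ 1)(1 ⊗ c)], that is, [± lam]. *)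
Lemma mid_in_copairing :
  (mid_in A A mu ∘ (c ⊗* c) ∘ star_runit (gunit k) = gscale (sgn k l) ((1 ⊗! lam) ∘ c))%G.
Proof.
apply: eq_gmap => [|n j u /= e]; first by rewrite /= deg_eta; lia.
(* The source is concentrated in degree 0. *)
have [n0|n0] := eqVneq n 0; last first.
  by rewrite (gunit_eq0 u n0) !is_linear0 //; apply: (gcomponent_clin _ _ _).1; ghom_done.
rewrite {n} n0 deg_eta in u e *.
apply: bang_ext => r q rq; pose w := l - m - r.
rewrite (gcomp_component _ _ _ (j := 0)); last by rewrite /=.
rewrite star_runit_component (gcomp_component _ _ _ (j := l - m + (l - m))); last by rewrite /= deg_eta; lia.
rewrite (star_tens_pure _ _ _ hc hc (i' := l - m) (j' := l - m)) //; [|by rewrite deg_c; lia..].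
rewrite mulr0 sgn0 scale1r (mid_in_pure (r := w)) //; [|rewrite /w; lia..].
rewrite gscale_component bang_compZ (gcomp_component _ _ _ (j := l - m)); last by rewrite deg_c; lia.
rewrite (bang_tens_comp _ _ _ (i := r) (j := w)) //; [|rewrite /w /=; lia..].
rewrite gid_fun.
have -> : (fun v : A w => gcomponent ((mu ⊗! 1) ∘ gdistl A A A)%G q
      (star_pure (w + (l - m)) v (gcomponent c (l - m) (gone k)))) =
    fun v => sgn k (m + (l - m) * w) *: gcomponent lam q v.
  apply: funext => v.
  have -> : gcomponent lam q v =
      gcomponent (gscale (sgn k m) (comp_right mu c ∘ star_runit A))%G q v.
    by rewrite -(coFrobenius_lam_r H).
  rewrite gscale_component (gcomp_component (comp_right mu c) _ _ (j := w)); last by rewrite /=; lia.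
  rewrite star_runit_component /comp_right.
  rewrite (gcomp_component ((mu ⊗! 1) ∘ gdistl A A A)%G _ _ (j := w + (l - m))); last by rewrite /= deg_eta; lia.
  rewrite (star_tens_pure _ _ _ (@gid_ghom k A) hc (i' := w) (j' := l - m)) //; [|by rewrite ?deg_c /=; lia..].
  rewrite gid_component gcomponentZ; last by ghom_done.
  by rewrite deg_c !scalerA -!sgnD -[LHS]scale1r -[1](sgn0 k); sgn_done.
rewrite bang_mapZr //; last exact: gcomponent_clin.
by rewrite !scalerA -!sgnD; apply: eq_sgnZ; rewrite /w; parity_done.
Qed.

(** [(p ⊗ p)(1 ⊗ lam ⊗ 1)] is [p (1 ⊗ (1 ⊗ p)(lam ⊗ 1))] up to sign, and
    [(1 ⊗ p)(lam ⊗ 1) = ± mu].  The second argument is an arbitrary element of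
    the star product, so no decomposition of it is needed. *)
Lemma mid_out_pairing :
  (bang_lunit (gunit k) ∘ (p ⊗! p) ∘ mid_out A A lam =
   ± (gdeg p * m + m) *: (p ∘ (1 ⊗* mu)))%G.
Proof.
have hg := @bang_lunit_ghom k (gunit k) (@gunit_complete k).
pose h := (gdistr A A A ∘ (lam ⊗* 1))%G.
have hh : ghom h by rewrite /h; ghom_done.
apply: eq_ghom_star => [||/=|i j n a w /= e]; [ghom_done|ghom_done|rewrite deg_eps; lia|].
(* Both sides take values in the ground field, placed in degree 0. *)
have [n0|n0] := eqVneq n 0; last by rewrite [LHS]gunit_eq0 // [RHS]gunit_eq0.
rewrite {n} n0 deg_eps in e *; have ij : i + (j + m) = l - m by lia.
have dp : l - m + gdeg p = 0 by rewrite deg_p; lia.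
rewrite (gcomp_component _ _ _ (j := l - m + (l - m))); last by rewrite /=; lia.
rewrite (gcomp_component _ _ _ (j := 0)); last by rewrite /= deg_eps; lia.
rewrite bang_lunit_component (bang_tens_comp _ _ _ (i := l - m) (j := l - m)) //.
rewrite /mid_out (gcomp_component _ _ _ (j := i + (j + l))); last by rewrite /=; lia.
rewrite -/h (star_tens_pure _ _ _ (@gid_ghom k A) hh (i' := i) (j' := j + l)) //; [|by rewrite /=; lia..].
rewrite gid_component gcomponentZ ?bang_compZ; last by ghom_done.
rewrite (gdistl_comp _ _ _ _ _ (r := j + m)) //; [|by lia..].
set Y := bang_comp (j + m) (l - m) _.
have cp : clin (gcomponent p 0 : star A A (l - m) -> gunit k 0) by exact: gcomponent_clin.
pose g (u : A (j + m)) : gunit k 0 := gcomponent p 0 (star_pure (l - m) a u).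
have cg : clin g := clin_comp cp (star_pure_clinr _ _ _ _).
rewrite bang_mapZ // bang_map_comp //; [|exact: star_pure_clinr|exact: clin_id].
rewrite -/g.
rewrite gscale_component (gcomp_component _ _ _ (j := l - m)); last by rewrite /=; lia.
rewrite (star_tens_pure _ _ _ (@gid_ghom k A) hmu (i' := i) (j' := j + m)) //; last by rewrite /=; lia.
rewrite gid_component gcomponentZ // -/(g _).
have -> : gcomponent mu (j + m) w = sgn k (m * l + gdeg p * (j + m)) *:
    act_unit (bang_map id (gcomponent p 0) Y).
  have -> : gcomponent mu (j + m) w =
      gcomponent (gscale (sgn k (m * l)) (bang_runit A ∘ ((1 ⊗! p) ∘ h)))%G (j + m) w.
    by rewrite /h -[((1 ⊗! p) ∘ _)%G]gcompA -(coFrobenius_mu_r H).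
  rewrite gscale_component (gcomp_component _ _ _ (j := j + m)); last by rewrite /= deg_eps; lia.
  rewrite bang_runit_component (gcomp_component _ _ _ (j := j + l)); last by rewrite /=; lia.
  rewrite (bang_tens_comp _ _ _ (i := j + m) (j := l - m)) //; [|by rewrite /=; lia..].
  rewrite gid_fun (is_linearZ _ (act_unit_clin (cA _)).1).
  by rewrite scalerA -sgnD.
rewrite (is_linearZ _ cg.1) -act_unit_map //; last exact: gunit_complete.
rewrite bang_map_comp //; [|exact: clin_id..].
rewrite (is_linearZ _ (unit_act_clin (@gunit_complete k 0)).1).
rewrite (is_linearZ _ (unit_act_clin (@gunit_complete k 0)).1).
rewrite unit_actC !scalerA -!sgnD; apply: eq_sgnZ.
have -> : j = l - m - m - i by lia.
rewrite deg_p /=; parity_done.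
Qed.

Let counit_l : (bang_lunit A ∘ (eps ⊗! 1) ∘ lam = 1)%G.
Proof. by case: (coFrobenius_structure H) => _ _ _ _ []. Qed.
Let counit_r : (1 = ± l *: (bang_runit A ∘ (1 ⊗! eps) ∘ lam))%G.
Proof. by case: (coFrobenius_structure H) => _ _ _ _ []. Qed.
Let unit_l : (± m *: (mu ∘ (eta ⊗* 1) ∘ star_lunit A) = 1)%G.
Proof. by case: (coFrobenius_structure H) => _ _ []. Qed.
Let unit_r : (1 = mu ∘ (1 ⊗* eta) ∘ star_runit A)%G.
Proof. by case: (coFrobenius_structure H) => _ _ []. Qed.
Let assoc :
  (mu ∘ (mu ⊗* 1) ∘ star3l A A A = ± m *: (mu ∘ (1 ⊗* mu) ∘ star3r A A A))%G.
Proof. by case: (coFrobenius_structure H) => _ []. Qed.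
Let coassoc :
  (bang3l A A A ∘ (lam ⊗! 1) ∘ lam = ± l *: (bang3r A A A ∘ (1 ⊗! lam) ∘ lam))%G.
Proof. by case: (coFrobenius_structure H) => _ _ _ []. Qed.

Lemma pairing_atE i j t (a : A i) (b : A j) : i + j + m = t ->
  pairing_at a b = sgn k l *: gcomponent eps 0 (gmul t a b).
Proof.
by move=> ij; rewrite /pairing_at gscale_component (gcomp_component _ _ _ (j := t)).
Qed.

(** [c' p(c'', a) = ± c' eps(c''a) = ± a' eps(a'')], to which the counit
    applies. *)
Lemma copairing_pairing_l : (bang_runit A ∘ comp_left p c ∘ star_lunit A = 1)%G.
Proof.
apply: eq_gmap => [|i n a /= e]; first by rewrite /= deg_eta deg_eps; lia.
have ni : n = i by rewrite -e deg_eta deg_eps; lia.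
rewrite {n e}ni; have ir : i + (l - m - i) = l - m by lia.
rewrite (gcomp_component _ _ _ (j := i)); last by rewrite /=; lia.
rewrite star_lunit_component (runit_comp_left _ _ _ (r := l - m - i)) //; [|by lia|by rewrite deg_p; lia|by rewrite deg_c; lia].
rewrite deg_p ir -/(copairing_at i (l - m - i)).
have -> : gcomponent (gid A) i a =
    gcomponent (± l *: (bang_runit A ∘ (1 ⊗! eps) ∘ lam))%G i a by rewrite -counit_r.
rewrite gscale_component (gcomp_component _ _ _ (j := i + l)) //.
rewrite (gcomp_component _ _ _ (j := i)); last by rewrite /= deg_eps; lia.
rewrite bang_runit_component (bang_tens_comp _ _ _ (i := i) (j := l)) //; [|by rewrite /= ?deg_eps; lia..].
rewrite gid_fun (lam_l _ ir) //; last lia.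
have ce := gcomponent_clin l 0 heps.
rewrite bang_mapZ // bang_map_comp //.
have -> : (fun v : A (l - m - i) => gcomponent p 0 (star_pure (l - m - i + i) v a)) =
    fun v => sgn k l *: gcomponent eps 0 (gmul l v a).
  by apply: funext => v; apply: pairing_atE; lia.
rewrite bang_mapZr //; last exact: clin_comp.
rewrite !(is_linearZ _ (act_unit_clin (cA i)).1) !scalerA -!sgnD deg_eps.
sgn_done.
Qed.

Lemma copairing_pairing_r :
  (± (l + m) *: (bang_lunit A ∘ comp_right p c ∘ star_runit A) = 1)%G.
Proof.
apply: eq_gmap => [|i n a /= e]; first by rewrite /= deg_eta deg_eps; lia.
have ni : n = i by rewrite -e deg_eta deg_eps; lia.
rewrite {n e}ni; have ri : l - m - i + i = l - m by lia.
rewrite gscale_component (gcomp_component _ _ _ (j := i)); last by rewrite /=; lia.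
rewrite star_runit_component (lunit_comp_right _ _ _ (r := l - m - i)) //; [|by lia|by rewrite deg_p; lia|by rewrite deg_c; lia].
rewrite deg_c ri -/(copairing_at (l - m - i) i).
have -> : gcomponent (gid A) i a =
    gcomponent (bang_lunit A ∘ (eps ⊗! 1) ∘ lam)%G i a by rewrite counit_l.
rewrite (gcomp_component _ _ _ (j := i + l)) //.
rewrite (gcomp_component _ _ _ (j := i)); last by rewrite /= deg_eps; lia.
rewrite bang_lunit_component (bang_tens_comp _ _ _ (i := l) (j := i)) //; [|by rewrite /= ?deg_eps; lia..].
rewrite gid_fun (lam_r _ ri) //; [|by lia..].
have ce := gcomponent_clin l 0 heps.
rewrite bang_mapZ // bang_map_comp //.
have -> : (fun v : A (l - m - i) => gcomponent p 0 (star_pure (i + (l - m - i)) a v)) =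
    fun v => sgn k l *: gcomponent eps 0 (gmul l a v).
  by apply: funext => v; apply: pairing_atE; lia.
rewrite bang_mapZl //; last exact: clin_comp.
rewrite !(is_linearZ _ (unit_act_clin (cA i)).1) !scalerA -!sgnD.
sgn_done.
Qed.

Lemma pairing_assoc :
  (p ∘ (mu ⊗* 1) ∘ star3l A A A = ± m *: (p ∘ (1 ⊗* mu) ∘ star3r A A A))%G.
Proof.
rewrite !(gscale_comp, gcompA) -!(gcompA mu) assoc gcomp_scale // !gscaleA mulrC.
by [].
Qed.

Lemma copairing_coassoc :
  (bang3l A A A ∘ (lam ⊗! 1) ∘ c = ± l *: (bang3r A A A ∘ (1 ⊗! lam) ∘ c))%G.
Proof.
rewrite !gcomp_scale; [|by ghom_done..].
by rewrite -!(gcompA _ lam) coassoc gscale_comp !gscaleA mulrC.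
Qed.

Lemma pairing_unit_r : (± l *: eps = p ∘ (1 ⊗* eta) ∘ star_runit A)%G.
Proof. by rewrite !(gscale_comp, gcompA) -!(gcompA mu) -unit_r gcompf1. Qed.

Lemma pairing_unit_l : (± l *: eps = ± m *: (p ∘ (eta ⊗* 1) ∘ star_lunit A))%G.
Proof.
rewrite !(gscale_comp, gcompA) -!(gcompA mu) gscaleA mulrC -gscaleA -gcomp_scale //.
by rewrite unit_l gcompf1.
Qed.

Lemma copairing_counit_l :
  (± (l * m + m) *: eta = bang_lunit A ∘ (eps ⊗! 1) ∘ c)%G.
Proof. by rewrite gcomp_scale; [rewrite -gcompA counit_l gcomp1f|ghom_done]. Qed.

Lemma copairing_counit_r :
  (± (l * m + m) *: eta = ± l *: (bang_runit A ∘ (1 ⊗! eps) ∘ c))%G.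
Proof.
rewrite gcomp_scale; last by ghom_done.
by rewrite -gcompA gscaleA [sgn k l * _]mulrC -gscaleA -gscale_comp -counit_r gcomp1f.
Qed.

Lemma infinitesimal :
  biunital_infinitesimal_antisymmetric_bialgebra mu lam eta eps.
Proof.
have form := mid_form_lam_lam h_epsmu d_epsmu epsmuE.
split; [exact: coFrobenius_structure H|..].
- rewrite form comp_right_left.
  have -> : comp_left mu lam = (± (l * m) *: (lam ∘ mu))%G by rewrite lam_mu gscale_sgnK.
  apply: eq_gmap => // i n x e.
  rewrite gadd_component; last by rewrite /= ?deg_eps; lia.
  rewrite !gscale_component gadd_component // !gscale_component.
  by rewrite -scalerDr !scalerA mulNr !sgnMM scaleNr !scale1r addrK.
- rewrite form gscale_sgnK lam_mu.
  apply: eq_ghom_star_bang => [||/=|i j r q a b /= rq]; [ghom_done|ghom_done|rewrite deg_eta; lia|].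
  have [|x [y [xy ix yj]]] := @deg2 i j r q; first by lia.
  rewrite (gscale_component _ (comp_left mu lam)) (gscale_component _ ((mu ⊗! mu) ∘ _)%G).
  rewrite !bang_compZ (comp_left_lr a b xy ix yj) (mid_elt_lam_eta_lr a b xy ix yj).
  by rewrite !scalerA -!sgnD; sgn_done.
- exact: infinitesimal_op.
- exact: infinitesimal_op_l.
- exact: infinitesimal_op_r.
Qed.

Lemma coFrobenius_identities :
  ((bang3r A A A ∘ mid_in A A mu ∘ (c ⊗* c) ∘ star_runit (gunit k)
     = bang3l A A A ∘ (lam ⊗! 1) ∘ c) /\
   (± (gdeg p * m) *: (bang_lunit (gunit k) ∘ (p ⊗! p) ∘ mid_out A A lam ∘ star3r A A A)
     = p ∘ (mu ⊗* 1) ∘ star3l A A A))%G.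
Proof.
split.
  rewrite copairing_coassoc gcomp4A mid_in_copairing gcompA gcomp_scale //.
  exact: bang3r_ghom.
rewrite pairing_assoc mid_out_pairing gscale_comp gscaleA -sgnD.
by apply: eq_gscale_sgn; parity_done.
Qed.
End CoFrobenius.

Local Open Scope ring_scope.
Local Open Scope gmap_scope.

Theorem proposition4p7 (k : fieldType) (A : gspace k)
    (mu : gmap (star A A) A) (lam : gmap A (bang A A))
    (eta : gmap (gunit k) A) (eps : gmap A (gunit k)) :
  biunital_coFrobenius_bialgebra mu lam eta eps ->
  let c := copairing mu lam eta in
  let p := pairing mu lam eps in
  let m := gdeg mu in
  let l := gdeg lam in
  (bang3r A A A ∘ mid_in A A mu ∘ (c ⊗* c) ∘ star_runit (gunit k)
     = bang3l A A A ∘ (lam ⊗! 1) ∘ c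
   /\ ± (gdeg p * m) *: (bang_lunit (gunit k) ∘ (p ⊗! p) ∘ mid_out A A lam ∘ star3r A A A)
     = p ∘ (mu ⊗* 1) ∘ star3l A A A
   /\ comp_right mu lam = comp_left mu lam
   /\ comp_left mu lam = (mu ⊗! mu) ∘ mid_elt A A c
   /\ (mu ⊗! mu) ∘ mid_elt A A c = ± (l * m) *: (mid_form A A p ∘ (lam ⊗* lam))
   /\ ± (l * m) *: (mid_form A A p ∘ (lam ⊗* lam)) = ± (l * m) *: (lam ∘ mu))
  /\ (p ∘ (mu ⊗* 1) ∘ star3l A A A = ± m *: (p ∘ (1 ⊗* mu) ∘ star3r A A A)
   /\ bang3l A A A ∘ (lam ⊗! 1) ∘ c = ± l *: (bang3r A A A ∘ (1 ⊗! lam) ∘ c)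
   /\ ± l *: eps = p ∘ (1 ⊗* eta) ∘ star_runit A
   /\ p ∘ (1 ⊗* eta) ∘ star_runit A = ± m *: (p ∘ (eta ⊗* 1) ∘ star_lunit A)
   /\ ± (l * m + m) *: eta = bang_lunit A ∘ (eps ⊗! 1) ∘ c
   /\ bang_lunit A ∘ (eps ⊗! 1) ∘ c = ± l *: (bang_runit A ∘ (1 ⊗! eps) ∘ c)
   /\ bang_runit A ∘ comp_left p c ∘ star_lunit A
     = ± (l + m) *: (bang_lunit A ∘ comp_right p c ∘ star_runit A)
   /\ ± (l + m) *: (bang_lunit A ∘ comp_right p c ∘ star_runit A) = gid A)
  /\ biunital_infinitesimal_antisymmetric_bialgebra mu lam eta eps.
Proof.
move=> H c p m l; split; last split.
- split; first exact: (coFrobenius_identities H).1.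
  split; first exact: (coFrobenius_identities H).2.
  split; first exact: comp_right_left H.
  split; first exact: comp_left_mid_elt H.
  have -> : (mid_form A A p ∘ (lam ⊗* lam) = lam ∘ mu)%G by exact: mid_form_pairing H.
  by split=> //; rewrite (lam_mu H) gscale_sgnK; exact: esym (comp_left_mid_elt H).
- split; first exact: pairing_assoc H.
  split; first exact: copairing_coassoc H.
  split; first exact: pairing_unit_r H.
  split; first by rewrite -(pairing_unit_r H); exact: pairing_unit_l H.
  split; first exact: copairing_counit_l H.
  split; first by rewrite -(copairing_counit_l H); exact: copairing_counit_r H.
  by rewrite (copairing_pairing_r H) (copairing_pairing_l H).
- exact: infinitesimal H.
Qed.
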